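(* Let $G$ be a simply connected $2$-step nilpotent Lie group of dimension $7$ with Lie algebra $\mathfrak g$, and let $\varphi$ be a left-invariant $\mathrm G_2$-structure on $G$, viewed as an element of $\Lambda^3\mathfrak g^*$. Then $\varphi$ is coclosed and its characteristic connection is a $\mathrm G_2$-instanton if and only if there exists a basis $\{e^1,\dots,e^7\}$ of $\mathfrak g^*$ such that $$\varphi=e^{127}+e^{347}+e^{567}+e^{135}-e^{146}-e^{236}-e^{245}$$ and one of the following conditions holds: (1) $de^i=0$ for $i=1,\dots,6$ and $de^7=a(e^{12}-e^{56})+b(e^{34}-e^{56})$ for some $a,b\in\mathbb R$ not simultaneously zero; (2) $de^i=0$ for $i=1,\dots,4$ and $de^5=\nu(e^{13}-e^{24})$, $de^6=\nu(-e^{14}-e^{23})$, $de^7=\nu(e^{12}+e^{34})$ for some $\nu\in\mathbb R$, $\nu\neq0$; (3) $de^i=0$ for $i=1,\dots,4$ and $de^5=-2\nu e^{24}$, $de^6=-2\nu e^{23}$, $de^7=2\nu e^{34}$ for some $\nu\in\mathbb R$, $\nu\ne0$.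
   Context: Notation: $e^{ij\cdots}=e^i\wedge e^j\wedge\cdots$. A Lie algebra is $2$-step nilpotent if $[\mathfrak g,\mathfrak g]\neq0$ and $[\mathfrak g,[\mathfrak g,\mathfrak g]]=0$; a Lie group is $2$-step nilpotent if it is connected and its Lie algebra is. Left-invariant forms are identified with elements of $\Lambda^\bullet\mathfrak g^*$, and $d$ is then the Chevalley–Eilenberg differential, $d\xi(x,y)=-\xi([x,y])$ for $\xi\in\mathfrak g^*$. A $\mathrm G_2$-structure on $\mathfrak g$ is $\varphi\in\Lambda^3\mathfrak g^*$ that in some basis $\{e^i\}$ of $\mathfrak g^*$ equals $e^{127}+e^{347}+e^{567}+e^{135}-e^{146}-e^{236}-e^{245}$. It determines an inner product $g$ and a volume form by $(x\lrcorner\varphi)\wedge(y\lrcorner\varphi)\wedge\varphi=6g(x,y)\,\mathrm{vol}$ (such a basis is orthonormal and positively oriented), hence a Hodge star $\star$. Put $\psi=\star\varphi$. $\varphi$ is coclosed if $d\psi=0$. For coclosed $\varphi$, the characteristic connection $\nabla$ is the unique metric connection on $TG$ with totally skew-symmetric torsion and $\nabla\varphi=0$. Explicitly $g(\nabla_XY,Z)=g(\nabla^g_XY,Z)+\frac12T(X,Y,Z)$, where $\nabla^g$ is the Levi-Civita connection of $g$ and $T=\frac16\star(d\varphi\wedge\varphi)\,\varphi-\star d\varphi$. A connection $\nabla$ on $TG$ with curvature $R$ is a $\mathrm G_2$-instanton if $R\wedge\psi=0$, i.e. for all vectors $a,b$ the 2-form $(x,y)\mapsto g(R_{x,y}a,b)$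 wedged with $\psi$ vanishes. *)

(* Defs.v *)
From mathcomp Require Import all_boot all_order all_fingroup all_algebra.
From mathcomp Require Import boolp classical_sets functions reals.

Set Implicit Arguments.
Unset Strict Implicit.
Unset Printing Implicit Defensive.

Import Order.TTheory GRing.Theory Num.Theory.

Local Open Scope ring_scope.

(* A simply connected Lie group is determined by its Lie algebra, and every
   object below is left-invariant, so everything is expressed on a Lie algebra:
   a finite-dimensional real vector space V with a bracket br. *)

Definition fupd (I : eqType) (T : Type) (v : I -> T) (i : I) (x : T) : I -> T :=
  @dfwith I (fun=> T) v i x.

Section Forms.
Variables (R : realType) (V : vectType R).

(* Functions of k vectors.  The elements of Lambda^k V^* are the [k]-forms
   satisfying [is_form]; addition and scaling are pointwise. *)
Definition kform (k : nat) : Type := ('I_k -> V) -> R^o.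

Definition is_form (k : nat) (w : kform k) : Prop :=
  (forall (v : 'I_k -> V) (i : 'I_k) (a : R) (x y : V),
      w (fupd v i (a *: x + y)) = a * w (fupd v i x) + w (fupd v i y))
  /\ (forall (v : 'I_k -> V) (i j : 'I_k), i != j -> v i = v j -> w v = 0).

Definition fcat (T : Type) (p q : nat) (u : 'I_p -> T) (v : 'I_q -> T) :
    'I_(p + q) -> T :=
  fun i => match fintype.split i with inl a => u a | inr b => v b end.

Definition fcons (T : Type) (k : nat) (x : T) (v : 'I_k -> T) : 'I_k.+1 -> T :=
  fun i => if unlift ord0 i is Some j then v j else x.

(* Normalised so that (e^1 /\ ... /\ e^k)(x_1, ..., x_k) = det (e^i(x_j)). *)
Definition wedge (p q : nat) (a : kform p) (b : kform q) : kform (p + q) :=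
  fun v => ((p`! * q`!)%:R)^-1 *
    \sum_(s : 'S_(p + q))
      (-1) ^+ s * a (fun i => v (s (lshift q i))) * b (fun j => v (s (rshift p j))).

Definition contract (k : nat) (x : V) (w : kform k.+1) : kform k :=
  fun v => w (fcons x v).

Definition form_of_covector (f : 'Hom(V, R^o)) : kform 1 := fun v => f (v ord0).

(* e^{i_1 ... i_k} for a sequence e of covectors, numbered from 1. *)
Fixpoint monomial (e : seq 'Hom(V, R^o)) (I : seq nat) : kform (size I) :=
  match I return kform (size I) with
  | [::] => fun=> 1
  | i :: J => wedge (form_of_covector (nth 0 e i.-1)) (@monomial e J)
  end.

Definition bilinear_map (W : lmodType R) (f : V -> V -> W) : Prop :=
  (forall y, linear (f ^~ y)) /\ (forall x, linear (f x)).

Definition inner_product (g : V -> V -> R^o) : Prop :=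
  [/\ bilinear_map g, forall x y, g x y = g y x & forall x, x != 0 -> 0 < g x x].

Definition is_volume_form (n : nat) (g : V -> V -> R^o) (vol : kform n) : Prop :=
  is_form vol /\
  forall b : 'I_n -> V, (forall i j, g (b i) (b j) = (i == j)%:R) ->
    vol b = 1 \/ vol b = -1.

Local Notation b i := (tnth (vbasis {:V}) i).

Definition reciprocal_basis (g : V -> V -> R^o) (i : 'I_(\dim {:V})) : V :=
  \sum_j invmx (\matrix_(i, j) g (b i) (b j)) i j *: b j.

(* Hodge star in components, in an arbitrary basis b with g-reciprocal basis b':
   (star w)(y) = 1/k! sum_I w(b'_{i_1}, ..., b'_{i_k}) vol(b_{i_1}, ..., b_{i_k}, y),
   i.e. a /\ star w = g(a, w) vol.  Take vol : kform n with n = k + m = \dim V. *)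
Definition hodge (k m : nat) (g : V -> V -> R^o) (vol : kform (k + m))
    (w : kform k) : kform m :=
  fun y => (k`!%:R)^-1 *
    \sum_(I : {ffun 'I_k -> 'I_(\dim {:V})})
      w (fun r => reciprocal_basis g (I r)) * vol (fcat (fun r => b (I r)) y).

End Forms.
Arguments monomial {R V} e I : rename.

Section LieAlgebra.
Variables (R : realType) (V : vectType R) (br : V -> V -> V).

Definition lie_bracket : Prop :=
  [/\ bilinear_map br, forall x, br x x = 0 &
      forall x y z, br x (br y z) + br y (br z x) + br z (br x y) = 0].

Definition two_step_nilpotent : Prop :=
  (exists x y, br x y != 0) /\ (forall x y z, br x (br y z) = 0).

(* (dw)(v_0, ..., v_{k+1}) = sum_(p < q) (-1)^(p+q) w([v_p, v_q], v_0, .., v_{k+1})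
   with v_p, v_q omitted on the right; here p = i and q = lift i j = j + 1. *)
Definition ce_diff (k : nat) (w : kform V k.+1) : kform V k.+2 :=
  fun v => \sum_(i < k.+2) \sum_(j < k.+1 | (i <= j)%N)
    (-1) ^+ (i + j).+1 *
      w (fcons (br (v i) (v (lift i j))) (fun l => v (lift i (lift j l)))).

(* Left-invariant connections on TG are bilinear maps (x, y) |-> nabla_x y. *)
Definition metric_connection (g : V -> V -> R^o) (nabla : V -> V -> V) : Prop :=
  bilinear_map nabla /\
  forall x y z, g (nabla x y) z + g y (nabla x z) = 0.

Definition torsion (nabla : V -> V -> V) (x y : V) : V :=
  nabla x y - nabla y x - br x y.

Definition curvature (nabla : V -> V -> V) (x y a : V) : V :=
  nabla x (nabla y a) - nabla y (nabla x a) - nabla (br x y) a.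

Definition levi_civita (g : V -> V -> R^o) (nabla : V -> V -> V) : Prop :=
  metric_connection g nabla /\ forall x y, torsion nabla x y = 0.

Definition parallel (k : nat) (nabla : V -> V -> V) (w : kform V k) : Prop :=
  forall (x : V) (v : 'I_k -> V), \sum_(i < k) w (fupd v i (nabla x (v i))) = 0.

End LieAlgebra.

Section G2.
Variables (R : realType) (V : vectType R).

Definition g2_model (e : seq 'Hom(V, R^o)) : kform V 3 :=
  let e3 i j k : kform V 3 := monomial e [:: i; j; k] in
  e3 1 2 7 + e3 3 4 7
  + e3 5 6 7 + e3 1 3 5
  - e3 1 4 6 - e3 2 3 6
  - e3 2 4 5.

Definition g2_structure (phi : kform V 3) : Prop :=
  exists2 e : 7.-tuple 'Hom(V, R^o), basis_of fullv e & phi = g2_model e.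

(* The normalisation of vol with respect to g is what makes (g, vol) unique. *)
Definition g2_metric (phi : kform V 3) (g : V -> V -> R^o) (vol : kform V 7) :
    Prop :=
  [/\ inner_product g, is_volume_form g vol &
      forall x y, wedge (wedge (contract x phi) (contract y phi)) phi
                  = (6 * g x y) *: vol :> kform V 7].

Variables (br : V -> V -> V) (g : V -> V -> R^o) (vol : kform V 7).
Variable phi : kform V 3.

Definition g2_psi : kform V 4 := @hodge R V 3 4 g vol phi.

Definition coclosed : Prop := ce_diff br g2_psi = 0.

(* T = 1/6 star(dphi /\ phi) phi - star dphi; the 0-form star(dphi /\ phi) is a scalar,
   read off on the empty family. *)
Definition g2_torsion : kform V 3 :=
  let dphi := ce_diff br phi in
  (6^-1 * @hodge R V 7 0 g vol (wedge dphi phi) (fun=> 0)) *: phi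
  - @hodge R V 4 3 g vol dphi.

Definition vec3 (x y z : V) : 'I_3 -> V := fun i => nth 0 [:: x; y; z] i.

(* The first three clauses are the definition (metric, skew torsion, parallel
   phi); the last one is the explicit formula, which determines nabla. *)
Definition characteristic_connection (nabla : V -> V -> V) : Prop :=
  [/\ metric_connection g nabla,
      forall x y, g (torsion br nabla x y) y = 0,
      parallel nabla phi &
      exists2 LC, levi_civita br g LC &
        forall x y z,
          g (nabla x y) z = g (LC x y) z + 2^-1 * g2_torsion (vec3 x y z)].

Definition g2_instanton (nabla : V -> V -> V) : Prop :=
  forall a b : V,
    wedge ((fun v => g (curvature br nabla (v ord0) (v ord_max) a) b) : kform V 2)
          g2_psi = 0.

End G2.

Section StructureEquations.
Variables (R : realType) (V : vectType R) (br : V -> V -> V).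
Variable e : seq 'Hom(V, R^o).

Local Notation e2 i j := (monomial e [:: i; j]%N : kform V 2).

Definition d_basis (i : nat) : kform V 2 :=
  ce_diff br (form_of_covector (nth 0 e i.-1)).

Definition structure_eqs1 : Prop :=
  (forall i, (1 <= i <= 6)%N -> d_basis i = 0) /\
  exists a b : R, (a, b) != (0, 0) /\
    d_basis 7 = a *: (e2 1 2 - e2 5 6)
                + b *: (e2 3 4 - e2 5 6).

Definition structure_eqs2 : Prop :=
  (forall i, (1 <= i <= 4)%N -> d_basis i = 0) /\
  exists nu : R,
    [/\ nu != 0,
        d_basis 5 = nu *: (e2 1 3 - e2 2 4),
        d_basis 6 = nu *: (- e2 1 4 - e2 2 3) &
        d_basis 7 = nu *: (e2 1 2 + e2 3 4)].

Definition structure_eqs3 : Prop :=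
  (forall i, (1 <= i <= 4)%N -> d_basis i = 0) /\
  exists nu : R,
    [/\ nu != 0,
        d_basis 5 = (- 2 * nu) *: e2 2 4,
        d_basis 6 = (- 2 * nu) *: e2 2 3 &
        d_basis 7 = (2 * nu) *: e2 3 4].

End StructureEquations.

(* Main.v *)
From Stdlib Require Import ZArith.
From HB Require Import structures.
Require Import Defs.
From mathcomp Require Import all_boot all_order all_fingroup all_algebra.
From mathcomp Require Import boolp classical_sets functions reals.
From mathcomp Require Import ssrZ zify ring lra complex.

Set Implicit Arguments.
Unset Strict Implicit.
Unset Printing Implicit Defensive.

Import Order.TTheory GRing.Theory Num.Theory.

Local Open Scope ring_scope.
Local Delimit Scope Z_scope with BZ.

(** * Alternating forms and their values on frames *)

Section Multilinear.
Variables (R : realType) (V : vectType R).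

Definition multilinear (k : nat) (w : kform V k) : Prop :=
  forall (v : 'I_k -> V) (i : 'I_k) (a : R) (x y : V),
    w (fupd v i (a *: x + y)) = a * w (fupd v i x) + w (fupd v i y).

Definition alternating (k : nat) (w : kform V k) : Prop :=
  forall (s : 'S_k) (v : 'I_k -> V), w (fun i => v (s i)) = (-1) ^+ s * w v.

Lemma fupd_same (I : eqType) (T : Type) (v : I -> T) i x : fupd v i x i = x.
Proof. exact: dfwith_in. Qed.

Lemma fupd_other (I : eqType) (T : Type) (v : I -> T) i x j :
  j != i -> fupd v i x j = v j.
Proof. by rewrite eq_sym => ij; rewrite /fupd dfwith_out. Qed.

Lemma fupd_id (I : eqType) (T : Type) (v : I -> T) i : fupd v i (v i) = v.
Proof.
apply/funext => j; have [->|ji] := eqVneq j i; first by rewrite fupd_same.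
by rewrite fupd_other.
Qed.

Lemma multilinear0 k (w : kform V k) v i : multilinear w -> w (fupd v i 0) = 0.
Proof.
move=> wL; have := wL v i 1 0 0; rewrite scale1r addr0 mul1r => /eqP.
by rewrite -subr_eq0 opprD addrA subrr sub0r oppr_eq0 => /eqP.
Qed.

Lemma multilinear_sum k (w : kform V k) v i (J : Type) (r : seq J) (P : pred J)
    (a : J -> R) (x : J -> V) : multilinear w ->
  w (fupd v i (\sum_(j <- r | P j) a j *: x j))
    = \sum_(j <- r | P j) a j * w (fupd v i (x j)).
Proof.
move=> wL; elim/big_rec2: _ => [|j y z _ <-]; first exact: multilinear0.
by rewrite wL.
Qed.

(** A multilinear function is determined by its values on a generating family:
    the entries are replaced one by one by members of the family. *)
Lemma multilinear_eq0 k n (w : kform V k) (f : 'I_n -> V) (xi : 'I_n -> V -> R) :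
    (forall v, v = \sum_j xi j v *: f j) -> multilinear w ->
    (forall I : 'I_k -> 'I_n, w (fun i => f (I i)) = 0) ->
  forall v, w v = 0.
Proof.
move=> fE wL w0.
suff H m : (m <= k)%N -> forall v, (forall i : 'I_k, (m <= i)%N -> exists j, v i = f j) ->
    w v = 0.
  move=> v; apply: (H k) => // i; by rewrite leqNgt ltn_ord.
elim: m => [|m IH] mk v vf.
  have {}vf i : {j | v i = f j} by apply: cid; apply: vf.
  by rewrite (_ : v = fun i => f (projT1 (vf i))) //; apply/funext => i; case: (vf i).
pose i0 := Ordinal mk.
rewrite -(fupd_id v i0) (fE (v i0)) multilinear_sum // big1 // => j _.
rewrite IH ?mulr0 // => [|i mi]; first exact: ltnW.
have [->|ii0] := eqVneq i i0; first by exists j; rewrite fupd_same.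
by rewrite fupd_other //; apply: vf; rewrite ltn_neqAle mi andbT eq_sym.
Qed.

Lemma multilinear_sub k (w w' : kform V k) :
  multilinear w -> multilinear w' -> multilinear (fun v => w v - w' v).
Proof. by move=> wL wL' v i a x y; rewrite wL wL' mulrBr opprD addrACA. Qed.

Lemma multilinear_ext k n (w w' : kform V k) (f : 'I_n -> V) (xi : 'I_n -> V -> R) :
    (forall v, v = \sum_j xi j v *: f j) -> multilinear w -> multilinear w' ->
    (forall I : 'I_k -> 'I_n, w (fun i => f (I i)) = w' (fun i => f (I i))) ->
  w = w'.
Proof.
move=> fE wL wL' ww'; apply/funext => v; apply/eqP; rewrite -subr_eq0; apply/eqP.
apply: (multilinear_eq0 fE (multilinear_sub wL wL')) => I.
by rewrite ww' subrr.
Qed.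

Lemma fupd2 (I : eqType) (T : Type) (v : I -> T) i j x y :
  i != j -> fupd (fupd v i x) j y = fupd (fupd v j y) i x.
Proof.
move=> ij; apply/funext => l.
have [->|lj] := eqVneq l j; first by rewrite fupd_same fupd_other 1?eq_sym // fupd_same.
rewrite fupd_other //; have [->|li] := eqVneq l i; first by rewrite !fupd_same.
by rewrite !fupd_other.
Qed.

Lemma fupdK (I : eqType) (T : Type) (v : I -> T) i x y :
  fupd (fupd v i x) i y = fupd v i y.
Proof.
apply/funext => l; have [->|li] := eqVneq l i; first by rewrite !fupd_same.
by rewrite !fupd_other.
Qed.

Lemma is_form_multilinear k (w : kform V k) : is_form w -> multilinear w.
Proof. by case. Qed.

Lemma is_form_alternating k (w : kform V k) : is_form w -> alternating w.
Proof.
move=> [wL w0] s v.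
have wD u i x y : w (fupd u i (x + y)) = w (fupd u i x) + w (fupd u i y).
  by have := wL u i 1 x y; rewrite scale1r mul1r.
have w2 (i j : 'I_k) x u : i != j -> w (fupd (fupd u i x) j x) = 0.
  by move=> ij; apply: (w0 _ i j ij); rewrite fupd_same fupd_other // fupd_same.
have wT (i j : 'I_k) u : i != j -> w (fun l => u (tperm i j l)) = - w u.
  move=> ij; pose x := u i; pose y := u j.
  have E1 : (fun l => u (tperm i j l)) = fupd (fupd u i y) j x.
    apply/funext => l; case: tpermP => [->|->|li lj].
    - by rewrite fupd_other // fupd_same.
    - by rewrite fupd_same.
    - by rewrite !fupd_other //; apply/eqP.
  have E2 : u = fupd (fupd u i x) j y by rewrite !fupd_id.
  apply/eqP; rewrite E1 {2}E2 -addr_eq0; apply/eqP.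
  have := w2 i j (x + y) u ij; rewrite wD !(fupd2 _ _ _ ij) !wD.
  by rewrite -!(fupd2 _ _ _ ij) !w2 // add0r addr0 addrC.
have [ts -> /=] := prod_tpermP s.
elim: ts v => [|t ts IH] v /=.
  by rewrite big_nil odd_perm1 expr0 mul1r => _; congr w; apply/funext => i; rewrite perm1.
move=> /andP[t12 tsd]; rewrite big_cons odd_permM odd_tperm t12 signr_addb mulN1r mulNr.
have E : (fun i => v ((tperm t.1 t.2 * \prod_(j <- ts) tperm j.1 j.2)%g i)) =
   (fun i => (fun l => v ((\prod_(j <- ts) tperm j.1 j.2)%g l)) (tperm t.1 t.2 i)).
  by apply/funext => i; rewrite permM.
by rewrite E (wT _ _ (fun l => v ((\prod_(j <- ts) tperm j.1 j.2)%g l))) // IH.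
Qed.

(** The vanishing on repeated entries comes from [w = - w] under their exchange. *)
Lemma alternating_repeat k (w : kform V k) v i j :
  alternating w -> i != j -> v i = v j -> w v = 0.
Proof.
move=> wA ij vij.
have := wA (tperm i j) v; rewrite odd_tperm ij expr1 mulN1r.
rewrite (_ : (fun l => _) = v); first by move/eqP; rewrite eq_sym eqNr => /eqP.
by apply/funext => l; case: tpermP => // ->.
Qed.

Lemma is_formP k (w : kform V k) : multilinear w -> alternating w -> is_form w.
Proof. by move=> wL wA; split=> // v i j; apply: alternating_repeat. Qed.

Lemma wedge_alternating p q (a : kform V p) (b : kform V q) :
  alternating (wedge a b).
Proof.
move=> s v; rewrite /wedge mulrCA; congr (_ * _).
rewrite (reindex_inj (mulIg s^-1)%g) big_distrr /=; apply: eq_bigr => t _.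
rewrite odd_permM odd_permV addbC signr_addb -!mulrA; congr (_ * (_ * (_ * _))).
  by congr a; apply/funext => i; rewrite permM permKV.
by congr b; apply/funext => i; rewrite permM permKV.
Qed.

Lemma wedge_multilinear p q (a : kform V p) (b : kform V q) :
  multilinear a -> multilinear b -> multilinear (wedge a b).
Proof.
move=> aL bL v i c x y; rewrite /wedge mulrCA -mulrDr; congr (_ * _).
rewrite big_distrr -big_split /=; apply: eq_bigr => s _.
pose j := (s^-1)%g i; have sj : s j = i by rewrite permKV.
have other l z : l != j -> fupd v i z (s l) = v (s l).
  move=> lj; rewrite fupd_other //; apply: contra lj => /eqP sl.
  by apply/eqP; rewrite /j -sl permK.
have [j1 jE|j2 jE] := fintype.splitP j.
  have {}jE : j = lshift q j1 by apply: val_inj.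
  have aE z : (fun l => fupd v i z (s (lshift q l))) = fupd (fun l => v (s (lshift q l))) j1 z.
    apply/funext => l; have [->|lj] := eqVneq l j1.
      by rewrite -jE sj !fupd_same.
    by rewrite (fupd_other _ _ lj) other // jE (inj_eq (@lshift_inj _ _)).
  have bE z : (fun l => fupd v i z (s (rshift p l))) = (fun l => v (s (rshift p l))).
    by apply/funext => l; rewrite other // jE eq_rlshift.
  by rewrite !aE !bE aL mulrDr mulrDl !mulrA (mulrC _ c) -!mulrA.
have {}jE : j = rshift p j2 by apply: val_inj.
have bE z : (fun l => fupd v i z (s (rshift p l))) = fupd (fun l => v (s (rshift p l))) j2 z.
  apply/funext => l; have [->|lj] := eqVneq l j2.
    by rewrite -jE sj !fupd_same.
  by rewrite (fupd_other _ _ lj) other // jE (inj_eq (@rshift_inj _ _)).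
have aE z : (fun l => fupd v i z (s (lshift q l))) = (fun l => v (s (lshift q l))).
  by apply/funext => l; rewrite other // jE eq_lrshift.
by rewrite !aE !bE bL mulrDr mulrCA.
Qed.

Lemma wedge_is_form p q (a : kform V p) (b : kform V q) :
  multilinear a -> multilinear b -> is_form (wedge a b).
Proof. by move=> aL bL; apply: is_formP; [exact: wedge_multilinear|exact: wedge_alternating]. Qed.

Lemma covector_is_form (f : 'Hom(V, R^o)) : is_form (form_of_covector f).
Proof.
split=> [v i a x y|v i j]; last by rewrite !ord1.
by rewrite /form_of_covector (ord1 i) !fupd_same linearP.
Qed.

Lemma monomial_is_form (e : seq 'Hom(V, R^o)) (I : seq nat) : is_form (monomial e I).
Proof.
case: I => [|i I] /=; first by split=> [v []//|v []].
apply: (@wedge_is_form 1 (size I)); first by case: (covector_is_form (nth 0 e i.-1)).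
elim: I => [|j I IH] /=; first by move=> v [].
by apply: (@wedge_multilinear 1 (size I)) => //; case: (covector_is_form (nth 0 e j.-1)).
Qed.

Lemma is_formD k (w w' : kform V k) : is_form w -> is_form w' -> is_form (w + w').
Proof.
move=> [wL w0] [wL' w0']; split=> [v i a x y|v i j ij vij] /=.
  by rewrite /GRing.add /= wL wL' mulrDr addrACA.
by rewrite /GRing.add /= (w0 _ _ _ ij vij) (w0' _ _ _ ij vij) addr0.
Qed.

Lemma is_formN k (w : kform V k) : is_form w -> is_form (- w).
Proof.
move=> [wL w0]; split=> [v i a x y|v i j ij vij] /=.
  by rewrite /GRing.opp /= wL opprD mulrN.
by rewrite /GRing.opp /= (w0 _ _ _ ij vij) oppr0.
Qed.

Lemma contract_is_form k (x : V) (w : kform V k.+1) :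
  is_form w -> is_form (contract x w).
Proof.
move=> [wL w0].
have E v i t : fcons x (fupd v i t) = fupd (fcons x v) (lift ord0 i) t.
  apply/funext => l; have [l1 ->|->] := unliftP ord0 l.
    rewrite /fcons liftK; have [->|li] := eqVneq l1 i; first by rewrite !fupd_same.
    by rewrite !fupd_other ?(inj_eq lift_inj) ?liftK.
  by rewrite fupd_other ?neq_lift // /fcons unlift_none.
split=> [v i a y z|v i j ij vij]; rewrite /contract; first by rewrite !E wL.
by apply: (w0 _ (lift ord0 i) (lift ord0 j)); rewrite ?(inj_eq lift_inj) // /fcons !liftK.
Qed.

Lemma g2_model_is_form (e : seq 'Hom(V, R^o)) : is_form (g2_model e).
Proof.
have e3 i j k : is_form (monomial e [:: i; j; k] : kform V 3).
  exact: (monomial_is_form e [:: i; j; k]).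
rewrite /g2_model; cbv zeta; do 3!(apply: is_formD; last by apply: is_formN; exact: e3).
by do 3!(apply: is_formD; last exact: e3); exact: e3.
Qed.

End Multilinear.

(** * Arithmetic shared by real components and by computed polynomials *)

(** The components of all forms below are produced by programs that use nothing
    but these three operations.  Run on real numbers they are the components;
    run on polynomials they can be computed, and [arith_hom] relates both. *)
Record arith (T : Type) : Type :=
  Arith { aadd : T -> T -> T; amul : T -> T -> T; acst : Z -> T }.

Record arith_hom (T T' : Type) (A : arith T) (A' : arith T') (h : T -> T') : Prop :=
  ArithHom {
    hom_add : forall x y, h (aadd A x y) = aadd A' (h x) (h y);
    hom_mul : forall x y, h (amul A x y) = amul A' (h x) (h y);
    hom_cst : forall z, h (acst A z) = acst A' z }.

Definition Zarith : arith Z := Arith Z.add Z.mul id.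

Definition realZ (R : pzRingType) (z : Z) : R := (int_of_Z z)%:~R.

Definition Rarith (R : pzRingType) : arith R := Arith +%R *%R (@realZ R).

Lemma realZ_hom (R : pzRingType) : arith_hom Zarith (Rarith R) (@realZ R).
Proof.
split=> [x y|x y|//] /=; rewrite /realZ.
  by rewrite -intrD -(rmorphD int_of_Z).
by rewrite -intrM -(rmorphM int_of_Z).
Qed.

Section Programs.
Variables (T : Type) (A : arith T).

Definition asum (J : Type) (r : seq J) (F : J -> T) : T :=
  foldr (fun j => aadd A (F j)) (acst A 0%BZ) r.

Definition asign (n : nat) : T := acst A (if odd n then (-1)%BZ else 1%BZ).

(** The sum over all ways of splitting [s] into a subsequence of length [p] for
    [a] and one of length [q] for [b], with the sign of the shuffle. *)
Fixpoint shuffle (p q : nat) (a b : seq nat -> T) (s : seq nat) : T :=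
  if s is x :: s' then
    aadd A (if p is p'.+1 then shuffle p' q (fun l => a (x :: l)) b s' else acst A 0%BZ)
           (if q is q'.+1 then
              amul A (asign p) (shuffle p q' a (fun l => b (x :: l)) s')
            else acst A 0%BZ)
  else amul A (a [::]) (b [::]).

(** [c i j m] stands for the [m]-th component of the bracket of the [i]-th and
    [j]-th basis vectors. *)
Definition ce_comp (k : nat) (c : nat -> nat -> nat -> T) (w : seq nat -> T)
    (s : seq nat) : T :=
  asum (iota 0 k.+2) (fun i => asum [seq j <- iota 0 k.+1 | (i <= j)%N] (fun j =>
    amul A (asign (i + j).+1)
      (asum (iota 0 7) (fun m =>
        amul A (c (nth 0%N s i) (nth 0%N s (bump i j)) m)
          (w (m :: [seq nth 0%N s (bump i (bump j l)) | l <- iota 0 k])))))).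

(** The number of exchanges of neighbours that sort [s] into [r], for [s] a
    rearrangement of [r]. *)
Fixpoint exchanges (r s : seq nat) : nat :=
  if r is x :: r' then (index x s + exchanges r' (rem x s))%N else 0.

Definition hodge_comp (w : seq nat -> T) (s : seq nat) : T :=
  let r := [seq i <- iota 0 7 | i \notin s] in
  if uniq s then amul A (asign (exchanges (iota 0 7) (r ++ s))) (w r)
  else acst A 0%BZ.

Fixpoint monomial_comp (I : seq nat) (s : seq nat) : T :=
  if I is i :: I' then
    shuffle 1 (size I') (fun l => acst A (if l == [:: i.-1] then 1%BZ else 0%BZ))
      (monomial_comp I') s
  else acst A 1%BZ.

Definition model_comp (s : seq nat) : T :=
  let m I := monomial_comp I s in
  let neg x := amul A (acst A (-1)%BZ) x in
  aadd A (aadd A (aadd A (aadd A (aadd A (aadd A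
    (m [:: 1; 2; 7]) (m [:: 3; 4; 7])) (m [:: 5; 6; 7])) (m [:: 1; 3; 5]))
    (neg (m [:: 1; 4; 6]))) (neg (m [:: 2; 3; 6]))) (neg (m [:: 2; 4; 5])).

End Programs.

Definition index7 : pred nat := fun i => (i < 7)%N.

Fixpoint table (T : Type) (k : nat) (f : seq nat -> T) : seq T :=
  if k is k'.+1 then flatten [seq table k' (fun l => f (i :: l)) | i <- iota 0 7]
  else [:: f [::]].

Definition table_pos (s : seq nat) : nat := foldl (fun n i => (7 * n + i)%N) 0%N s.

Definition lookup (T : Type) (x : T) (t : seq T) (s : seq nat) : T := nth x t (table_pos s).

Lemma size_table (T : Type) k (f : seq nat -> T) : size (table k f) = (7 ^ k)%N.
Proof.
elim: k f => [//|k IH] f /=; rewrite !size_cat !IH /= expnS; nia.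
Qed.

Lemma nth_flatten_uniform (T : Type) (x : T) n (ss : seq (seq T)) i p :
    all (fun t => size t == n) ss -> (p < n)%N ->
  nth x (flatten ss) (i * n + p) = nth x (nth [::] ss i) p.
Proof.
elim: ss i => [|t ss IH] i /=; first by rewrite !nth_nil.
move=> /andP[/eqP tn ssn] pn; rewrite nth_cat tn.
case: i => [|i]; first by rewrite mul0n add0n pn.
by rewrite mulSn -addnA ltnNge leq_addr /= addKn IH.
Qed.

Lemma lookup_table (T : Type) (x : T) k (f : seq nat -> T) s :
  size s = k -> all index7 s -> lookup x (table k f) s = f s.
Proof.
rewrite /lookup.
have foldlE n l : foldl (fun n i => (7 * n + i)%N) n l = (n * 7 ^ size l + table_pos l)%N.
  rewrite /table_pos; elim: l n => [|i l IH] n /=; first by rewrite expn0; lia.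
  by rewrite IH (IH i) expnS; nia.
have pos_lt l : all index7 l -> (table_pos l < 7 ^ size l)%N.
  elim: l => [//|i l IH] /= /andP[i7 /IH l7].
  by rewrite /table_pos /= foldlE expnS; rewrite /index7 in i7; nia.
elim: k f s => [|k IH] f [|i s] //; rewrite [size _]/=.
move=> [sk] /andP[i7 s7]; 
rewrite -[table _ _]/(flatten [seq table k (fun l => f (j :: l)) | j <- iota 0 7]).
rewrite /table_pos [foldl _ _ _]/= muln0 add0n foldlE sk nth_flatten_uniform.
- rewrite (nth_map 0%N) ?size_iota // nth_iota // add0n.
  exact: (IH (fun l => f (i :: l))).
- by rewrite all_map (eq_all (a2 := predT)) ?all_predT // => j /=; rewrite size_table eqxx.
- by rewrite -sk pos_lt.
Qed.

Definition phi_table : seq Z := Eval vm_compute in table 3 (model_comp Zarith).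

(** The components of the model form and of its Hodge dual. *)
Definition phiZ (s : seq nat) : Z := lookup 0%BZ phi_table s.

Definition psi_table : seq Z := Eval vm_compute in table 4 (hodge_comp Zarith phiZ).

Definition psiZ (s : seq nat) : Z := lookup 0%BZ psi_table s.

Lemma phiZE s : size s = 3%N -> all index7 s -> phiZ s = model_comp Zarith s.
Proof.
move=> s3 s7; rewrite -[RHS](lookup_table 0%BZ _ s3 s7) /phiZ; congr lookup.
Qed.

Lemma psiZE s : size s = 4%N -> all index7 s -> psiZ s = hodge_comp Zarith phiZ s.
Proof.
move=> s4 s7; rewrite -[RHS](lookup_table 0%BZ _ s4 s7) /psiZ; congr lookup.
Qed.

Section ProgramHom.
Variables (T T' : Type) (A : arith T) (A' : arith T') (h : T -> T').
Hypothesis hP : arith_hom A A' h.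

Lemma hom_asum (J : Type) (r : seq J) F F' :
  (forall j, h (F j) = F' j) -> h (asum A r F) = asum A' r F'.
Proof.
move=> FF'; elim: r => [|j r IH] /=; first exact: hom_cst hP _.
by rewrite (hom_add hP) FF' -IH.
Qed.

Lemma hom_asign n : h (asign A n) = asign A' n.
Proof. exact: hom_cst hP _. Qed.

Lemma hom_shuffle p q a b a' b' s :
    (forall l, h (a l) = a' l) -> (forall l, h (b l) = b' l) ->
  h (shuffle A p q a b s) = shuffle A' p q a' b' s.
Proof.
elim: s p q a b a' b' => [|x s IH] p q a b a' b' aE bE /=.
  by rewrite (hom_mul hP) aE bE.
rewrite (hom_add hP); congr (aadd _ _ _).
  by case: p => [|p]; [exact: hom_cst hP _|exact: IH].
case: q => [|q]; first exact: hom_cst hP _.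
by rewrite (hom_mul hP) hom_asign (IH _ _ _ _ a' (fun l => b' (x :: l))).
Qed.

Lemma hom_ce_comp k c c' w w' s :
    (forall i j m, h (c i j m) = c' i j m) -> (forall l, h (w l) = w' l) ->
  h (ce_comp A k c w s) = ce_comp A' k c' w' s.
Proof.
move=> cE wE; apply: hom_asum => i; apply: hom_asum => j.
rewrite (hom_mul hP) hom_asign; congr (amul _ _ _); apply: hom_asum => m.
by rewrite (hom_mul hP) cE wE.
Qed.

Lemma hom_hodge_comp w w' s :
  (forall l, h (w l) = w' l) -> h (hodge_comp A w s) = hodge_comp A' w' s.
Proof.
move=> wE; rewrite /hodge_comp; case: (uniq s); last exact: hom_cst hP _.
by rewrite (hom_mul hP) hom_asign wE.
Qed.

Lemma hom_monomial_comp I s : h (monomial_comp A I s) = monomial_comp A' I s.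
Proof.
elim: I s => [|i I IH] s /=; first exact: hom_cst hP _.
by apply: hom_shuffle => // l; apply: hom_cst hP _.
Qed.

Lemma hom_model_comp s : h (model_comp A s) = model_comp A' s.
Proof.
by rewrite /model_comp !(hom_add hP) !(hom_mul hP) !(hom_cst hP) !hom_monomial_comp.
Qed.

End ProgramHom.

Lemma asumE (R : pzRingType) (J : Type) (r : seq J) (F : J -> R) :
  asum (Rarith R) r F = \sum_(j <- r) F j.
Proof. by elim: r => [|j r IH]; rewrite /asum /= ?big_nil ?big_cons -?IH. Qed.

Lemma asignE (R : pzRingType) n : asign (Rarith R) n = (-1) ^+ n.
Proof. by rewrite -signr_odd /asign /= /realZ; case: (odd n). Qed.

(** * Sums over permutations as sums over shuffles *)

Definition ins (T : Type) (j : nat) (x : T) (l : seq T) := take j l ++ x :: drop j l.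

Lemma size_ins T j (x : T) l : size (ins j x l) = (size l).+1.
Proof. by rewrite /ins size_cat /= addnS -size_cat cat_take_drop. Qed.

Lemma ins_cons T j (x y : T) l : y :: ins j x l = ins j.+1 x (y :: l).
Proof. by []. Qed.

Lemma take_ins T p j (x : T) l :
  (j <= p)%N -> take p.+1 (ins j x l) = ins j x (take p l).
Proof.
elim: j p l => [|j IH] [|p] [|y l] //= jp; rewrite /ins /= ?drop0 ?take0 //.
by congr (_ :: _); apply: IH.
Qed.

Lemma drop_ins T p j (x : T) l :
  (j <= p)%N -> drop p.+1 (ins j x l) = drop p l.
Proof.
elim: j p l => [|j IH] [|p] [|y l] //= jp; rewrite /ins /= ?drop0 //.
exact: IH.
Qed.

Lemma take_ins_ge T p j (x : T) l :
  (p <= j)%N -> (p <= size l)%N -> take p (ins j x l) = take p l.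
Proof.
by elim: p j l => [|p IH] [|j] [|y l] //= pj pl; rewrite ?take0 // IH.
Qed.

Lemma drop_ins_ge T p j (x : T) l :
  (p <= j)%N -> (p <= size l)%N -> drop p (ins j x l) = ins (j - p) x (drop p l).
Proof.
by elim: p j l => [|p IH] [|j] [|y l] //= pj pl; rewrite ?drop0 ?subn0 // IH.
Qed.

Section Shuffles.
Variable R : realType.
Implicit Types (a b f : seq nat -> R).

(** The property of the components of an alternating form of degree [p]: an
    entry moved to the front changes the sign once for each entry it passes. *)
Definition alt_comp (p : nat) f : Prop :=
  forall x l j, (size l).+1 = p -> (j <= size l)%N ->
    f (ins j x l) = (-1) ^+ j * f (x :: l).

Lemma alt_comp_contract p f x :
  alt_comp p.+1 f -> alt_comp p (fun l => f (x :: l)).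
Proof.
move=> fA y l j sl jl; rewrite ins_cons fA /=; [|by rewrite sl|exact: jl].
have -> : f (y :: x :: l) = (-1) ^+ 1 * f (x :: y :: l).
  by rewrite -fA //= ?sl // /ins /= drop0 take0.
by rewrite expr1 exprS !mulN1r mulrN mulNr opprK.
Qed.

Definition permuted n (s : 'S_n) (l : seq nat) : seq nat :=
  [seq nth 0%N l (s i) | i <- enum 'I_n].

Lemma size_permuted n (s : 'S_n) l : size (permuted s l) = n.
Proof. by rewrite size_map size_enum_ord. Qed.

Lemma nth_permuted n (s : 'S_n) l (i : 'I_n) : nth 0%N (permuted s l) i = nth 0%N l (s i).
Proof. by rewrite (nth_map i) ?size_enum_ord // nth_ord_enum. Qed.

Definition antisum n f (l : seq nat) : R :=
  \sum_(s : 'S_n) (-1) ^+ s * f (permuted s l).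

Lemma permuted_lift n (j : 'I_n.+1) (s : 'S_n) x l :
  permuted (lift_perm j ord0 s) (x :: l) = ins j x (permuted s l).
Proof.
apply: (@eq_from_nth _ 0%N) => [|i]; first by rewrite size_ins !size_permuted.
rewrite size_permuted => lin; rewrite -[ i ]/(nat_of_ord (Ordinal lin)).
move: (Ordinal lin) => {lin}i'; rewrite (nth_permuted _ _ i') /ins nth_cat size_take size_permuted.
have -> : (if (j < n)%N then j : nat else n) = j.
  by case: ltnP => // nj; apply/eqP; rewrite eqn_leq nj -ltnS ltn_ord.
have [i'' ->|->] := unliftP j i'; last first.
  by rewrite lift_perm_id ltnn subnn.
rewrite lift_perm_lift /=; rewrite /bump.
have [ji|ij] := leqP j i''.
  rewrite add1n ltnNge leqW //= subSn // /= nth_drop subnKC //.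
  by rewrite nth_permuted.
by rewrite add0n ij nth_take // nth_permuted.
Qed.

Lemma antisum_cons n f x l :
  antisum n.+1 f (x :: l)
    = \sum_(j < n.+1) (-1) ^+ j * antisum n (fun l' => f (ins j x l')) l.
Proof.
rewrite /antisum (partition_big (fun s : 'S_n.+1 => (s^-1)%g ord0) predT) //=.
apply: eq_bigr => j _; rewrite (reindex (lift_perm j ord0)); last first.
  pose ulsf i (s : 'S_n.+1) k := odflt k (unlift (s i) (s (lift i k))).
  have ulsfK i (s : 'S_n.+1) k: lift (s i) (ulsf i s k) = s (lift i k).
    rewrite /ulsf; have:= neq_lift i k.
    by rewrite -(can_eq (permK s)) => /unlift_some[] ? ? ->.
  have inj_ulsf: injective (ulsf j _).
    move=> s; apply: can_inj (ulsf (s j) s^-1%g) _ => k'.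
    by rewrite {1}/ulsf ulsfK !permK liftK.
  exists (fun s => perm (inj_ulsf s)) => [s _ | s].
    by apply/permP=> k'; rewrite permE /ulsf lift_perm_lift lift_perm_id liftK.
  move=> /eqP sj; have {}sj : s j = ord0 by rewrite -sj permKV.
  apply/permP=> k; case: (unliftP j k) => [k'|] ->; rewrite ?lift_perm_id //.
  by rewrite lift_perm_lift -sj permE ulsfK.
rewrite big_distrr /=; apply: eq_big => [s|s _].
  by rewrite -{2}(lift_perm_id j ord0 s) permK eqxx.
by rewrite permuted_lift odd_lift_perm addbF signr_addb signr_odd -mulrA.
Qed.

Definition split_at p a b (l : seq nat) : R := a (take p l) * b (drop p l).

(** The first entry [x] lands among the [p] arguments of [a] or the [q] ones of
    [b]; in either group all positions contribute equally, by alternation. *)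
Theorem antisum_split p q a b l :
    size l = (p + q)%N -> alt_comp p a -> alt_comp q b ->
  antisum (p + q) (split_at p a b) l
    = (p`! * q`!)%:R * shuffle (Rarith R) p q a b l.
Proof.
elim: l p q a b => [|x l IH] p q a b.
  move=> /esym/eqP; rewrite addn_eq0 => /andP[/eqP -> /eqP ->] _ _.
  rewrite /antisum /split_at (eq_bigr (fun=> a [::] * b [::])) => [|s _].
    by rewrite sumr_const card_Sn fact0 mulr1n mul1r.
  rewrite (_ : permuted s _ = [::]); last by apply: size0nil; rewrite size_permuted.
  by rewrite (_ : s = 1%g) ?odd_perm1 ?mul1r //; apply/permP => -[].
move=> sl aA bA.
have [n pq] : exists n, (p + q = n.+1)%N by exists (size l); rewrite -sl.
have sln : size l = n by move: sl; rewrite pq => -[].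
rewrite pq antisum_cons.
have antisumE f f' : (forall l', size l' = n -> f l' = f' l') -> antisum n f l = antisum n f' l.
  by move=> ff; apply: eq_bigr => s _; rewrite ff // size_permuted.
have antisumZ e f : e * antisum n f l = antisum n (fun l' => e * f l') l.
  by rewrite big_distrr /=; apply: eq_bigr => s _; rewrite mulrCA.
rewrite -(big_mkord xpredT (fun j => (-1) ^+ j * antisum n (fun l' => split_at p a b (ins j x l')) l)).
rewrite (big_cat_nat (n := p)) //=; last by rewrite -pq leq_addr.
rewrite mulrDr; congr (_ + _).
- case: p pq sl aA => [|p] pq sl aA; first by rewrite big_geq // /realZ rmorph0 mulr0.
  have np : n = (p + q)%N by move: pq; rewrite addSn => -[].
  rewrite (eq_big_nat _ _ (F2 := fun=> antisum n (split_at p (fun l' => a (x :: l')) b) l)).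
    rewrite sumr_const_nat subn0 np IH ?sln //; last exact: alt_comp_contract.
    by rewrite factS -mulnA -[LHS]mulr_natl mulrA -natrM.
  move=> j /andP[_ jp]; rewrite antisumZ; apply: antisumE => l' sl'.
  have jl' : (j <= p)%N by [].
  have pl' : size (take p l') = p by rewrite size_takel // sl' np leq_addr.
  rewrite /split_at take_ins // drop_ins // aA ?pl' //.
  by rewrite !mulrA -exprD addnn -signr_odd odd_double mul1r.
case: q pq sl bA => [|q] pq sl bA; first by rewrite addn0 in pq; rewrite pq big_geq // /realZ rmorph0 mulr0.
have np : n = (p + q)%N by move: pq; rewrite addnS => -[].
rewrite (eq_big_nat _ _ (F2 := fun=> (-1) ^+ p * antisum n (split_at p a (fun l' => b (x :: l'))) l)).
  rewrite sumr_const_nat np IH ?sln //; last exact: alt_comp_contract.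
  rewrite [RHS]/= -[realZ _ _]/(asign (Rarith R) p) asignE -addnS addKn.
  by rewrite factS mulnCA [in RHS]natrM -[LHS]mulr_natl -[RHS]mulrA; congr (_ * _); rewrite mulrCA.
move=> j /andP[pj jn]; rewrite !antisumZ; apply: antisumE => l' sl'.
have pl : (p <= size l')%N by rewrite sl' np leq_addr.
rewrite /split_at take_ins_ge // drop_ins_ge // bA.
- by rewrite -{1}(subnKC pj) exprD mulrCA -mulrA [in LHS]mulrCA signrMK mulrCA.
- by rewrite size_drop sl' np addKn.
- by rewrite size_drop leq_sub2r // sl'.
Qed.


End Shuffles.

Section Values.
Variables (R : realType) (V : vectType R).
Implicit Type b : nat -> V.

Definition ev b (k : nat) (w : kform V k) (s : seq nat) : R :=
  w (fun i => b (nth 0%N s i)).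

Lemma permuted1 n (s : seq nat) : size s = n -> permuted (1 : 'S_n)%g s = s.
Proof.
move=> sn; apply: (@eq_from_nth _ 0%N) => [|i]; rewrite size_permuted //.
move=> i_n; rewrite -[ i ]/(nat_of_ord (Ordinal i_n)).
by rewrite (nth_permuted 1%g s (Ordinal i_n)) perm1.
Qed.

Lemma ev_alt_comp b k (w : kform V k) : alternating w -> alt_comp k (ev b w).
Proof.
move=> wA x l j; case: k w wA => [//|n] w wA [sl] jl.
pose j' : 'I_n.+1 := inord j; have j'E : j = j' by rewrite inordK // ltnS -sl.
have -> : (-1 : R) ^+ j = (-1) ^+ (lift_perm j' ord0 (1 : 'S_n)%g).
  by rewrite odd_lift_perm odd_perm1 !addbF signr_odd j'E.
rewrite -[RHS]wA /ev; congr w; apply/funext => i.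
by rewrite -nth_permuted permuted_lift permuted1 // j'E.
Qed.

Lemma ev_wedge b p q (a : kform V p) (a' : kform V q) s :
    alternating a -> alternating a' -> size s = (p + q)%N ->
  ev b (wedge a a') s = shuffle (Rarith R) p q (ev b a) (ev b a') s.
Proof.
move=> aA aA' ss; rewrite /ev /wedge.
have pq0 : (p`! * q`!)%:R != 0 :> R by rewrite pnatr_eq0 muln_eq0 !negb_or -!lt0n !fact_gt0.
apply: (mulfI pq0); rewrite mulVKf //.
rewrite -antisum_split //; [|exact: (ev_alt_comp b aA)|exact: (ev_alt_comp b aA')].
apply: eq_bigr => t _; rewrite -mulrA /split_at /ev; congr (_ * (_ * _)).
  congr a; apply/funext => i; rewrite nth_take //.
  by rewrite -[nat_of_ord i]/(nat_of_ord (lshift q i)) nth_permuted.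
congr a'; apply/funext => i; rewrite nth_drop.
by rewrite -[(p + i)%N]/(nat_of_ord (rshift p i)) nth_permuted.
Qed.

Lemma ev_contract b k (w : kform V k.+1) x s :
  ev b (contract (b x) w) s = ev b w (x :: s).
Proof.
rewrite /ev /contract; congr w; apply/funext => i; rewrite /fcons.
by case: unliftP => [j|] ->.
Qed.

Lemma ins_index x (s : seq nat) : x \in s -> ins (index x s) x (rem x s) = s.
Proof.
move=> xs; rewrite /ins remE take_cat drop_cat size_take.
rewrite index_mem xs ltnn subnn take0 drop0 cats0.
by rewrite -[RHS](cat_take_drop (index x s)) (drop_nth 0%N) ?index_mem // nth_index.
Qed.

Lemma alt_comp_exchanges p (f : seq nat -> R) r s :
    alt_comp p f -> size s = p -> perm_eq s r ->
  f s = (-1) ^+ exchanges r s * f r.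
Proof.
elim: r p f s => [|x r IH] p f s fA sp sr.
  by rewrite (perm_small_eq _ sr) //= expr0 mul1r.
have xs : x \in s by rewrite (perm_mem sr) inE eqxx.
have srem : size (rem x s) = p.-1 by rewrite size_rem // sp.
have p0 : p = p.-1.+1 by move: xs; rewrite -sp; case: (s).
rewrite -{1}(ins_index xs) fA ?srem -?p0 //; last first.
  by rewrite -ltnS -p0 -sp index_mem.
rewrite p0 in fA; rewrite (IH _ _ (rem x s) (alt_comp_contract x fA) srem).
  by rewrite /= exprD mulrA.
rewrite -(perm_cons x); apply: perm_trans sr; rewrite perm_sym; exact: perm_to_rem.
Qed.

(** Every rearrangement [K] of [r] contributes the same amount, since the signs
    of the two factors cancel. *)
Lemma sum_complement b k m (w : kform V k) (vol : kform V (k + m)) r s :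
    alternating w -> alternating vol ->
    perm_eq (r ++ s) (iota 0 7) -> size r = k -> size s = m ->
  \sum_(K : {ffun 'I_k -> 'I_7})
     w (fun i => b (K i)) * vol (fun i => b (nth 0%N ([seq nat_of_ord (K i) | i <- enum 'I_k] ++ s) i))
  = k`!%:R * (ev b w r * ev b vol (r ++ s)).
Proof.
move=> wA volA rs sr sm.
have r7 i : (nth 0%N r i < 7)%N.
  have [ir|ri] := ltnP i (size r); last by rewrite nth_default.
  have : nth 0%N r i \in iota 0 7 by rewrite -(perm_mem rs) mem_cat mem_nth.
  by rewrite mem_iota.
have urs : uniq (r ++ s) by rewrite (perm_uniq rs) iota_uniq.
pose h (t : 'S_k) : {ffun 'I_k -> 'I_7} := [ffun i => Ordinal (r7 (t i))].
have h_inj : {in {: 'S_k} &, injective h}.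
  move=> t t' _ _ /ffunP tt'; apply/permP => i; apply: val_inj.
  have := congr1 val (tt' i); rewrite !ffunE /= => /eqP.
  move: urs; rewrite cat_uniq => /andP[ur _].
  by rewrite nth_uniq ?sr // => /eqP.
rewrite (bigID (fun K => K \in [set h t | t in {: 'S_k}])) /= [X in _ + X]big1 ?addr0.
  rewrite big_imset //= (eq_bigr (fun=> ev b w r * ev b vol (r ++ s))).
    by rewrite sumr_const card_Sn mulr_natl.
  move=> t _.
  have -> : [seq nat_of_ord (h t i) | i <- enum 'I_k] = permuted t r.
    by apply: eq_map => i; rewrite ffunE.
  have -> : w (fun i => b (h t i)) = ev b w (permuted t r).
    by congr w; apply/funext => i; rewrite nth_permuted ffunE.
  have tr : perm_eq (permuted t r) r.
    rewrite -[X in perm_eq _ X](permuted1 sr) /permuted.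
    rewrite (map_comp (nth 0%N r \o val) t) (map_comp (nth 0%N r \o val) (1 : 'S_k)%g).
    have tU (t' : 'S_k) : uniq [seq t' i | i <- enum 'I_k].
      by rewrite (map_inj_uniq perm_inj) enum_uniq.
    apply: perm_map; apply: uniq_perm; [exact: tU|exact: tU|].
    have tM (t' : 'S_k) i : i \in [seq t' i | i <- enum 'I_k].
      by apply/mapP; exists (t'^-1%g i); rewrite ?mem_enum ?permKV.
    by move=> i; rewrite !tM.
  rewrite -[X in _ * X = _]/(ev b vol (permuted t r ++ s)).
  rewrite (alt_comp_exchanges (ev_alt_comp b wA) (size_permuted t r) tr).
  rewrite (alt_comp_exchanges (f := fun l => ev b vol (l ++ s)) (s := permuted t r) (p := k) (r := r)) ?size_permuted //.
    by rewrite mulrACA -expr2 sqrr_sign mul1r.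
  move=> x l j sl jl; have lm : (size (l ++ s)).+1 = (k + m)%N.
    by rewrite size_cat -addSn sl sm.
  rewrite -[RHS](ev_alt_comp b volA) //; last by rewrite size_cat (leq_trans jl) ?leq_addr.
  rewrite /ins -catA cat_cons take_cat drop_cat; case: ltnP jl => // lj jl.
  have -> : j = size l by apply/eqP; rewrite eqn_leq lj jl.
  by rewrite subnn take0 drop0 take_size drop_size cats0.
move=> K KN; apply/eqP; rewrite mulf_eq0; apply/orP; right; apply/eqP.
set l := _ ++ s.
have sl : size l = (k + m)%N by rewrite size_cat size_map size_enum_ord sm.
have [ul|] := boolP (uniq l); last first.
  case/(uniqPn 0%N) => i [j [ij jl nij]].
  rewrite sl in jl; pose j' := Ordinal jl; pose i' := Ordinal (ltn_trans ij jl).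
  apply: (alternating_repeat (i := i') (j := j') volA); last by rewrite /= nij.
  by rewrite -val_eqE /= neq_ltn ij.
case/negP: KN; apply/imsetP.
have Kr : perm_eq [seq nat_of_ord (K i) | i <- enum 'I_k] r.
  rewrite -(perm_cat2r s) perm_sym; apply: (perm_trans rs); rewrite perm_sym.
  apply: uniq_perm; rewrite ?iota_uniq // => i.
  have l7 : {subset l <= iota 0 7}.
    move=> x; rewrite mem_cat => /orP[/mapP[y _ ->]|xs]; first by rewrite mem_iota /=.
    by rewrite -(perm_mem rs) mem_cat xs orbT.
  have [|_ -> //] := uniq_min_size ul l7.
  by rewrite sl -sr -sm -size_cat (perm_size rs).
have Kin i : nat_of_ord (K i) \in r.
  by rewrite -(perm_mem Kr); apply/mapP; exists i; rewrite ?mem_enum.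
have urs' : uniq r by move: urs; rewrite cat_uniq => /andP[].
pose t0 (i : 'I_k) := index (nat_of_ord (K i)) r.
have t0k i : (t0 i < k)%N.
  by rewrite -sr index_mem Kin.
have t_inj : injective (fun i => Ordinal (t0k i)).
  move=> i i' /(congr1 val) /= /(congr1 (nth 0%N r)).
  rewrite !nth_index ?Kin // => Kii.
  move: ul; rewrite cat_uniq => /andP[ul _].
  by have /injectiveP := ul; apply.
exists (perm t_inj); rewrite ?inE //; apply/ffunP => i; apply: val_inj.
by rewrite ffunE permE /= nth_index // -(perm_mem Kr) map_f ?mem_enum.
Qed.

End Values.

(** * Orthonormal frames and the Hodge star *)

Lemma multilinear_expand (R : realType) (V : vectType R) k n (w : kform V k)
    (f : 'I_n -> V) (xi : 'I_n -> V -> R) :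
    (forall v, v = \sum_j xi j v *: f j) ->
    (forall j a x y, xi j (a *: x + y) = a * xi j x + xi j y) ->
    (forall j l, xi j (f l) = (j == l)%:R) -> multilinear w ->
  forall v, w v = \sum_(I : {ffun 'I_k -> 'I_n})
     (\prod_i xi (I i) (v i)) * w (fun i => f (I i)).
Proof.
move=> fE xiL xif wL v.
pose w' : kform V k := fun v => \sum_(I : {ffun 'I_k -> 'I_n})
     (\prod_i xi (I i) (v i)) * w (fun i => f (I i)).
suff E : w = w' by rewrite {1}E.
apply: (multilinear_ext fE wL) => [u i a x y|J]; rewrite /w'.
  have prodE (I : {ffun 'I_k -> 'I_n}) t : \prod_j xi (I j) (fupd u i t j)
      = xi (I i) t * \prod_(j | j != i) xi (I j) (u j).
    rewrite (bigD1 i) //= fupd_same; congr (_ * _).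
    by apply: eq_bigr => j ji; rewrite fupd_other.
  rewrite big_distrr -big_split /=; apply: eq_bigr => I _.
  by rewrite !prodE xiL mulrA -mulrDl mulrA -mulrDl.
rewrite (bigD1 [ffun i => J i]) //= [X in _ + X]big1 ?addr0 => [|I IJ].
  rewrite big1 ?mul1r => [|i _]; last by rewrite ffunE xif eqxx.
  by congr w; apply/funext => i; rewrite ffunE.
have [ i ] : exists i, I i != J i.
  apply/existsP; rewrite -negb_forall; apply: contra IJ => /forallP IJ.
  by apply/eqP/ffunP => i; rewrite ffunE; apply/eqP.
by move=> Iij; rewrite (bigD1 i) //= xif (negPf Iij) !mul0r.
Qed.

Section Concatenation.
Variables (T : Type) (p q : nat) (u : 'I_p -> T) (v : 'I_q -> T).

Lemma fcat_lshift i : fcat u v (lshift q i) = u i.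
Proof. by rewrite /fcat (unsplitK (inl i)). Qed.

Lemma fcat_rshift i : fcat u v (rshift p i) = v i.
Proof. by rewrite /fcat (unsplitK (inr i)). Qed.

End Concatenation.

Lemma fcat_ext (T : Type) p q (f f' : 'I_(p + q) -> T) :
    (forall i, f (lshift q i) = f' (lshift q i)) ->
    (forall i, f (rshift p i) = f' (rshift p i)) -> f = f'.
Proof.
by move=> fl fr; apply/funext => i; rewrite -(splitK i); case: (fintype.split i).
Qed.

Section Metric.
Variables (R : realType) (V : vectType R) (g : V -> V -> R^o).
Hypothesis gP : inner_product g.

Lemma metricC x y : g x y = g y x.
Proof. by case: gP. Qed.

Lemma metricDl x x' y : g (x + x') y = g x y + g x' y.
Proof. by case: gP => -[gl _] _ _; have := gl y 1 x x'; rewrite !scale1r. Qed.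

Lemma metricZl a x y : g (a *: x) y = a * g x y.
Proof.
case: gP => -[gl _] _ _; have := gl y a x 0; rewrite addr0 => ->.
have := gl y (-1) x x; rewrite scaleN1r addNr => ->.
by rewrite scaleN1r addNr addr0.
Qed.

Lemma metricDr x y y' : g x (y + y') = g x y + g x y'.
Proof. by rewrite ![g x _]metricC metricDl. Qed.

Lemma metricZr a x y : g x (a *: y) = a * g x y.
Proof. by rewrite ![g x _]metricC metricZl. Qed.

Lemma metricNl x y : g (- x) y = - g x y.
Proof. by rewrite -scaleN1r metricZl mulN1r. Qed.

Lemma metricNr x y : g x (- y) = - g x y.
Proof. by rewrite -scaleN1r metricZr mulN1r. Qed.

Lemma metric0l y : g 0 y = 0.
Proof. by rewrite -(scale0r 0) metricZl mul0r. Qed.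

Lemma metric0r y : g y 0 = 0.
Proof. by rewrite metricC metric0l. Qed.

Lemma metric_suml (J : Type) (r : seq J) (P : pred J) (x : J -> V) y :
  g (\sum_(j <- r | P j) x j) y = \sum_(j <- r | P j) g (x j) y.
Proof. by elim/big_rec2: _ => [|j u v _ <-]; rewrite ?metric0l ?metricDl. Qed.

Lemma metric_sumr (J : Type) (r : seq J) (P : pred J) (x : J -> V) y :
  g y (\sum_(j <- r | P j) x j) = \sum_(j <- r | P j) g y (x j).
Proof. by rewrite metricC metric_suml; apply: eq_bigr => j _; rewrite metricC. Qed.

Lemma metric_gt0 x : x != 0 -> 0 < g x x.
Proof. by case: gP => _ _; apply. Qed.

Lemma metric_eq0 x : g x x = 0 -> x = 0.
Proof. by move=> gx; apply/eqP; apply: contraPT gx => /metric_gt0 /gt_eqF /eqP. Qed.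

Lemma metric_inj x y : (forall z, g x z = g y z) -> x = y.
Proof.
move=> gxy; apply/eqP; rewrite -subr_eq0; apply/eqP/metric_eq0.
by rewrite metricDl metricNl gxy subrr.
Qed.

Definition orthonormal (n : nat) (b : nat -> V) : Prop :=
  forall i j, (i < n)%N -> (j < n)%N -> g (b i) (b j) = (i == j)%:R.

Lemma orthonormal_expand b : \dim {:V} = 7%N -> orthonormal 7 b ->
  forall v, v = \sum_(i < 7) g v (b i) *: b i.
Proof.
move=> dimV bO v; pose X := [tuple b i | i < 7].
have gX a (j : 'I_7) : g (\sum_(i < 7) a i *: b i) (b j) = a j.
  rewrite metric_suml (bigD1 j) //= metricZl bO // eqxx mulr1 big1 ?addr0 // => i ij.
  by rewrite metricZl bO // (inj_eq val_inj) (negPf ij) mulr0.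
have XE (a : 'I_7 -> R) : \sum_(i < 7) a i *: X`_i = \sum_(i < 7) a i *: b i.
  by apply: eq_bigr => i _; rewrite -tnth_nth tnth_mktuple.
have Xfree : free X.
  by apply/freeP => a; rewrite XE => aX j; rewrite -(gX a j) aX metric0l.
have Xb : basis_of {:V} X.
  by rewrite basisEfree Xfree subvf size_tuple dimV.
have vX : v \in <<X>>%VS by rewrite (span_basis Xb) memvf.
have vE : v = \sum_(i < 7) coord X i v *: b i by rewrite -XE -coord_span.
by rewrite {1}vE; apply: eq_bigr => i _; rewrite {2}vE gX.
Qed.

Local Notation vb i := (tnth (vbasis {:V}) i).

Let vec (u : 'rV[R]_(\dim {:V})) := \sum_l u 0 l *: vb l.

Let vecE u j : g (vec u) (vb j) = (u *m \matrix_(i, j) g (vb i) (vb j)) 0 j.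
Proof.
by rewrite metric_suml !mxE; apply: eq_bigr => l _; rewrite metricZl mxE.
Qed.

Lemma gram_unit : \matrix_(i, j) g (vb i) (vb j) \in unitmx.
Proof.
have vec_inj u : vec u = 0 -> u = 0.
  move=> u0; apply/rowP => l; rewrite mxE.
  have /freeP := basis_free (vbasisP {:V}); apply.
  by rewrite -[RHS]u0; apply: eq_bigr => i _; rewrite -tnth_nth.
rewrite -row_free_unit; apply: inj_row_free => u uG; apply/vec_inj/metric_eq0.
rewrite {2}/vec metric_sumr big1 // => l _.
by rewrite metricZr vecE uG mxE mulr0.
Qed.

Lemma reciprocal_basis_expand v :
  v = \sum_j g v (vb j) *: reciprocal_basis g j.
Proof.
set G := \matrix_(i, j) g (vb i) (vb j).
have [u ->] : exists u, v = vec u.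
  exists (\row_l coord (vbasis {:V}) l v).
  rewrite [LHS](coord_vbasis (memvf v)).
  by apply: eq_bigr => l _; rewrite mxE -tnth_nth.
transitivity (vec (u *m G *m invmx G)); first by rewrite mulmxK ?gram_unit.
rewrite /vec (eq_bigr (fun k => \sum_j (g (vec u) (vb j) * invmx G j k) *: vb k)).
  rewrite exchange_big /=; apply: eq_bigr => j _.
  by rewrite scaler_sumr; apply: eq_bigr => k _; rewrite scalerA.
move=> k _; rewrite mxE scaler_suml; apply: eq_bigr => j _.
by rewrite vecE.
Qed.

Lemma reciprocal_basis_dual i j : g (reciprocal_basis g j) (vb i) = (i == j)%:R.
Proof.
have := mulVmx gram_unit => /matrixP /(_ j i); rewrite !mxE eq_sym => <-.
rewrite metric_suml; apply: eq_bigr => l _.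
by rewrite metricZl [in RHS]mxE.
Qed.

(** The definition sums over a basis and its reciprocal basis; the sum does not
    depend on the basis, and an orthonormal frame is its own reciprocal. *)
Lemma hodge_orthonormal b k m (vol : kform V (k + m)) (w : kform V k) y :
    \dim {:V} = 7%N -> orthonormal 7 b -> multilinear w -> multilinear vol ->
  hodge g vol w y = (k`!%:R)^-1 * \sum_(K : {ffun 'I_k -> 'I_7})
     w (fun i => b (K i)) * vol (fcat (fun i => b (K i)) y).
Proof.
move=> dimV bO wL volL; rewrite /hodge; congr (_ * _).
pose volk : kform V k := fun u => vol (fcat u y).
have volkL : multilinear volk.
  move=> v i a x z; rewrite /volk.
  have E t : fcat (fupd v i t) y = fupd (fcat v y) (lshift m i) t.
    apply: fcat_ext => j; last by rewrite fupd_other ?fcat_rshift // eq_rlshift.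
    rewrite fcat_lshift; have [->|ji] := eqVneq j i; first by rewrite !fupd_same.
    by rewrite !fupd_other ?fcat_lshift ?(inj_eq (@lshift_inj _ _)).
  by rewrite !E volL.
pose b' (i : 'I_7) := b i.
transitivity (\sum_(I : {ffun 'I_k -> 'I_(\dim {:V})}) \sum_(K : {ffun 'I_k -> 'I_7})
   (\prod_i g (vb (I i)) (b' (K i))) * (w (fun r => reciprocal_basis g (I r)) * volk (fun i => b' (K i)))).
  apply: eq_bigr => I _; rewrite -[vol _]/(volk (fun r => vb (I r))).
  have -> := @multilinear_expand _ _ _ _ volk b' (fun j v => g v (b j)) (orthonormal_expand dimV bO) _ _ volkL.
  - rewrite big_distrr /=; apply: eq_bigr => K _; by rewrite mulrCA.
  - by move=> j a x z; rewrite metricDl metricZl.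
  - by move=> j l; rewrite bO // eq_sym.
rewrite exchange_big /=; apply: eq_bigr => K _.
have -> := @multilinear_expand _ _ _ _ w (reciprocal_basis g) (fun j v => g v (vb j)) reciprocal_basis_expand _ _ wL.
- rewrite big_distrl /=; apply: eq_bigr => I _; rewrite mulrA; congr (_ * _ * _).
  by apply: eq_bigr => i _; rewrite metricC.
- by move=> j a x z; rewrite metricDl metricZl.
- by move=> j l; rewrite reciprocal_basis_dual.
Qed.

Lemma hodge_is_form k m (vol : kform V (k + m)) (w : kform V k) :
  is_form vol -> is_form (hodge g vol w).
Proof.
move=> [volL vol0].
split=> [v i a x y|v i j ij vij]; rewrite /hodge.
  rewrite mulrCA -mulrDr; congr (_ * _).
  rewrite big_distrr -big_split /=; apply: eq_bigr => I _.
  rewrite mulrCA -mulrDr; congr (_ * _).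
  have E (u : 'I_k -> V) t : fcat u (fupd v i t) = fupd (fcat u v) (rshift k i) t.
    apply: fcat_ext => j; first by rewrite fupd_other ?fcat_lshift // eq_lrshift.
    rewrite fcat_rshift; have [->|ji] := eqVneq j i; first by rewrite !fupd_same.
    by rewrite !fupd_other ?fcat_rshift ?(inj_eq (@rshift_inj _ _)).
  by rewrite !E volL.
rewrite big1 ?mulr0 // => I _.
rewrite (vol0 _ (rshift k i) (rshift k j)) ?mulr0 ?fcat_rshift //.
by rewrite (inj_eq (@rshift_inj _ _)).
Qed.

End Metric.

(** * Components of the objects of the theory in an adapted frame *)

Lemma pairing_is_form (R : realType) (V : vectType R) (f : V -> V -> R) :
    (forall a x x' y, f (a *: x + x') y = a * f x y + f x' y) ->
    (forall a x y y', f x (a *: y + y') = a * f x y + f x y') ->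
    (forall x, f x x = 0) ->
  is_form ((fun v => f (v ord0) (v ord_max)) : kform V 2).
Proof.
move=> fl fr f0; split=> [v i a x y|v i j ij vij].
  have [iE|iE] : i = ord0 \/ i = ord_max.
    by case: i => -[|[|//]] i2; [left|right]; apply: val_inj.
    by rewrite iE !fupd_same !fupd_other.
  by rewrite iE !fupd_same !fupd_other.
suff -> : v ord0 = v ord_max by rewrite f0.
case: i j ij vij => -[|[|//]] i2 [[|[|//]] j2] // _ vij; do [idtac|symmetry].
  by rewrite (_ : ord0 = Ordinal i2) ?vij; [congr v|]; apply: val_inj.
by rewrite (_ : ord0 = Ordinal j2) -?vij; [congr v|]; apply: val_inj.
Qed.

Lemma wedgeZl (R : realType) (V : vectType R) p q a (w : kform V p) (w' : kform V q) v :
  a * wedge w w' v = wedge (fun u => a * w u) w' v.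
Proof.
rewrite /wedge mulrCA; congr (_ * _); rewrite big_distrr; apply: eq_bigr => s _ /=.
by rewrite !mulrA (mulrC a).
Qed.

Lemma realZ0 (R : pzRingType) : realZ R 0%BZ = 0.
Proof. by []. Qed.

Lemma realZ1 (R : pzRingType) : realZ R 1%BZ = 1.
Proof. by []. Qed.

Lemma realZN1 (R : pzRingType) : realZ R (-1)%BZ = -1.
Proof. by []. Qed.

Lemma sum_iota (T : nmodType) n (P : pred nat) (F : nat -> T) :
  \sum_(i <- iota 0 n | P i) F i = \sum_(i < n | P i) F i.
Proof. by rewrite -(big_mkord P F) /index_iota subn0. Qed.

Lemma perm_complement s : uniq s -> all index7 s ->
  perm_eq ([seq i <- iota 0 7 | i \notin s] ++ s) (iota 0 7).
Proof.
move=> us s7; rewrite perm_sym -(perm_filterC (mem s) (iota 0 7)) perm_sym perm_catC perm_cat2r.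
apply: uniq_perm; [by []|exact/filter_uniq/iota_uniq|] => i.
rewrite mem_filter mem_iota add0n leq0n andTb (_ : mem s i = (i \in s)) //.
by case si: (i \in s) => //; symmetry; exact: (allP s7 _ si).
Qed.

Section EqPrograms.
Variables (T : Type) (A : arith T).

Lemma eq_asum (J : Type) (r : seq J) F F' : F =1 F' -> asum A r F = asum A r F'.
Proof. by move=> FF'; elim: r => //= j r ->; rewrite FF'. Qed.

Lemma eq_shuffle (P : pred nat) p q a a' b b' s :
    size s = (p + q)%N -> all P s ->
    (forall l, size l = p -> all P l -> a l = a' l) ->
    (forall l, size l = q -> all P l -> b l = b' l) ->
  shuffle A p q a b s = shuffle A p q a' b' s.
Proof.
elim: s p q a a' b b' => [|x s IH] p q a a' b b'.
  by move=> /esym/eqP; rewrite addn_eq0 => /andP[/eqP -> /eqP ->] _ aE bE /=; rewrite aE ?bE.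
move=> /= sz /andP[Px Ps] aE bE; congr aadd.
  case: p sz aE => // p [sz] aE; apply: IH => // l sl Pl.
  by apply: aE; rewrite /= ?sl ?Px.
case: q sz bE => // q; rewrite addnS => -[sz] bE; congr amul; apply: IH => // l sl Pl.
by apply: bE; rewrite /= ?sl ?Px.
Qed.

Lemma nth_lt7 s i : all index7 s -> (nth 0 s i < 7)%N.
Proof.
move=> s7; have [si|si] := ltnP i (size s); last by rewrite nth_default.
exact: (allP s7) (mem_nth 0%N si).
Qed.

Lemma eq_ce_comp k c c' w w' s : all index7 s ->
    (forall i j m, index7 i -> index7 j -> index7 m -> c i j m = c' i j m) ->
    (forall l, size l = k.+1 -> all index7 l -> w l = w' l) ->
  ce_comp A k c w s = ce_comp A k c' w' s.
Proof.
move=> s7 cc' ww'; apply: eq_asum => i; apply: eq_asum => j; congr amul.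
rewrite /asum; have : all index7 (iota 0 7) by [].
elim: (iota 0 7) => //= m r IH /andP[m7 r7]; rewrite IH //.
congr (aadd A (amul A _ _) _); first by apply: cc' => //; exact: nth_lt7.
apply: ww'; first by rewrite /= size_map size_iota.
by apply/andP; split=> //; apply/allP => _ /mapP[l _ ->]; exact: nth_lt7.
Qed.

Lemma eq_hodge_comp m w w' s : size s = m -> (m <= 7)%N -> all index7 s ->
    (forall l, size l = (7 - m)%N -> all index7 l -> w l = w' l) ->
  hodge_comp A w s = hodge_comp A w' s.
Proof.
move=> sm m7 s7 ww'; rewrite /hodge_comp; case: ifP => // us; congr amul.
apply: ww'; last by apply/allP => i; rewrite mem_filter mem_iota => /andP[_].
have /perm_size := perm_complement us s7.
by rewrite size_cat size_iota sm => /(canRL (addnK _)).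
Qed.

(** The components of six times the torsion, twelve times the connection and 144
    times its curvature, as polynomials in the structure constants with integer
    coefficients. *)

Definition phi_cst (s : seq nat) : T := acst A (phiZ s).
Definition psi_cst (s : seq nat) : T := acst A (psiZ s).

Definition torsion_comp (dphi : seq nat -> T) (s : seq nat) : T :=
  aadd A (amul A (hodge_comp A (shuffle A 4 3 dphi phi_cst) [::]) (phi_cst s))
         (amul A (acst A (-6)%BZ) (hodge_comp A dphi s)).

Definition koszul_comp (c : nat -> nat -> nat -> T) x y z : T :=
  aadd A (c x y z) (aadd A (c z x y) (amul A (acst A (-1)%BZ) (c y z x))).

Definition connection_comp (c : nat -> nat -> nat -> T) (tor : seq nat -> T) x y z : T :=
  aadd A (amul A (acst A 6%BZ) (koszul_comp c x y z)) (tor [:: x; y; z]).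

Definition curvature_comp (c gam : nat -> nat -> nat -> T) x y a b : T :=
  asum A (iota 0 7) (fun l =>
    aadd A (amul A (gam y a l) (gam x l b))
      (amul A (acst A (-1)%BZ)
        (aadd A (amul A (gam x a l) (gam y l b))
                (amul A (acst A 12%BZ) (amul A (c x y l) (gam l a b)))))).

Definition instanton_comp (c gam : nat -> nat -> nat -> T) a b (s : seq nat) : T :=
  shuffle A 2 4 (fun l => curvature_comp c gam (nth 0%N l 0) (nth 0%N l 1) a b)
    psi_cst s.

End EqPrograms.

Section Adapted.
Variables (R : realType) (V : vectType R) (br : V -> V -> V) (g : V -> V -> R^o).
Variables (vol : kform V 7) (phi : kform V 3).
Hypothesis dimV : \dim {:V} = 7%N.
Hypothesis brP : lie_bracket br.
Hypothesis gP : inner_product g.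
Hypothesis volF : is_form vol.
Hypothesis phiF : is_form phi.

Definition adapted (b : nat -> V) : Prop :=
  orthonormal g 7 b /\
  forall s, size s = 3%N -> all index7 s -> ev b phi s = realZ R (phiZ s).

Variable b : nat -> V.
Hypothesis bA : adapted b.
Hypothesis vol1 : ev b vol (iota 0 7) = 1.

Definition struct_const (i j m : nat) : R := g (br (b i) (b j)) (b m).

Let bO : orthonormal g 7 b. Proof. by case: bA. Qed.

Let brL : bilinear_map br. Proof. by case: brP. Qed.

Lemma frame_ext k (w w' : kform V k) : multilinear w -> multilinear w' ->
    (forall s, size s = k -> all index7 s -> ev b w s = ev b w' s) ->
  w = w'.
Proof.
move=> wL wL' ww'; apply: (multilinear_ext (orthonormal_expand gP dimV bO)) => // I.
have -> : (fun i => b (I i)) = (fun i => b (nth 0%N [seq nat_of_ord (I i) | i <- enum 'I_k] i)).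
  by apply/funext => i; rewrite (nth_map i) ?size_enum_ord // nth_ord_enum.
apply: ww'; first by rewrite size_map size_enum_ord.
by apply/allP => _ /mapP[i _ ->]; exact: ltn_ord.
Qed.

Lemma ev_hodge k m (vol' : kform V (k + m)) (w : kform V k) s :
    (k + m = 7)%N -> is_form vol' -> ev b vol' (iota 0 7) = 1 -> is_form w ->
    size s = m -> all index7 s ->
  ev b (hodge g vol' w) s = hodge_comp (Rarith R) (ev b w) s.
Proof.
move=> km volF' vol1' wF sm s7; rewrite /hodge_comp.
have [us|] := boolP (uniq s); last first.
  case/(uniqPn 0%N) => i [j [ij js nij]].
  have [_ h0] := hodge_is_form g w volF'.
  rewrite sm in js; apply: (h0 _ (Ordinal (ltn_trans ij js)) (Ordinal js)); last by rewrite /= nij.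
  by rewrite -val_eqE /= neq_ltn ij.
set r := [seq i <- iota 0 7 | i \notin s].
have rs : perm_eq (r ++ s) (iota 0 7) by exact: perm_complement.
have sr : size r = k.
  by have /perm_size := rs; rewrite size_cat sm size_iota -km => /addIn.
rewrite /ev (hodge_orthonormal gP _ dimV bO) //; [|by case: wF|by case: volF'].
have k0 : k`!%:R != 0 :> R by rewrite pnatr_eq0 -lt0n fact_gt0.
apply: (mulfI k0); rewrite mulVKf //.
rewrite (eq_bigr (fun K : {ffun 'I_k -> 'I_7} => w (fun i => b (K i)) *
    vol' (fun i => b (nth 0%N ([seq nat_of_ord (K i) | i <- enum 'I_k] ++ s) i)))).
  rewrite (sum_complement b (is_form_alternating wF) (is_form_alternating volF') rs sr sm).
  congr (_ * _).
  rewrite mulrC asignE (alt_comp_exchanges (ev_alt_comp b (is_form_alternating volF')) _ rs).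
    by rewrite vol1' mulr1.
  by rewrite (perm_size rs) size_iota km.
move=> K _; congr (_ * vol' _); apply: fcat_ext => i.
  rewrite fcat_lshift /= nth_cat size_map size_enum_ord ltn_ord.
  by rewrite (nth_map i) ?size_enum_ord // nth_ord_enum.
by rewrite fcat_rshift /= nth_cat size_map size_enum_ord ltnNge leq_addr /= addKn.
Qed.

Let phiE s : size s = 3%N -> all index7 s -> ev b phi s = phi_cst (Rarith R) s.
Proof. by case: bA => _; apply. Qed.

Lemma ev_psi s : size s = 4%N -> all index7 s ->
  ev b (g2_psi g vol phi) s = psi_cst (Rarith R) s.
Proof.
move=> s4 s7; rewrite (@ev_hodge 3 4) //.
rewrite /psi_cst psiZE // [RHS](hom_hodge_comp (realZ_hom R) (w' := phi_cst (Rarith R))) //.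
by apply: (@eq_hodge_comp _ _ 4).
Qed.

Lemma bracket_linl a x x' y : br (a *: x + x') y = a *: br x y + br x' y.
Proof. by case: brL => bl _; rewrite bl. Qed.

Lemma bracket_linr a x x' y : br y (a *: x + x') = a *: br y x + br y x'.
Proof. by case: brL => _ bl; rewrite bl. Qed.

Lemma ev_ce_diff k (w : kform V k.+1) s : multilinear w ->
  ev b (ce_diff br w) s = ce_comp (Rarith R) k struct_const (ev b w) s.
Proof.
move=> wL; rewrite /ev /ce_diff /ce_comp asumE.
rewrite sum_iota; apply: eq_bigr => i _.
rewrite asumE big_filter sum_iota.
apply: eq_bigr => j ij; rewrite asignE; congr (_ * _).
have E x : fcons x (fun l : 'I_k => b (nth 0%N s (lift i (lift j l))))
   = fupd (fcons 0 (fun l : 'I_k => b (nth 0%N s (lift i (lift j l))))) ord0 x.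
  apply/funext => l; rewrite /fcons; case: unliftP => [l'|] ->; last by rewrite fupd_same.
  by rewrite fupd_other //= /fcons liftK.
rewrite E (orthonormal_expand gP dimV bO (br _ _)) multilinear_sum //.
rewrite asumE sum_iota; apply: eq_bigr => m _.
congr (_ * _); rewrite -E /ev; congr w; apply/funext => l; rewrite /fcons.
case: unliftP => [l'|] -> //=.
by rewrite (nth_map 0%N) add0n ?size_iota // nth_iota.
Qed.

Lemma ce_diff_ev_phi s : size s = 4%N -> all index7 s ->
  ev b (ce_diff br phi) s = ce_comp (Rarith R) 2 struct_const (phi_cst (Rarith R)) s.
Proof.
move=> s4 s7; rewrite ev_ce_diff; last by case: phiF.
by apply: eq_ce_comp.
Qed.

Lemma sum_frame (F : nat -> R) : \sum_(l < 7) F l = asum (Rarith R) (iota 0 7) F.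
Proof. by rewrite asumE sum_iota. Qed.

Lemma coclosed_comp : coclosed br g vol phi -> forall s, all index7 s ->
  ce_comp (Rarith R) 3 struct_const (psi_cst (Rarith R)) s = 0.
Proof.
move=> cocl s s7; have psiL : multilinear (g2_psi g vol phi).
  by have [] := @hodge_is_form _ _ g 3 4 vol phi volF.
have := ev_ce_diff s psiL; rewrite cocl.
rewrite (eq_ce_comp (Rarith R) (c' := struct_const) (w' := psi_cst (Rarith R))) // => l sl l7.
exact: ev_psi.
Qed.

Local Notation dphi_comp := (ce_comp (Rarith R) 2 struct_const (phi_cst (Rarith R))).
Local Notation tor := (g2_torsion br g vol phi).

Lemma ce_diff_multilinear k (w : kform V k.+1) :
  multilinear w -> multilinear (ce_diff br w).
Proof.
move=> wL v i0 a x y; rewrite /ce_diff mulr_sumr -big_split; apply: eq_bigr => i _.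
rewrite mulr_sumr -big_split; apply: eq_bigr => j _ /=.
rewrite mulrCA -mulrDr; congr (_ * _).
have fconsE B (r : 'I_k -> V) : fcons B r = fupd (fcons 0 r) ord0 B.
  apply/funext => l; rewrite /fcons; case: unliftP => [l'|] ->; last by rewrite fupd_same.
  by rewrite fupd_other //= /fcons liftK.
pose rest t l := fupd v i0 t (lift i (lift j l)).
have [j' i0E|i0i] := unliftP i i0; last first.
  have restE t : (fun l => fupd v i0 t (lift i (lift j l))) = rest 0.
    by apply/funext => l; rewrite /rest i0i !fupd_other // eq_sym neq_lift.
  rewrite !restE {1 3 5}i0i !fupd_same !(fupd_other _ _ (_ : lift i j != i0)) ?i0i 1?eq_sym ?neq_lift //.
  by rewrite bracket_linl fconsE wL -!fconsE.
have [l0 jE|jl] := unliftP j j'; last first.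
  have restE t : (fun l => fupd v i0 t (lift i (lift j l))) = rest 0.
    apply/funext => l; rewrite /rest i0E jl !fupd_other //; apply/eqP => /lift_inj/eqP.
      by rewrite eq_sym (negPf (neq_lift _ _)).
    by rewrite eq_sym (negPf (neq_lift _ _)).
  rewrite !restE i0E jl !fupd_same !(fupd_other _ _ (_ : i != lift i j)) ?neq_lift //.
  by rewrite bracket_linr fconsE wL -!fconsE.
have E t : fcons (br (v i) (v (lift i j))) (fun l => fupd v i0 t (lift i (lift j l)))
    = fupd (fcons (br (v i) (v (lift i j))) (fun l => v (lift i (lift j l)))) (lift ord0 l0) t.
  apply/funext => l; have [l1 ->|->] := unliftP ord0 l.
    have [->|ll] := eqVneq l1 l0; first by rewrite fupd_same /fcons liftK i0E jE fupd_same.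
    rewrite fupd_other ?(inj_eq lift_inj) // /fcons liftK fupd_other //.
    by rewrite i0E jE !(inj_eq lift_inj).
  by rewrite fupd_other ?neq_lift // /fcons unlift_none.
rewrite i0E jE !(fupd_other _ _ (_ : i != _)) ?(fupd_other _ _ (_ : lift i j != _)) ?(inj_eq lift_inj) ?neq_lift //.
by rewrite -jE -i0E !E wL.
Qed.

(** Up to sign, the derivative of [w] is the sum over [m] of the two-form given by
    the [m]-th component of the bracket wedged with the contraction of [w]. *)
Lemma ce_diff_is_form k (w : kform V k.+1) : (k <= 3)%N -> is_form w -> is_form (ce_diff br w).
Proof.
move=> k3 wF; have wL : multilinear w by case: wF.
pose cform m : kform V 2 := fun v => g (br (v ord0) (v ord_max)) (b m).
have brxx x : br x x = 0 by case: brP.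
have cformL m : is_form (cform m).
  apply: (@pairing_is_form _ _ (fun x y => g (br x y) (b m))) => [a x x' y|a x y y'|x]; last by rewrite brxx (metric0l gP).
    by rewrite bracket_linl (metricDl gP) (metricZl gP).
  by rewrite bracket_linr (metricDl gP) (metricZl gP).
have contrL m : is_form (contract (b m) w) by exact: contract_is_form.
pose dw : kform V k.+2 := fun v => - \sum_(m < 7) wedge (cform m) (contract (b m) w) v.
have dwF : is_form dw.
  have wmF m : is_form (wedge (cform m) (contract (b m) w)).
    by apply: wedge_is_form; [case: (cformL m)|case: (contrL m)].
  split=> [v i a x y|v i j ij vij]; rewrite /dw.
    rewrite mulrN -opprD mulr_sumr -big_split; congr (- _); apply: eq_bigr => m _.
    by case: (wmF m) => ->.
  by rewrite big1 ?oppr0 // => m _; case: (wmF m) => _; apply; [exact: ij|].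
suff -> : ce_diff br w = dw by [].
apply: frame_ext.
- exact: ce_diff_multilinear.
- by case: dwF.
move=> s sk s7; rewrite ev_ce_diff //.
have -> : ev b dw s = - \sum_(m < 7) shuffle (Rarith R) 2 k (ev b (cform m)) (fun l => ev b w ((m : nat) :: l)) s.
  rewrite /ev /dw; congr (- _); apply: eq_bigr => m _.
  rewrite -[LHS]/(ev b (wedge (cform m) (contract (b m) w)) s).
  rewrite ev_wedge //; [|exact: is_form_alternating|exact: is_form_alternating].
  by apply: (@eq_shuffle _ _ index7) => // l _ _; exact: ev_contract.
have cformE (m x y : nat) : ev b (cform m) [:: x; y] = struct_const x y m by [].
rewrite !big_ord_recl big_ord0; move: (ev b w) => f.
case: k k3 {w wF wL contrL dw dwF} sk => [|[|[|[|//]]]] _;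
case: s {s7} => [|i [|j [|k [|l [|n [|//]]]]]] //= _;
rewrite /ce_comp /= !cformE /asign /= ?realZ1 ?realZN1 ?realZ0; ring.
Qed.

Lemma ev_torsion s : size s = 3%N -> all index7 s ->
  6 * ev b tor s = torsion_comp (Rarith R) dphi_comp s.
Proof.
move=> s3 s7; rewrite /g2_torsion.
set dphi := ce_diff br phi.
have dphiF : is_form dphi by exact: ce_diff_is_form.
have E : @hodge R V 7 0 g vol (wedge dphi phi) (fun=> 0) =
   hodge_comp (Rarith R) (shuffle (Rarith R) 4 3 dphi_comp (phi_cst (Rarith R))) [::].
  have -> : (fun=> 0) = (fun i : 'I_0 => b (nth 0%N [::] i)).
    by apply/funext; case.
  rewrite -/(ev b (@hodge R V 7 0 g vol (wedge dphi phi)) [::]).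
  rewrite (@ev_hodge 7 0) //; last first.
    by apply: (@wedge_is_form _ _ 4 3); [case: dphiF|case: phiF].
  apply: (@eq_hodge_comp _ _ 0) => // l l7 l_7.
  rewrite (ev_wedge b (is_form_alternating dphiF) (is_form_alternating phiF)) //.
  apply: (@eq_shuffle _ _ index7) => // l' l'4 l'7; exact: ce_diff_ev_phi.
rewrite {1}/ev /= {1}/GRing.add {1}/GRing.opp {1}/GRing.scale /= E.
rewrite /torsion_comp; set H := hodge_comp _ _ [::].
rewrite -/(ev b phi s) -/(ev b (@hodge R V 4 3 g vol dphi) s) (phiE s3 s7).
rewrite (@ev_hodge 4 3) //.
rewrite (@eq_hodge_comp _ (Rarith R) 3 (ev b dphi) dphi_comp) //; last first.
  by move=> l l4 l7; exact: ce_diff_ev_phi.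
rewrite /= (_ : realZ R (-6)%BZ = - 6%:R) // mulNr mulrBr !mulrA mulfV ?pnatr_eq0 //.
by rewrite mul1r.
Qed.

Local Notation gam := (connection_comp (Rarith R) struct_const
  (torsion_comp (Rarith R) dphi_comp)).

(** The Koszul formula: a metric connection without torsion is determined by the
    bracket. *)
Lemma levi_civita_koszul LC x y z : levi_civita br g LC ->
  2 * g (LC x y) z = g (br x y) z + g (br z x) y - g (br y z) x.
Proof.
move=> [[_ LCm] LC0].
have brE u v : br u v = LC u v - LC v u.
  by have := LC0 u v; rewrite /torsion => /eqP; rewrite subr_eq0 => /eqP ->.
rewrite !brE !(metricDl gP) !(metricNl gP).
have A u v w : g (LC u v) w = - g (LC u w) v.
  by apply/eqP; rewrite -addr_eq0 (metricC gP (LC u w)) LCm.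
rewrite (A z x y) (A y z x) (A x z y).
set p := g (LC x y) z; set q := g (LC y x) z; set r := g (LC z y) x.
ring.
Qed.

Lemma connection_compE nabla LC x y z : levi_civita br g LC ->
    (forall x y z, g (nabla x y) z = g (LC x y) z + 2^-1 * tor (vec3 x y z)) ->
    (x < 7)%N -> (y < 7)%N -> (z < 7)%N ->
  12 * g (nabla (b x) (b y)) (b z) = gam x y z.
Proof.
move=> LCP nablaE x7 y7 z7.
rewrite nablaE mulrDr.
have -> : 12 * g (LC (b x) (b y)) (b z) = 6 * (2 * g (LC (b x) (b y)) (b z)).
  by rewrite mulrA -natrM.
rewrite (levi_civita_koszul _ _ _ LCP).
have -> : 12 * (2^-1 * tor (vec3 (b x) (b y) (b z))) = 6 * ev b tor [:: x; y; z].
  rewrite mulrA (_ : 12 / 2 = 6 :> R); last by rewrite (_ : 12 = 6 * 2) ?mulfK ?pnatr_eq0 // -natrM.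
  congr (_ * tor _); apply/funext => i; rewrite /vec3.
  by case: i => -[|[|[|]]].
rewrite ev_torsion //; last by apply/and4P.
rewrite /connection_comp /koszul_comp /= /struct_const; congr (_ * _ + _).
by rewrite addrA realZN1 mulN1r.
Qed.

Lemma curvature_compE nabla x y a z : bilinear_map nabla ->
    (forall x y z, (x < 7)%N -> (y < 7)%N -> (z < 7)%N ->
       12 * g (nabla (b x) (b y)) (b z) = gam x y z) ->
    (x < 7)%N -> (y < 7)%N -> (a < 7)%N -> (z < 7)%N ->
  144 * g (curvature br nabla (b x) (b y) (b a)) (b z)
    = curvature_comp (Rarith R) struct_const gam x y a z.
Proof.
move=> [nl nr] nE x7 y7 a7 z7.
have lin_sum (f : V -> V) (r : 'I_7 -> R) (v : 'I_7 -> V) : linear f ->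
    f (\sum_l r l *: v l) = \sum_l r l *: f (v l).
  move=> fL; elim/big_rec2: _ => [|l u u' _ <-]; last by rewrite fL.
  by have := fL (-1) 0 0; rewrite scaler0 addr0 scaleN1r addNr.
rewrite /curvature /curvature_comp -sum_frame.
rewrite !(metricDl gP) !(metricNl gP).
rewrite (orthonormal_expand gP dimV bO (nabla (b y) (b a))) (lin_sum _ _ _ (nr _)).
rewrite (orthonormal_expand gP dimV bO (nabla (b x) (b a))) (lin_sum _ _ _ (nr _)).
rewrite (orthonormal_expand gP dimV bO (br _ _)) (lin_sum _ _ _ (nl _)).
rewrite !(metric_suml gP) -!sumrN -!big_split mulr_sumr; apply: eq_bigr => l _.
rewrite !(metricZl gP) -!nE //= /struct_const realZN1 (_ : realZ R 12%BZ = 12%:R) //.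
ring.
Qed.

Lemma instanton_compE nabla a z s : bilinear_map nabla ->
    (forall x y z, (x < 7)%N -> (y < 7)%N -> (z < 7)%N ->
       12 * g (nabla (b x) (b y)) (b z) = gam x y z) ->
    (a < 7)%N -> (z < 7)%N -> size s = 6%N -> all index7 s ->
  144 * ev b (wedge ((fun v => g (curvature br nabla (v ord0) (v ord_max) (b a)) (b z)) : kform V 2)
          (g2_psi g vol phi)) s
    = instanton_comp (Rarith R) struct_const gam a z s.
Proof.
move=> nL nE a7 z7 s6 s7; rewrite /ev wedgeZl.
set F := (fun v => _) : kform V 2.
have FF : is_form F.
  apply: (@pairing_is_form _ _ (fun x y => 144 * g (curvature br nabla x y (b a)) (b z))).
  - move=> r x x' y; rewrite (_ : curvature br nabla (r *: x + x') y (b a) =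
      r *: curvature br nabla x y (b a) + curvature br nabla x' y (b a)).
      by rewrite (metricDl gP) (metricZl gP) mulrDr mulrCA.
    rewrite /curvature bracket_linl; case: nL => nl nr; rewrite !nl !nr.
    by apply: (metric_inj gP) => u; rewrite !(metricDl gP, metricNl gP, metricZl gP); ring.
  - move=> r x y y'; rewrite (_ : curvature br nabla x (r *: y + y') (b a) =
      r *: curvature br nabla x y (b a) + curvature br nabla x y' (b a)).
      by rewrite (metricDl gP) (metricZl gP) mulrDr mulrCA.
    rewrite /curvature bracket_linr; case: nL => nl nr; rewrite !nl !nr.
    by apply: (metric_inj gP) => u; rewrite !(metricDl gP, metricNl gP, metricZl gP); ring.
  - move=> x; rewrite /curvature subrr; have -> : br x x = 0 by case: brP.
    case: nL => nl _; have := nl (b a) (-1) 0 0; rewrite scaler0 addr0 scaleN1r addNr => ->.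
    by rewrite subrr (metric0l gP) mulr0.
have psiF : is_form (g2_psi g vol phi) by exact: (@hodge_is_form _ _ g 3 4).
rewrite -/(ev b (wedge F (g2_psi g vol phi)) s).
rewrite (ev_wedge b (is_form_alternating FF) (is_form_alternating psiF)) //.
apply: (@eq_shuffle _ _ index7) => // l l2 l7; last exact: ev_psi.
by rewrite -(curvature_compE nL nE) //; exact: nth_lt7.
Qed.

End Adapted.

(** * Adapted frames and coframes *)

Section Coframes.
Variables (R : realType) (V : vectType R).

Definition dual_frame (e : seq 'Hom(V, R^o)) (b : nat -> V) : Prop :=
  forall i j, (i < 7)%N -> (j < 7)%N -> nth 0 e i (b j) = (i == j)%:R.

Lemma dual_frame_exists (e : 7.-tuple 'Hom(V, R^o)) :
  basis_of fullv e -> exists b, dual_frame e b.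
Proof.
move=> /basis_free/freeP efree.
pose M : 'M[R]_(7, \dim {:V}) := \matrix_(i, k) (tnth e i) (tnth (vbasis {:V}) k).
have Mfree : row_free M.
  apply: inj_row_free => v vM; apply/rowP => i; rewrite mxE.
  apply: (efree (v 0)); apply/lfunP => u; rewrite lfunE /=.
  rewrite (coord_vbasis (memvf u)) linear_sum big1 // => k _.
  rewrite linearZ /= sum_lfunE -tnth_nth.
  have /rowP/(_ k) := vM; rewrite !mxE => vMk.
  rewrite (_ : \sum_(j < 7) _ = 0) ?scaler0 // -[RHS]vMk.
  by apply: eq_bigr => j _; rewrite scale_lfunE mxE -tnth_nth.
have [B MB] := row_freeP Mfree.
exists (fun j => \sum_k B k (inord j) *: tnth (vbasis {:V}) k) => i j i7 j7.
have /matrixP/(_ (inord i) (inord j)) := MB; rewrite !mxE -val_eqE /= !inordK // => <-.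
rewrite linear_sum; apply: eq_bigr => k _; rewrite linearZ /= mxE.
by rewrite (tnth_nth 0 e) inordK // mulrC.
Qed.

Lemma ev_covector (e : seq 'Hom(V, R^o)) b i s : dual_frame e b ->
    (i < 7)%N -> size s = 1%N -> all index7 s ->
  ev b (form_of_covector (nth 0 e i)) s
    = acst (Rarith R) (if s == [:: i] then 1%BZ else 0%BZ).
Proof.
case: s => [|j [|//]] //= eb i7 _ /andP[j7 _].
rewrite /ev /form_of_covector /= eb // eqseq_cons andbT (eq_sym j).
by case: (i == j).
Qed.

Lemma ev_monomial (e : seq 'Hom(V, R^o)) b I s : dual_frame e b ->
    all (fun i => (i.-1 < 7)%N) I -> size s = size I -> all index7 s ->
  ev b (monomial e I) s = monomial_comp (Rarith R) I s.
Proof.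
move=> eb; elim: I s => [|i I IH] s /=; first by case: s.
move=> /andP[i7 I7] sI s7; rewrite (@ev_wedge _ _ b 1 (size I)) //.
- apply: (@eq_shuffle _ _ index7) => // l l1 l7; last exact: IH.
  exact: ev_covector.
- exact/is_form_alternating/covector_is_form.
- exact/is_form_alternating/monomial_is_form.
Qed.

Lemma ev_g2_model (e : seq 'Hom(V, R^o)) b s : dual_frame e b ->
  size s = 3%N -> all index7 s -> ev b (g2_model e) s = realZ R (phiZ s).
Proof.
move=> eb s3 s7; rewrite phiZE // (hom_model_comp (realZ_hom R)) /model_comp.
rewrite -!(ev_monomial eb) //= realZN1 !mulN1r.
by [].
Qed.

Lemma multilinear_scale k (w : kform V k) (v : 'I_k -> V) (a : R) :
  multilinear w -> w (fun i => a *: v i) = a ^+ k * w v.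
Proof.
move=> wL.
suff H m : (m <= k)%N -> w (fun i : 'I_k => if (i < m)%N then a *: v i else v i) = a ^+ m * w v.
  by rewrite -H //; congr w; apply/funext => i; rewrite ltn_ord.
elim: m => [|m IH] mk.
  by rewrite mul1r; congr w; apply/funext => i.
pose i0 := Ordinal mk; set u := fun i => _.
have -> : u = fupd u i0 (a *: v i0 + 0).
  by rewrite addr0 -[RHS](fupd_id _ i0) fupd_same fupdK -[in RHS](_ : u i0 = a *: v i0) ?fupd_id // /u /= ltnSn.
rewrite wL (multilinear0 _ _ wL) addr0 exprS -mulrA -IH; last exact: ltnW.
congr (_ * w _); apply/funext => i; have [->|ii0] := eqVneq i i0.
  by rewrite fupd_same /= ltnn.
by rewrite fupd_other // /u ltnS leq_eqVlt -[_ == m]/(i == i0) (negPf ii0).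
Qed.

End Coframes.
Section MetricOfModel.
Variables (R : realType) (V : vectType R) (g : V -> V -> R^o).
Variables (vol : kform V 7) (phi : kform V 3).
Hypothesis dimV : \dim {:V} = 7%N.
Hypothesis gvolP : g2_metric phi g vol.
Hypothesis phiF : is_form phi.

Let gP : inner_product g. Proof. by case: gvolP. Qed.
Let volF : is_form vol. Proof. by case: gvolP => _ []. Qed.

Definition metric_comp (x y : nat) : Z :=
  shuffle Zarith 4 3
    (shuffle Zarith 2 2 (fun l => phiZ (x :: l)) (fun l => phiZ (y :: l)))
    phiZ (iota 0 7).

Lemma metric_compE x y : (x < 7)%N -> (y < 7)%N ->
  metric_comp x y = if x == y then 6%BZ else 0%BZ.
Proof.
move=> x7 y7; apply/eqP.
have : all (fun x => all (fun y => metric_comp x y == if x == y then 6%BZ else 0%BZ)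
  (iota 0 7)) (iota 0 7) by vm_compute.
by move=> /allP/(_ x); rewrite mem_iota => /(_ x7) /allP/(_ y); rewrite mem_iota; apply.
Qed.

(** The form fixes the product of metric and volume form, whether or not the
    frame is already known to be orthonormal. *)
Lemma metric_vol_frame b x y :
    (forall s, size s = 3%N -> all index7 s -> ev b phi s = realZ R (phiZ s)) ->
    (x < 7)%N -> (y < 7)%N ->
  g (b x) (b y) * ev b vol (iota 0 7) = (x == y)%:R.
Proof.
move=> phib x7 y7; have [_ _ /(_ (b x) (b y)) gvolE] := gvolP.
have contrF z : is_form (contract (b z) phi) by exact: contract_is_form.
have wF : is_form (wedge (contract (b x) phi) (contract (b y) phi)).
  by apply: wedge_is_form; [case: (contrF x)|case: (contrF y)].
have := congr1 (fun w => ev b w (iota 0 7)) gvolE.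
rewrite (@ev_wedge _ _ b 4 3) //; [|exact: is_form_alternating|exact: is_form_alternating].
rewrite (_ : shuffle _ _ _ _ _ _ = realZ R (metric_comp x y)).
  rewrite metric_compE // -[ev b _ _]/(6 * g (b x) (b y) * ev b vol (iota 0 7)) -mulrA => gv.
  have six : (6 : R) != 0 by rewrite pnatr_eq0.
  by apply: (mulfI six); rewrite -gv; case: (x == y); rewrite ?mulr1 ?mulr0.
rewrite /metric_comp (@hom_shuffle _ _ _ _ _ (realZ_hom R) _ _ _ _
  (shuffle (Rarith R) 2 2 (fun l => realZ R (phiZ (x :: l))) (fun l => realZ R (phiZ (y :: l))))
  (fun l => realZ R (phiZ l))) //; last by move=> l; exact: (hom_shuffle (realZ_hom R)).
apply: (@eq_shuffle _ _ index7) => // l l4 l7.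
rewrite (@ev_wedge _ _ b 2 2) //; [|exact/is_form_alternating/contrF|exact/is_form_alternating/contrF].
apply: (@eq_shuffle _ _ index7) => // l' l'2 l'7; rewrite ev_contract phib //= ?l'2 //.
  by rewrite /index7 x7.
by rewrite /index7 y7.
Qed.

Lemma adapted_vol b : adapted g phi b -> ev b vol (iota 0 7) = 1.
Proof.
move=> [bO phib]; have := @metric_vol_frame b 0 0 phib isT isT.
by rewrite bO // mul1r.
Qed.

Lemma dual_frame_adapted (e : seq 'Hom(V, R^o)) b :
  phi = g2_model e -> dual_frame e b -> adapted g phi b.
Proof.
move=> phiE eb; have phib s : size s = 3%N -> all index7 s -> ev b phi s = realZ R (phiZ s).
  by rewrite phiE; exact: ev_g2_model.
split=> //; have gv := @metric_vol_frame b _ _ phib.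
set c := ev b vol (iota 0 7) in gv.
suff c1 : c = 1 by move=> i j i7 j7; rewrite -(gv _ _ i7 j7) c1 mulr1.
have c0 : c != 0.
  by apply: contraPneq (gv 0%N 0%N isT isT) => ->; rewrite mulr0 => /esym/eqP; rewrite oner_eq0.
have c_gt0 : 0 < c.
  have b0 : b 0%N != 0.
    apply: contraPneq (gv 0%N 0%N isT isT) => ->.
    by rewrite (metric0l gP) mul0r => /esym/eqP; rewrite oner_eq0.
  by rewrite -(pmulr_rgt0 _ (metric_gt0 gP b0)) gv.
pose r := Num.sqrt c; have r_gt0 : 0 < r by rewrite sqrtr_gt0.
have r2 : r ^+ 2 = c by rewrite sqr_sqrtr // ltW.
have [_ [_ /(_ (fun i => r *: b i)) vol1] _] := gvolP.
have : vol (fun i : 'I_7 => r *: b i) = 1 \/ vol (fun i : 'I_7 => r *: b i) = -1.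
  apply: vol1 => i j; rewrite (metricZl gP) (metricZr gP) mulrA -expr2 r2 mulrC.
  by rewrite gv.
have volb : vol (fun i : 'I_7 => b i) = c.
  by congr vol; apply/funext => i; rewrite nth_iota.
rewrite multilinear_scale ?volb; last by case: volF.
have r7c : 0 < r ^+ 7 * c by rewrite mulr_gt0 // exprn_gt0.
move=> [r9|r9]; last by move: r7c; rewrite r9 oppr_gt0 ltr10.
have /eqP : r ^+ 9 = 1 by rewrite -r9 -r2 -exprD.
by rewrite pexpr_eq1 ?ltW // => /eqP r1; rewrite -r2 r1 expr1n.
Qed.

Lemma coframe_exists b : orthonormal g 7 b ->
  exists e : 7.-tuple 'Hom(V, R^o), basis_of fullv e /\ dual_frame e b.
Proof.
move=> bO.
have [f fE] : exists f : nat -> 'Hom(V, R^o), forall i v, f i v = g v (b i).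
  suff H u : exists f : 'Hom(V, R^o), forall v, f v = g v u.
    have [f fE] := choice (fun i => H (b i)); by exists f.
  have gl : linear (g^~ u) by case: gP => -[].
  pose L : {linear V -> R^o} := HB.pack (g^~ u) (GRing.isLinear.Build R V R^o _ (g^~ u) gl).
  by exists (linfun L) => v; rewrite lfunE.
pose e := [tuple f i | i < 7].
have eE i : (i < 7)%N -> nth 0 e i = f i.
  by move=> i7; rewrite -[ i ]/(nat_of_ord (Ordinal i7)) -tnth_nth tnth_mktuple.
have eb : dual_frame e b by move=> i j i7 j7; rewrite eE // fE bO // eq_sym.
exists e; split=> //; rewrite basisEfree subvf size_tuple.
have -> : free e.
  apply/freeP => a ae j; have := congr1 (fun h : 'Hom(V, R^o) => h (b j)) ae.
  rewrite /= zero_lfunE sum_lfunE (bigD1 j) //= scale_lfunE eb // eqxx.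
  rewrite big1 => [|i ij]; first by rewrite addr0 => <-; rewrite /GRing.scale /= mulr1.
  by rewrite scale_lfunE eb // (inj_eq val_inj) (negPf ij) scaler0.
by rewrite dimvf -[dim _]/(dim V * 1)%N muln1 -dimvf dimV.
Qed.

Lemma adapted_model (e : seq 'Hom(V, R^o)) b :
  adapted g phi b -> dual_frame e b -> phi = g2_model e.
Proof.
move=> bA eb; apply: (frame_ext dimV gP bA) => [||s s3 s7]; [by case: phiF| |].
  by case: (g2_model_is_form e).
by rewrite (ev_g2_model eb) //; case: bA => _; apply.
Qed.

End MetricOfModel.

(** * The cross product, and adapted frames through given vectors *)

Section CrossProduct.
Variables (R : realType) (V : vectType R) (g : V -> V -> R^o) (phi : kform V 3).
Hypothesis dimV : \dim {:V} = 7%N.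
Hypothesis gP : inner_product g.
Hypothesis phiF : is_form phi.
Variable b0 : nat -> V.
Hypothesis b0A : adapted g phi b0.

Definition cross (x y : V) : V := \sum_(m < 7) phi (vec3 x y (b0 m)) *: b0 m.

Lemma vec3E (x y z : V) : vec3 x y z = fcons x (fcons y (fcons z (fun=> 0))) :> ('I_3 -> V).
Proof.
apply/funext => -[[|[|[|//]]] i3]; rewrite /fcons /vec3 /=.
- by rewrite (_ : Ordinal i3 = ord0) ?unlift_none //; apply: val_inj.
- rewrite (_ : Ordinal i3 = lift ord0 ord0) ?liftK ?unlift_none //; exact: val_inj.
- rewrite (_ : Ordinal i3 = lift ord0 (lift ord0 ord0)) ?liftK ?unlift_none //; exact: val_inj.
Qed.

Let i30 : 'I_3 := ord0.
Let i31 : 'I_3 := lift ord0 ord0.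
Let i32 : 'I_3 := ord_max.

Lemma vec3_fupd0 (x y z t : V) : fupd (vec3 x y z) i30 t = vec3 t y z.
Proof.
apply/funext => i; have [->|ii] := eqVneq i i30; first by rewrite fupd_same.
by rewrite fupd_other //; case: i ii => -[|[|[|]]].
Qed.

Lemma vec3_fupd1 (x y z t : V) : fupd (vec3 x y z) i31 t = vec3 x t z.
Proof.
apply/funext => i; have [->|ii] := eqVneq i i31; first by rewrite fupd_same.
by rewrite fupd_other //; case: i ii => -[|[|[|]]].
Qed.

Lemma vec3_fupd2 (x y z t : V) : fupd (vec3 x y z) i32 t = vec3 x y t.
Proof.
apply/funext => i; have [->|ii] := eqVneq i i32; first by rewrite fupd_same.
by rewrite fupd_other //; case: i ii => -[|[|[|]]].
Qed.

Local Notation phi3 x y z := (phi (vec3 x y z)).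

Lemma phi3_lin0 a x x' y z : phi3 (a *: x + x') y z = a * phi3 x y z + phi3 x' y z.
Proof. by case: phiF => L _; have := L (vec3 x y z) i30 a x x'; rewrite !vec3_fupd0. Qed.

Lemma phi3_lin1 a x x' y z : phi3 y (a *: x + x') z = a * phi3 y x z + phi3 y x' z.
Proof. by case: phiF => L _; have := L (vec3 y x z) i31 a x x'; rewrite !vec3_fupd1. Qed.

Lemma phi3_lin2 a x x' y z : phi3 y z (a *: x + x') = a * phi3 y z x + phi3 y z x'.
Proof. by case: phiF => L _; have := L (vec3 y z x) i32 a x x'; rewrite !vec3_fupd2. Qed.

Lemma phi3_swap01 x y z : phi3 x y z = - phi3 y x z.
Proof.
rewrite -mulN1r; have := is_form_alternating phiF (tperm i30 i31) (vec3 y x z).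
rewrite odd_tperm expr1 => <-; congr phi; apply/funext => i.
by case: tpermP => [->|->|/eqP + /eqP] //; case: i => -[|[|[|]]].
Qed.

Lemma phi3_swap12 x y z : phi3 x y z = - phi3 x z y.
Proof.
rewrite -mulN1r; have := is_form_alternating phiF (tperm i31 i32) (vec3 x z y).
rewrite odd_tperm expr1 => <-; congr phi; apply/funext => i.
by case: tpermP => [->|->|/eqP + /eqP] //; case: i => -[|[|[|]]].
Qed.

Let b0O : orthonormal g 7 b0. Proof. by case: b0A. Qed.

Lemma metric_cross x y z : g (cross x y) z = phi3 x y z.
Proof.
rewrite /cross (metric_suml gP) [in RHS](orthonormal_expand gP dimV b0O z).
have L : multilinear phi by case: phiF.
rewrite -(vec3_fupd2 x y 0) (multilinear_sum _ _ _ _ _ _ L); apply: eq_bigr => m _.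
by rewrite (metricZl gP) mulrC vec3_fupd2 (metricC gP).
Qed.

Lemma crossC x y : cross x y = - cross y x.
Proof. by apply: (metric_inj gP) => z; rewrite (metricNl gP) !metric_cross phi3_swap01. Qed.

Lemma crossNl x y : cross (- x) y = - cross x y.
Proof.
apply: (metric_inj gP) => z; rewrite (metricNl gP) !metric_cross.
have := phi3_lin0 (-1) x 0 y z; rewrite addr0 scaleN1r mulN1r => ->.
by have := phi3_lin0 (-1) 0 0 y z; rewrite scaler0 addr0 mulN1r addNr => ->; rewrite addr0.
Qed.

Lemma crossNr x y : cross x (- y) = - cross x y.
Proof. by rewrite crossC crossNl crossC opprK. Qed.

(** The identity that makes seven-dimensional space the imaginary octonions,
    polarised in the repeated factor; by multilinearity it is a statement about
    the integers [phiZ]. *)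
Definition cross_polar_comp (s : seq nat) : bool :=
  let p i j m := phiZ [:: nth 0%N s i; nth 0%N s j; m] in
  let d i j := if nth 0%N s i == nth 0%N s j then 1%BZ else 0%BZ in
  let q i j k l := foldr (fun m z => Z.add (Z.mul (p i j m) (phiZ [:: nth 0%N s k; m; nth 0%N s l])) z) 0%BZ (iota 0 7) in
  Z.eqb (Z.add (q 1 2 0 3) (q 0 2 1 3))
   (Z.add (Z.mul (-2)%BZ (Z.mul (d 0 1) (d 2 3))) (Z.add (Z.mul (d 0 2) (d 1 3)) (Z.mul (d 1 2) (d 0 3)))).

Lemma cross_polar_compE : all (fun i => all (fun j => all (fun k => all (fun l =>
  cross_polar_comp [:: i; j; k; l]) (iota 0 7)) (iota 0 7)) (iota 0 7)) (iota 0 7).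
Proof. by vm_compute. Qed.

Lemma cross_linl a x x' y : cross (a *: x + x') y = a *: cross x y + cross x' y.
Proof.
apply: (metric_inj gP) => z.
by rewrite (metricDl gP) (metricZl gP) !metric_cross phi3_lin0.
Qed.

Lemma cross_linr a x y y' : cross x (a *: y + y') = a *: cross x y + cross x y'.
Proof.
apply: (metric_inj gP) => z.
by rewrite (metricDl gP) (metricZl gP) !metric_cross phi3_lin1.
Qed.

Let phi3_frame i j k : (i < 7)%N -> (j < 7)%N -> (k < 7)%N ->
  phi3 (b0 i) (b0 j) (b0 k) = realZ R (phiZ [:: i; j; k]).
Proof.
move=> i7 j7 k7; case: b0A => _ <- //=; last by rewrite /index7 i7 j7 k7.
by congr phi; apply/funext => -[[|[|[|]]]].
Qed.

Let cross_frame i j k l : (i < 7)%N -> (j < 7)%N -> (k < 7)%N -> (l < 7)%N ->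
  g (cross (b0 i) (cross (b0 j) (b0 k))) (b0 l) =
  realZ R (foldr (fun m z => Z.add (Z.mul (phiZ [:: j; k; m]) (phiZ [:: i; m; l])) z)
    0%BZ (iota 0 7)).
Proof.
move=> i7 j7 k7 l7; rewrite metric_cross {1}/cross -(vec3_fupd1 (b0 i) 0 (b0 l)).
rewrite multilinear_sum; last by case: phiF.
rewrite -[foldr _ _ _]/(asum Zarith (iota 0 7) (fun m => amul Zarith (phiZ [:: j; k; m]) (phiZ [:: i; m; l]))).
rewrite (hom_asum (realZ_hom R) _ (F' := fun m => realZ R (phiZ [:: j; k; m]) * realZ R (phiZ [:: i; m; l]))).
  by rewrite -sum_frame; apply: eq_bigr => m _; rewrite vec3_fupd1 !phi3_frame.
by move=> m; rewrite (hom_mul (realZ_hom R)).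
Qed.

Lemma cross_polar x x' y :
  cross x (cross x' y) + cross x' (cross x y)
    = - (2 * g x x') *: y + g x y *: x' + g x' y *: x.
Proof.
apply: (metric_inj gP) => w.
pose j1 : 'I_4 := Ordinal (isT : (1 < 4)%N); pose j2 : 'I_4 := Ordinal (isT : (2 < 4)%N).
pose L : kform V 4 := fun v => g (cross (v ord0) (cross (v j1) (v j2))
   + cross (v j1) (cross (v ord0) (v j2))) (v ord_max).
pose K : kform V 4 := fun v => - (2 * g (v ord0) (v j1)) * g (v j2) (v ord_max)
   + g (v ord0) (v j2) * g (v j1) (v ord_max) + g (v j1) (v j2) * g (v ord0) (v ord_max).
have E : L = K.
  apply: (frame_ext dimV gP b0A).
  - move=> v i a u u'; rewrite /L.
    have : [\/ i = ord0, i = j1, i = j2 | i = ord_max].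
      by case: i => -[|[|[|[|]]]] // i4; [constructor 1|constructor 2|constructor 3|constructor 4]; apply: val_inj.
    by case=> ->; rewrite !fupd_same ?[fupd v _ _ ord0]fupd_other ?[fupd v _ _ j1]fupd_other
      ?[fupd v _ _ j2]fupd_other ?[fupd v _ _ ord_max]fupd_other // ?cross_linl ?cross_linr
      ?cross_linr ?cross_linl !(metricDl gP) ?(metricZl gP) ?(metricDr gP) ?(metricZr gP); ring.
  - move=> v i a u u'; rewrite /K.
    have : [\/ i = ord0, i = j1, i = j2 | i = ord_max].
      by case: i => -[|[|[|[|]]]] // i4; [constructor 1|constructor 2|constructor 3|constructor 4]; apply: val_inj.
    by case=> ->; rewrite !fupd_same ?[fupd v _ _ ord0]fupd_other ?[fupd v _ _ j1]fupd_other
      ?[fupd v _ _ j2]fupd_other ?[fupd v _ _ ord_max]fupd_other //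
      ?(metricDl gP, metricZl gP, metricDr gP, metricZr gP); ring.
  case=> [|i [|j [|k [|l [|]]]]] // _ /and5P[i7 j7 k7 l7 _].
  rewrite /ev /L /K /= (metricDl gP) !cross_frame // !b0O //.
  have := cross_polar_compE.
  move=> /allP/(_ i); rewrite mem_iota => /(_ i7).
  move=> /allP/(_ j); rewrite mem_iota => /(_ j7).
  move=> /allP/(_ k); rewrite mem_iota => /(_ k7).
  move=> /allP/(_ l); rewrite mem_iota => /(_ l7) /Z.eqb_eq/(congr1 (realZ R)).
  have [rD rM _] := realZ_hom R.
  have dE m n : realZ R (if m == n then 1%BZ else 0%BZ) = (m == n)%:R by case: (m == n).
  rewrite ?(rD, rM) /= !dE => ->.
  by rewrite (_ : realZ R (-2)%BZ = - 2%:R) //; ring.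
pose v : 'I_4 -> V := fun i => nth 0 [:: x; x'; y; w] i.
have := congr1 (fun F => F v) E; rewrite /L /K /v /= => ->.
by rewrite !(metricDl gP) !(metricZl gP).
Qed.

Lemma cross_cross x y : cross x (cross x y) = - g x x *: y + g x y *: x.
Proof.
apply: (metric_inj gP) => w; have := congr1 (g^~ w) (cross_polar x x y).
rewrite !(metricDl gP) !(metricZl gP); lra.
Qed.

Lemma metric_cross2 u v w :
  g (cross u v) (cross u w) = g u u * g v w - g u v * g u w.
Proof.
rewrite metric_cross phi3_swap12 -metric_cross cross_cross.
rewrite (metricDl gP) !(metricZl gP) (metricC gP w); ring.
Qed.

Lemma cross_unit u v : g u u = 1 -> g u v = 0 -> cross u (cross u v) = - v.
Proof. by move=> u1 uv; rewrite cross_cross u1 uv scale0r addr0 scaleN1r. Qed.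

Lemma cross_anti u u' v : g u u' = 0 -> g u v = 0 -> g u' v = 0 ->
  cross u (cross u' v) = - cross u' (cross u v).
Proof.
move=> h1 h2 h3; apply/eqP; rewrite -addr_eq0 cross_polar h1 h2 h3.
by rewrite mulr0 oppr0 !scale0r !addr0.
Qed.

Lemma metric_crossl x y : g (cross x y) x = 0.
Proof.
rewrite metric_cross; have := phi3_swap01 x y x; have := phi3_swap12 y x x.
rewrite phi3_swap01 => E1 E2; lra.
Qed.

Lemma metric_crossr x y : g (cross x y) y = 0.
Proof. by rewrite crossC (metricNl gP) metric_crossl oppr0. Qed.

(** The product of two vectors of an adapted frame is a vector of the frame up to
    sign; this is its sign and its index. *)
Definition cross_index (i j : nat) : Z * nat :=
  head (0%BZ, 0%N)
    [seq (phiZ [:: i; j; m], m) | m <- iota 0 7 & phiZ [:: i; j; m] != 0%BZ].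

Lemma cross_indexP : all (fun i => all (fun j =>
  (cross_index j i == (- (cross_index i j).1, (cross_index i j).2)%R) &&
  all (fun k => phiZ [:: i; j; k] ==
    (if k == (cross_index i j).2 then (cross_index i j).1 else 0%BZ)) (iota 0 7) &&
  ((cross_index i j).2 < 7)%N)
  (iota 0 7)) (iota 0 7).
Proof. by vm_compute. Qed.

Lemma adapted_cross b : orthonormal g 7 b ->
    (forall i j, (i < j)%N -> (j < 7)%N ->
       cross (b i) (b j) = realZ R (cross_index i j).1 *: b (cross_index i j).2) ->
  adapted g phi b.
Proof.
move=> bO bX; split=> // -[|i [|j [|k [|]]]] // _ /and4P[i7 j7 k7 _].
have -> : ev b phi [:: i; j; k] = phi3 (b i) (b j) (b k).
  by congr phi; apply/funext => -[[|[|[|]]]].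
rewrite -metric_cross.
have X : cross (b i) (b j) = realZ R (cross_index i j).1 *: b (cross_index i j).2.
  have [ij|ji|->] := ltngtP i j; first exact: bX.
    move/allP: cross_indexP => /(_ j); rewrite mem_iota => /(_ j7).
    move=> /allP/(_ i); rewrite mem_iota => /(_ i7) /andP[/andP[/eqP -> _] _].
    rewrite crossC bX //= -scaleNr; congr (_ *: _).
    by rewrite /realZ rmorphN intrN.
  have -> : cross (b j) (b j) = 0.
    by apply: (metric_inj gP) => z; rewrite (metric0l gP); have := congr1 (g^~ z) (crossC (b j) (b j)); rewrite (metricNl gP); lra.
  suff -> : (cross_index j j).1 = 0%BZ by rewrite realZ0 scale0r.
  by move: j7; rewrite /index7; do 7 (case: j => [//|j]).
move/allP: cross_indexP => /(_ i); rewrite mem_iota => /(_ i7).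
move=> /allP/(_ j); rewrite mem_iota => /(_ j7) /andP[/andP[_ /allP/(_ k) K] m7].
move: K; rewrite mem_iota => /(_ k7) /eqP ->; rewrite X (metricZl gP) bO // eq_sym.
by case: eqP; rewrite ?mulr1 ?mulr0.
Qed.

(** The frame [e^1, ..., e^7] with [e^5], [e^6], [e^1] dual to [x], [y], [z]. *)
Definition triple_frame (x y z : V) (i : nat) : V :=
  nth 0 [:: z; cross (cross x y) z; cross x z; - cross y z; x; y; cross x y] i.

Lemma triple_frame_adapted x y z :
    g x x = 1 -> g y y = 1 -> g z z = 1 -> g x y = 0 -> g x z = 0 -> g y z = 0 ->
    phi3 x y z = 0 ->
  adapted g phi (triple_frame x y z).
Proof.
move=> xx yy zz xy xz yz xyz; have gC := metricC gP.
pose p := cross x y; pose q := cross x z; pose r := cross y z; pose s := cross p z.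
have px : g x p = 0 by rewrite gC metric_crossl.
have py : g y p = 0 by rewrite gC metric_crossr.
have pz : g p z = 0 by rewrite metric_cross.
have qx : g x q = 0 by rewrite gC metric_crossl.
have qz : g z q = 0 by rewrite gC metric_crossr.
have qy : g y q = 0 by rewrite gC metric_cross phi3_swap12 xyz oppr0.
have ry : g y r = 0 by rewrite gC metric_crossl.
have rz : g z r = 0 by rewrite gC metric_crossr.
have rx : g x r = 0 by rewrite gC metric_cross phi3_swap12 phi3_swap01 opprK.
have pp : g p p = 1 by rewrite metric_cross2 xx yy xy; ring.
have qq : g q q = 1 by rewrite metric_cross2 xx zz xz; ring.
have rr : g r r = 1 by rewrite metric_cross2 yy zz yz; ring.
have ss : g s s = 1 by rewrite metric_cross2 pp zz pz; ring.
have pq : g p q = 0 by rewrite metric_cross2 yz xy; ring.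
have pr : g p r = 0 by rewrite /p crossC (metricNl gP) metric_cross2 xz (gC y x) xy; ring.
have qr : g q r = 0.
  by rewrite /q /r crossC (crossC y) (metricNl gP) (metricNr gP) metric_cross2 xy (gC z x) xz; ring.
have ps : g p s = 0 by rewrite gC metric_crossl.
have sz : g z s = 0 by rewrite gC metric_crossr.
have xp : cross x p = - y by exact: cross_unit.
have yx : g y x = 0 by rewrite gC.
have zx : g z x = 0 by rewrite gC.
have zy : g z y = 0 by rewrite gC.
have zp : g z p = 0 by rewrite gC.
have rx' : g r x = 0 by rewrite gC.
have sx : g s x = 0.
  rewrite metric_cross phi3_swap12 phi3_swap01 opprK -metric_cross -/p.
  by rewrite xp (metricNl gP) yz oppr0.
have sy : g s y = 0.
  have yp : cross y p = x by rewrite /p (crossC x) crossNr cross_unit ?opprK.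
  rewrite metric_cross phi3_swap12 phi3_swap01 opprK -metric_cross -/p.
  by rewrite yp xz.
have sq : g s q = 0 by rewrite /s /q crossC (crossC x) (metricNl gP) (metricNr gP) metric_cross2 (gC p) px zx; ring.
have sr : g s r = 0 by rewrite /s /r crossC (crossC y) (metricNl gP) (metricNr gP) metric_cross2 (gC p) py zy; ring.
have yp : cross y p = x by rewrite /p (crossC x) crossNr cross_unit ?opprK.
have xq : cross x q = - z by exact: cross_unit.
have yr : cross y r = - z by exact: cross_unit.
have p_s : cross p s = - z by exact: cross_unit.
have zq : cross z q = x by rewrite /q (crossC x) crossNr cross_unit ?opprK.
have z_r : cross z r = y by rewrite /r (crossC y) crossNr cross_unit ?opprK.
have zs : cross z s = p by rewrite /s (crossC p) crossNr cross_unit ?opprK.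
have xr : cross x r = - s by rewrite /r (crossC y) crossNr cross_anti // opprK -/p crossC.
have yq : cross y q = s by rewrite /q cross_anti // -/r xr opprK.
have xs : cross x s = r by rewrite -[s]opprK -xr crossNr cross_unit ?opprK.
have ys : cross y s = - q by rewrite -yq cross_unit.
have pq' : cross p q = - r by rewrite /q cross_anti ?(gC p x) // -/s xs.
have pr' : cross p r = q by rewrite /r cross_anti ?(gC p y) // -/s ys opprK.
have qr' : cross q r = - p.
  rewrite /r (crossC y) crossNr cross_anti ?(gC q) // opprK (crossC q) crossNr -/q.
  by rewrite yq zs.
have qs : cross q s = y.
  rewrite /s cross_anti ?(gC q p) ?(gC q z) // (crossC q) zq crossNr opprK crossC xp opprK.
  by [].
have rs : cross r s = - x.
  rewrite /s cross_anti ?(gC r p) ?(gC r z) // (crossC r) z_r crossNr opprK crossC yp.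
  by [].
have E i : triple_frame x y z i = nth 0 [:: z; s; q; - r; x; y; p] i by [].
have N0 (a : R) : a = 0 -> - a = 0 by move=> ->; rewrite oppr0.
apply: adapted_cross => [i j i7 j7|i j ij j7]; rewrite !E.
  case: i i7 => [|[|[|[|[|[|[|//]]]]]]] _; case: j j7 => [|[|[|[|[|[|[|//]]]]]]] _ /=;
  rewrite ?(metricNl gP, metricNr gP) ?opprK;
  first [done | by rewrite gC | by apply: N0 | by apply: N0; rewrite gC].
case: i ij => [|[|[|[|[|[|[|//]]]]]]] ij; case: j ij j7 => [|[|[|[|[|[|[|//]]]]]]] // _ _.
all: try (match goal with |- context [cross_index ?i ?j] => let t := eval vm_compute in (cross_index i j) in change (cross_index i j) with t end).
all: rewrite /= ?realZ1 ?realZN1 ?scaleN1r ?scale1r ?crossNl ?crossNr.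
all: rewrite ?xp ?xq ?xr ?xs ?yp ?yq ?yr ?ys ?p_s ?pq' ?pr' ?qr' ?qs ?rs ?zq ?z_r ?zs ?opprK //.
all: by rewrite crossC ?xp ?xq ?xr ?xs ?yp ?yq ?yr ?ys ?p_s ?pq' ?pr' ?qr' ?qs ?rs ?zq ?z_r ?zs ?opprK.
Qed.

End CrossProduct.

(** * Computing with polynomials *)

(** Sparse polynomials with integer coefficients: a list of monomials, sorted by
    [mono_lt], with their coefficients; a monomial is the sorted list of its
    variables, with repetitions. *)
Definition poly : Type := seq (seq nat * Z).

Fixpoint mono_cmp (m n : seq nat) : comparison :=
  match m, n with
  | [::], [::] => Eq
  | [::], _ :: _ => Lt
  | _ :: _, [::] => Gt
  | i :: m', j :: n' => if Nat.compare i j is Eq then mono_cmp m' n' else Nat.compare i j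
  end.

Fixpoint add_term (m : seq nat) (a : Z) (p : poly) : poly :=
  if p is (n, c) :: p' then
    match mono_cmp m n with
    | Eq => if Z.eqb (Z.add a c) 0%BZ then p' else (m, Z.add a c) :: p'
    | Lt => (m, a) :: p
    | Gt => (n, c) :: add_term m a p'
    end
  else [:: (m, a)].

Definition poly_add (p q : poly) : poly := foldr (fun t => add_term t.1 t.2) q p.

Definition poly_mul (p q : poly) : poly :=
  foldr (fun t r => foldr (fun u => add_term (merge leq t.1 u.1) (Z.mul t.2 u.2)) r q) [::] p.

Definition poly_cst (z : Z) : poly := if Z.eqb z 0%BZ then [::] else [:: ([::], z)].

Definition Parith : arith poly := Arith poly_add poly_mul poly_cst.

Definition X (i : nat) : poly := [:: ([:: i], 1%BZ)].

(** Gaussian elimination without fractions.  Each row of [basis] is free of the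
    leading monomials of the rows before it, so one pass in order is enough. *)
Definition coef (m : seq nat) (p : poly) : Z :=
  foldr (fun t z => if mono_cmp t.1 m is Eq then t.2 else z) 0%BZ p.

Definition poly_scale (a : Z) (p : poly) : poly := [seq (t.1, Z.mul a t.2) | t <- p].

Arguments poly_scale : simpl never.

Definition primitive (p : poly) : poly :=
  let d := foldr (fun t z => Z.gcd t.2 z) 0%BZ p in
  let q := [seq (t.1, Z.div t.2 d) | t <- p] in
  if (poly_scale d q == p) && (d != 0%BZ) then q else p.

Definition reduce_by (r p : poly) : poly :=
  if r is (m, a) :: _ then
    let c := coef m p in
    if Z.eqb c 0%BZ || Z.eqb a 0%BZ then p
    else primitive (poly_add (poly_scale a p) (poly_scale (Z.opp c) r))
  else p.

Definition reduce (basis : seq poly) (p : poly) : poly := foldl (fun q r => reduce_by r q) p basis.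

Definition echelon (ps : seq poly) : seq poly :=
  foldl (fun basis p => let q := reduce basis p in if q is [::] then basis else rcons basis q)
    [::] ps.

Definition in_span (ps qs : seq poly) : bool :=
  let basis := echelon ps in all (fun q => nilp (reduce basis q)) qs.

Section Evaluation.
Variables (R : realType) (env : nat -> R).

Definition eval (p : poly) : R :=
  \sum_(t <- p) realZ R t.2 * \prod_(i <- t.1) env i.

Lemma mono_cmp_eq m n : mono_cmp m n = Eq -> m = n.
Proof.
elim: m n => [|i m IH] [|j n] //=; case E: (Nat.compare i j) => // /IH ->.
by move/Nat.compare_eq: E => ->.
Qed.

Lemma realZD x y : realZ R (Z.add x y) = realZ R x + realZ R y.
Proof. by case: (realZ_hom R) => /= ->. Qed.

Lemma realZM x y : realZ R (Z.mul x y) = realZ R x * realZ R y.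
Proof. by case: (realZ_hom R) => /= _ ->. Qed.

Lemma realZ_eq0 x : (realZ R x == 0) = (x == 0%BZ).
Proof.
rewrite /realZ intr_eq0; apply/eqP/eqP => [|-> //].
by move=> /(congr1 Z_of_int); rewrite int_of_ZK.
Qed.

Lemma eval_cons t p : eval (t :: p) = realZ R t.2 * \prod_(i <- t.1) env i + eval p.
Proof. exact: big_cons. Qed.

Lemma eval_add_term m a p :
  eval (add_term m a p) = realZ R a * \prod_(i <- m) env i + eval p.
Proof.
elim: p => [|[n c] p IH] /=; first by rewrite eval_cons.
case E: (mono_cmp m n).
- rewrite (mono_cmp_eq E) eval_cons addrA -mulrDl -realZD.
  case: Z.eqb_spec => [->|_]; last by rewrite eval_cons.
  by rewrite realZ0 mul0r add0r.
- by rewrite eval_cons.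
- by rewrite !eval_cons IH addrCA.
Qed.

Lemma eval_add p q : eval (poly_add p q) = eval p + eval q.
Proof.
elim: p => [|t p IH] /=; first by rewrite /eval big_nil add0r.
by rewrite eval_add_term IH eval_cons addrA.
Qed.

Lemma eval_mul p q : eval (poly_mul p q) = eval p * eval q.
Proof.
elim: p => [|t p IH] /=; first by rewrite /eval big_nil mul0r.
rewrite eval_cons mulrDl -IH; move: (poly_mul p q) => r; elim: {IH}q => [|u q IH] /=.
  by rewrite [eval [::]]big_nil mulr0 add0r.
rewrite eval_add_term IH [in RHS]eval_cons mulrDr -addrA; congr (_ + _).
rewrite realZM (perm_big (t.1 ++ u.1)); last by rewrite perm_merge.
by rewrite big_cat mulrACA.
Qed.

Lemma eval_cst z : eval (poly_cst z) = realZ R z.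
Proof.
rewrite /poly_cst; case: Z.eqb_spec => [->|_]; first by rewrite /eval big_nil.
by rewrite /eval big_seq1 big_nil mulr1.
Qed.

Lemma eval_hom : arith_hom Parith (Rarith R) eval.
Proof. split; [exact: eval_add|exact: eval_mul|exact: eval_cst]. Qed.

Lemma evalX i : eval (X i) = env i.
Proof. by rewrite /eval /X !big_seq1 mul1r. Qed.

Lemma eval_scale a p : eval (poly_scale a p) = realZ R a * eval p.
Proof.
elim: p => [|t p IH]; first by rewrite /eval !big_nil mulr0.
by rewrite /= !eval_cons IH /= realZM mulrDr mulrA.
Qed.

Lemma eval_primitive p : (eval (primitive p) == 0) = (eval p == 0).
Proof.
rewrite /primitive; set d := foldr _ _ _; set q := map _ _.
case: ifP => // /andP[/eqP pE d0].
by rewrite -pE eval_scale mulf_eq0 realZ_eq0 (negPf d0).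
Qed.

Lemma eval_reduce_by r p : eval r = 0 -> (eval (reduce_by r p) == 0) = (eval p == 0).
Proof.
case: r => [//|[m a] r]; rewrite /reduce_by; set r' := (m, a) :: r => r0.
case: Z.eqb_spec => //= _; case: Z.eqb_spec => //= a0.
rewrite eval_primitive eval_add !eval_scale r0 mulr0 addr0 mulf_eq0 realZ_eq0.
by case: eqP.
Qed.

Lemma eval_reduce basis p : (forall r, r \in basis -> eval r = 0) ->
  (eval (reduce basis p) == 0) = (eval p == 0).
Proof.
elim: basis p => [//|r basis IH] p b0 /=.
rewrite IH => [|r' r'b]; first by rewrite eval_reduce_by // b0 // mem_head.
by rewrite b0 // inE r'b orbT.
Qed.

Lemma eval_echelon ps : (forall p, p \in ps -> eval p = 0) ->
  forall r, r \in echelon ps -> eval r = 0.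
Proof.
rewrite /echelon; have : forall r, r \in [::] -> eval r = 0 by [].
elim: ps [::] => [//|p ps IH] basis b0 ps0 /=; apply: IH => [r|q qps]; last first.
  by apply: ps0; rewrite inE qps orbT.
case E : (reduce basis p) => [|t q]; first exact: b0.
rewrite mem_rcons inE => /predU1P[->|]; last exact: b0.
by apply/eqP; rewrite -E eval_reduce // ps0 // mem_head.
Qed.

Theorem span_sound ps qs : in_span ps qs ->
  (forall p, p \in ps -> eval p = 0) -> forall q, q \in qs -> eval q = 0.
Proof.
move=> /allP qs0 ps0 q /qs0 /nilP q0; apply/eqP.
by rewrite -(eval_reduce _ (eval_echelon ps0)) q0 /eval big_nil.
Qed.

End Evaluation.

(** * The equations of an adapted frame as polynomials *)

Section ConnectionPrograms.
Variables (T T' : Type) (A : arith T) (A' : arith T') (h : T -> T').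
Hypothesis hP : arith_hom A A' h.

Lemma hom_torsion_comp d s :
  h (torsion_comp A d s) = torsion_comp A' (fun l => h (d l)) s.
Proof.
rewrite /torsion_comp (hom_add hP) 2!(hom_mul hP) !(hom_cst hP).
congr (aadd _ (amul _ _ _) (amul _ _ _)); apply: (hom_hodge_comp hP) => // l.
by apply: (hom_shuffle hP) => // l'; exact: hom_cst hP _.
Qed.

Lemma hom_connection_comp c tor x y z :
  h (connection_comp A c tor x y z)
    = connection_comp A' (fun i j m => h (c i j m)) (fun l => h (tor l)) x y z.
Proof.
by rewrite /connection_comp /koszul_comp !((hom_add hP), (hom_mul hP), (hom_cst hP)).
Qed.

Lemma hom_curvature_comp c gam x y a z :
  h (curvature_comp A c gam x y a z)
    = curvature_comp A' (fun i j m => h (c i j m)) (fun i j m => h (gam i j m)) x y a z.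
Proof.
apply: (hom_asum hP) => l.
by rewrite !((hom_add hP), (hom_mul hP), (hom_cst hP)).
Qed.

Lemma hom_instanton_comp c gam a z s :
  h (instanton_comp A c gam a z s)
    = instanton_comp A' (fun i j m => h (c i j m)) (fun i j m => h (gam i j m)) a z s.
Proof.
apply: (hom_shuffle hP) => l; last exact: hom_cst hP _.
exact: hom_curvature_comp.
Qed.

End ConnectionPrograms.

Section EqConnection.
Variables (T : Type) (A : arith T).

Lemma eq_torsion_comp d d' s : size s = 3%N -> all index7 s ->
    (forall l, size l = 4%N -> all index7 l -> d l = d' l) ->
  torsion_comp A d s = torsion_comp A d' s.
Proof.
move=> s3 s7 dd'; congr (aadd A (amul A _ _) (amul A _ _)).
  apply: (@eq_hodge_comp _ A 0) => // l l7 l_7.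
  exact: (@eq_shuffle _ A index7).
exact: (@eq_hodge_comp _ A 3).
Qed.

Lemma eq_curvature_comp c c' gam gam' x y a z :
    (forall i j m, index7 i -> index7 j -> index7 m -> c i j m = c' i j m) ->
    (forall i j m, index7 i -> index7 j -> index7 m -> gam i j m = gam' i j m) ->
    index7 x -> index7 y -> index7 a -> index7 z ->
  curvature_comp A c gam x y a z = curvature_comp A c' gam' x y a z.
Proof.
move=> cc' gg' x7 y7 a7 z7; rewrite /curvature_comp /asum.
have : all index7 (iota 0 7) by [].
by elim: (iota 0 7) => //= l r IH /andP[l7 r7]; rewrite IH // !gg' // cc'.
Qed.

Lemma eq_instanton_comp c c' gam gam' a z s :
    (forall i j m, index7 i -> index7 j -> index7 m -> c i j m = c' i j m) ->
    (forall i j m, index7 i -> index7 j -> index7 m -> gam i j m = gam' i j m) ->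
    index7 a -> index7 z -> size s = 6%N -> all index7 s ->
  instanton_comp A c gam a z s = instanton_comp A c' gam' a z s.
Proof.
move=> cc' gg' a7 z7 s6 s7; apply: (@eq_shuffle _ A index7) => // l l2 l7.
by apply: eq_curvature_comp => //; exact: nth_lt7.
Qed.

End EqConnection.

Definition dphi_table (c : nat -> nat -> nat -> poly) : seq poly :=
  table 4 (ce_comp Parith 2 c (phi_cst Parith)).

Definition torsion_table (c : nat -> nat -> nat -> poly) : seq poly :=
  let d := dphi_table c in table 3 (torsion_comp Parith (lookup [::] d)).

Definition connection_table (c : nat -> nat -> nat -> poly) : seq poly :=
  let t := torsion_table c in
  table 3 (fun l => connection_comp Parith c (lookup [::] t)
    (nth 0%N l 0) (nth 0%N l 1) (nth 0%N l 2)).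

Definition gamma (c : nat -> nat -> nat -> poly) : nat -> nat -> nat -> poly :=
  let t := connection_table c in fun x y z => lookup [::] t [:: x; y; z].

Definition omit (r : seq nat) : seq nat := [seq i <- iota 0 7 | i \notin r].

Definition instanton_eqs (c : nat -> nat -> nat -> poly) : seq poly :=
  let gam := gamma c in
  flatten [seq flatten [seq [seq instanton_comp Parith c gam a z (omit [:: k])
    | k <- iota 0 7] | z <- iota 0 a] | a <- iota 0 7].

Definition coclosed_eqs (c : nat -> nat -> nat -> poly) : seq poly :=
  flatten [seq [seq ce_comp Parith 3 c (psi_cst Parith) (omit [:: k; l])
    | l <- iota 0 k] | k <- iota 0 7].

Definition frame_eqs c := coclosed_eqs c ++ instanton_eqs c.

Lemma omit_index7 r : all index7 (omit r).
Proof. by apply/allP => i; rewrite mem_filter mem_iota => /andP[]. Qed.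

Section Evaluate.
Variables (R : realType) (env : nat -> R) (c : nat -> nat -> nat -> poly).

Local Notation ev3 f := (fun i j m : nat => eval env (f i j m)).
Local Notation dphiR := (ce_comp (Rarith R) 2 (ev3 c) (phi_cst (Rarith R))).

Lemma eval_dphi_table s : size s = 4%N -> all index7 s ->
  eval env (lookup [::] (dphi_table c) s) = dphiR s.
Proof.
move=> s4 s7; rewrite lookup_table //; apply: (hom_ce_comp (eval_hom env)) => // l.
exact: eval_cst.
Qed.

Lemma eval_torsion_table s : size s = 3%N -> all index7 s ->
  eval env (lookup [::] (torsion_table c) s) = torsion_comp (Rarith R) dphiR s.
Proof.
move=> s3 s7; rewrite lookup_table // (hom_torsion_comp (eval_hom env)).
by apply: eq_torsion_comp => //; exact: eval_dphi_table.
Qed.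

Lemma eval_connection_table x y z : index7 x -> index7 y -> index7 z ->
  eval env (gamma c x y z)
    = connection_comp (Rarith R) (ev3 c) (torsion_comp (Rarith R) dphiR) x y z.
Proof.
move=> x7 y7 z7; rewrite /gamma lookup_table //=; last by rewrite x7 y7 z7.
rewrite (hom_connection_comp (eval_hom env)) /connection_comp eval_torsion_table //=.
by rewrite x7 y7 z7.
Qed.

End Evaluate.

Section FrameEquations.
Variables (R : realType) (V : vectType R) (br : V -> V -> V) (g : V -> V -> R^o).
Variables (vol : kform V 7) (phi : kform V 3).
Hypothesis dimV : \dim {:V} = 7%N.
Hypothesis brP : lie_bracket br.
Hypothesis gvolP : g2_metric phi g vol.
Hypothesis phiF : is_form phi.
Variables (b : nat -> V) (env : nat -> R) (c : nat -> nat -> nat -> poly).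
Hypothesis bA : adapted g phi b.
Hypothesis cE : forall i j m, index7 i -> index7 j -> index7 m ->
  struct_const br g b i j m = eval env (c i j m).

Let gP : inner_product g. Proof. by case: gvolP. Qed.
Let volF : is_form vol. Proof. by case: gvolP => _ []. Qed.
Let vol1 : ev b vol (iota 0 7) = 1. Proof. exact: (adapted_vol gvolP phiF bA). Qed.

Local Notation ev3 f := (fun i j m : nat => eval env (f i j m)).
Local Notation gamR c := (connection_comp (Rarith R) c
  (torsion_comp (Rarith R) (ce_comp (Rarith R) 2 c (phi_cst (Rarith R))))).

Lemma connection_struct_const x y z : index7 x -> index7 y -> index7 z ->
  gamR (struct_const br g b) x y z = gamR (ev3 c) x y z.
Proof.
move=> x7 y7 z7; rewrite /connection_comp /koszul_comp !cE //.
congr aadd; apply: eq_torsion_comp => //=; first by rewrite x7 y7 z7.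
by move=> l l4 l7; exact: eq_ce_comp.
Qed.

Lemma eval_gamma x y z : index7 x -> index7 y -> index7 z ->
  eval env (gamma c x y z) = gamR (struct_const br g b) x y z.
Proof. by move=> x7 y7 z7; rewrite eval_connection_table // connection_struct_const. Qed.

Lemma eval_instanton a z s : index7 a -> index7 z -> size s = 6%N -> all index7 s ->
  eval env (instanton_comp Parith c (gamma c) a z s)
    = instanton_comp (Rarith R) (struct_const br g b) (gamR (struct_const br g b)) a z s.
Proof.
move=> a7 z7 s6 s7; rewrite (hom_instanton_comp (eval_hom env)).
by apply: eq_instanton_comp => // i j m i7 j7 m7; [rewrite cE|exact: eval_gamma].
Qed.

Theorem frame_eqsP nabla : coclosed br g vol phi ->
    characteristic_connection br g vol phi nabla -> g2_instanton br g vol phi nabla ->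
  forall q, q \in frame_eqs c -> eval env q = 0.
Proof.
move=> cocl charP inst q; rewrite mem_cat => /orP[/flattenP[qs /mapP[k k7 ->]]|].
  move=> /mapP[l l7 ->].
  rewrite (hom_ce_comp (eval_hom env) 3 (c' := ev3 c) (w' := psi_cst (Rarith R))) //; last first.
    by move=> s; exact: eval_cst.
  rewrite -(coclosed_comp dimV gP volF phiF bA vol1 cocl (omit_index7 [:: k; l])).
  by apply: eq_ce_comp => [|i j m *|//]; [exact: omit_index7|rewrite cE].
move=> /flattenP[qs /mapP[a a7 ->]] /flattenP[qs' /mapP[z z7 ->]] /mapP[k k7 ->].
rewrite !mem_iota /= !add0n in a7 z7 k7.
have z_7 : index7 z by exact: ltn_trans z7 a7.
have s6 : size (omit [:: k]) = 6%N by move: k7; do 7 (case: k => [//|k]).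
have s7 := omit_index7 [:: k].
rewrite eval_instanton //.
have nL : bilinear_map nabla by case: charP => -[].
rewrite -(@instanton_compE _ _ br g vol phi dimV brP gP volF phiF b bA vol1 nabla _ _ _ nL) //.
  by rewrite inst /ev mulr0.
have [_ _ _ [LC LCP nablaE]] := charP.
by move=> x y t x7 y7 t7; exact: (connection_compE dimV brP gP volF phiF bA vol1 LCP nablaE).
Qed.

End FrameEquations.

(** * Unit vectors and eigenvectors *)

(** The real and imaginary part of a complex eigenvector are eigenvectors, since
    symmetry makes the eigenvalue real. *)
Lemma symmetric_eigenvector (R : realType) n (S : 'M[R]_n) :
  (0 < n)%N -> S^T = S -> exists l (v : 'rV[R]_n), v != 0 /\ v *m S = l *: v.
Proof.
move=> n0 ST; have [l /eigenvalueP[u uS u0]] := eigenvalue_closed (map_mx (real_complex R) S) n0.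
pose re := map_mx (@complex.Re R) u; pose im := map_mx (@complex.Im R) u.
have [x [y lE]] : exists x y, l = (x +i* y)%C by exists (complex.Re l), (complex.Im l); case: (l).
have entry j : (\sum_i u 0 i * (S i j)%:C)%C = l * u 0 j.
  have /rowP/(_ j) := uS; rewrite !mxE => <-.
  by apply: eq_bigr => i _; rewrite !mxE.
have reE : re *m S = x *: re - y *: im.
  apply/rowP => j; rewrite !mxE; have := congr1 (@complex.Re R) (entry j); rewrite raddf_sum lE.
  case: (u 0 j) => a c /= <-; apply: eq_bigr => i _; rewrite !mxE.
  by case: (u 0 i) => a' c' /=; rewrite mulr0 subr0.
have imE : im *m S = y *: re + x *: im.
  apply/rowP => j; rewrite !mxE; have := congr1 (@complex.Im R) (entry j); rewrite raddf_sum lE.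
  case: (u 0 j) => a c /=; rewrite addrC => <-; apply: eq_bigr => i _; rewrite !mxE.
  by case: (u 0 i) => a' c' /=; rewrite mulr0 add0r.
pose dot (p q : 'rV[R]_n) := (p *m q^T) 0 0.
have dotC p q : dot p q = dot q p.
  by rewrite /dot !mxE; apply: eq_bigr => i _; rewrite !mxE mulrC.
have dotS p q : dot (p *m S) q = dot p (q *m S).
  by rewrite /dot trmx_mul ST mulmxA.
have dot0 p : 0 <= dot p p ?= iff (p == 0).
  split; first by rewrite /dot mxE; apply: sumr_ge0 => i _; rewrite mxE -expr2 sqr_ge0.
  rewrite /dot mxE eq_sym psumr_eq0 => [|i _]; last by rewrite mxE -expr2 sqr_ge0.
  apply/allP/eqP => [p0|-> i _]; last by rewrite /= !mxE mul0r eqxx.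
  apply/rowP => i; have := p0 i (mem_index_enum _); rewrite /= !mxE -expr2 sqrf_eq0.
  by move/eqP.
have dotDl a p a' p' q : dot (a *: p + a' *: p') q = a * dot p q + a' * dot p' q.
  by rewrite /dot mulmxDl -!scalemxAl !mxE.
have [re0 im0] := (dot0 re, dot0 im).
have y0 : y * (dot re re + dot im im) = 0.
  have := dotS re im; rewrite reE imE -scaleNr (dotC re) !dotDl (dotC im re); lra.
have [rez|rez] := eqVneq re 0.
  have imz : im != 0.
    apply: contra u0 => /eqP imz; apply/eqP/rowP => j; rewrite mxE.
    have := congr1 (fun m : 'rV_n => m 0 j) rez; have := congr1 (fun m : 'rV_n => m 0 j) imz.
    by rewrite !mxE; case: (u 0 j) => a c /= -> ->.
  by exists x, im; rewrite imE rez scaler0 add0r.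
exists x, re; split=> //; rewrite reE (_ : y = 0) ?scale0r ?subr0 //.
apply/eqP; move/eqP: y0; rewrite mulf_eq0 => /orP[//|].
rewrite paddr_eq0 ?re0 ?im0 // => /andP[+ _].
by rewrite eq_sym (eq_leif re0) (negPf rez).
Qed.

(** Fewer linear equations than unknowns. *)
Lemma orthogonal_combination (R : realType) (V : vectType R) (g : V -> V -> R^o) n m
    (z : 'I_n -> V) (w : 'I_m -> V) : inner_product g -> (m < n)%N ->
  exists a : 'I_n -> R, (exists i, a i != 0) /\
    forall j, g (\sum_i a i *: z i) (w j) = 0.
Proof.
move=> gP mn; pose M := \matrix_(i < n, j < m) g (z i) (w j).
have : kermx M != 0.
  rewrite -mxrank_eq0 mxrank_ker subn_eq0 -ltnNge.
  exact: leq_ltn_trans (rank_leq_col M) mn.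
case/rowV0Pn => v /sub_kermxP vM v0; exists (v 0); split.
  by apply/existsP; rewrite -negb_forall; apply: contra v0 => /forallP v0; apply/eqP/rowP => i; rewrite mxE; apply/eqP.
move=> j; have /rowP/(_ j) := vM; rewrite !mxE => <-.
by rewrite (metric_suml gP); apply: eq_bigr => i _; rewrite (metricZl gP) mxE.
Qed.

Section UnitVectors.
Variables (R : realType) (V : vectType R) (g : V -> V -> R^o).
Hypothesis gP : inner_product g.

Lemma normalize x : x != 0 -> exists2 r, r != 0 & g (r *: x) (r *: x) = 1.
Proof.
move=> x0; have gx := metric_gt0 gP x0; pose r := (Num.sqrt (g x x))^-1.
have s0 : Num.sqrt (g x x) != 0 by rewrite gt_eqF // sqrtr_gt0.
exists r; first by rewrite invr_eq0.
rewrite (metricZl gP) (metricZr gP) mulrA -expr2 -[X in _ * X](sqr_sqrtr (ltW gx)).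
by rewrite -exprMn mulVf // expr1n.
Qed.

Lemma unit_orthogonal b (s : seq V) : orthonormal g 7 b -> (size s < 7)%N ->
  exists2 u, g u u = 1 & forall x, x \in s -> g u x = 0.
Proof.
move=> bO s7; have [a [[i ai] aw]] := @orthogonal_combination R V g 7 (size s)
  (fun i => b i) (fun j => nth 0 s j) gP s7.
set u := \sum_i _ in aw.
have u0 : u != 0.
  apply: contraNneq ai => u0; have := metric0l gP (b i); rewrite -u0.
  rewrite (metric_suml gP) (bigD1 i) //= (metricZl gP) bO // eqxx mulr1.
  rewrite big1 ?addr0 => [->//|j ji].
  by rewrite (metricZl gP) bO // (inj_eq val_inj) (negPf ji) mulr0.
have [r r0 ru] := normalize u0; exists (r *: u) => // x /(nthP 0)[j js <-].
by rewrite (metricZl gP) (aw (Ordinal js)) mulr0.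
Qed.

End UnitVectors.

(** * Consequences of the equations in adapted frames *)

(** The bracket of a frame as polynomials in its possibly nonzero components: the
    brackets of vectors with indices in [vs] have components with indices in [ms]. *)
Definition slots (vs ms : seq nat) : seq (nat * nat * nat) :=
  [seq (p, m) | p <- [seq (i, j) | i <- vs, j <- vs], m <- ms].

Definition gen_comp (vs ms : seq nat) (i j m : nat) : poly :=
  if ~~ [&& i \in vs, j \in vs & m \in ms] then [::]
  else if (i < j)%N then X (index (i, j, m) (slots vs ms))
  else if (j < i)%N then poly_scale (-1)%BZ (X (index (j, i, m) (slots vs ms)))
  else [::].

Definition poly_sub (p q : poly) : poly := poly_add p (poly_scale (-1)%BZ q).
Definition poly_sq (p : poly) : poly := poly_mul p p.

Definition products (ms ps : seq poly) : seq poly := [seq poly_mul m p | m <- ms, p <- ps].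
Definition vars (n : nat) : seq poly := poly_cst 1%BZ :: [seq X i | i <- iota 0 n].

Definition all_zero (R : realType) (env : nat -> R) (qs : seq poly) : Prop :=
  foldr (fun q P => eval env q = 0 /\ P) True qs.

Section AllZero.
Variables (R : realType) (env : nat -> R).

Lemma all_zeroP qs : all_zero env qs <-> forall q, q \in qs -> eval env q = 0.
Proof.
elim: qs => [//|q qs IH] /=; split=> [[q0 /IH qs0] p|qs0].
  by rewrite inE => /predU1P[->|/qs0].
by split; [exact/qs0/mem_head|apply/IH => p pq; apply: qs0; rewrite inE pq orbT].
Qed.

Lemma all_zero_products ms ps : all_zero env ps -> all_zero env (products ms ps).
Proof.
move=> /all_zeroP ps0; apply/all_zeroP => _ /allpairsP[[m p] /= [_ /ps0 p0 ->]].
by rewrite eval_mul p0 mulr0.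
Qed.

Lemma all_zero_cat ps qs : all_zero env ps -> all_zero env qs -> all_zero env (ps ++ qs).
Proof.
by move=> /all_zeroP ps0 /all_zeroP qs0; apply/all_zeroP => q; rewrite mem_cat => /orP[/ps0|/qs0].
Qed.

Lemma all_zero_span ps qs : in_span ps qs -> all_zero env ps -> all_zero env qs.
Proof. by move=> H /all_zeroP ps0; apply/all_zeroP; exact: span_sound H ps0. Qed.

Lemma eval_sub p q : eval env (poly_sub p q) = eval env p - eval env q.
Proof. by rewrite eval_add eval_scale realZN1 mulN1r. Qed.

Lemma eval_sq p : eval env (poly_sq p) = eval env p ^+ 2.
Proof. by rewrite eval_mul. Qed.

End AllZero.

Definition evalE := (eval_sub, eval_sq, eval_add, eval_mul, eval_scale, eval_cst, evalX).

Section Classification.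
Variables (R : realType) (V : vectType R) (br : V -> V -> V) (g : V -> V -> R^o).
Variables (vol : kform V 7) (phi : kform V 3) (nabla : V -> V -> V).
Hypothesis dimV : \dim {:V} = 7%N.
Hypothesis brP : lie_bracket br.
Hypothesis gvolP : g2_metric phi g vol.
Hypothesis phiF : is_form phi.
Hypothesis coclP : coclosed br g vol phi.
Hypothesis nablaP : characteristic_connection br g vol phi nabla.
Hypothesis instP : g2_instanton br g vol phi nabla.

Let gP : inner_product g. Proof. by case: gvolP. Qed.

Local Notation sc := (struct_const br g).

Lemma bracketC x y : br x y = - br y x.
Proof.
case: brP => -[bl b_r] b0 _; apply/eqP; rewrite -addr_eq0.
have := b0 (x + y); have D u v w : br (u + v) w = br u w + br v w.
  by have := bl w 1 u v; rewrite !scale1r.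
have D' u v w : br w (u + v) = br w u + br w v.
  by have := b_r w 1 u v; rewrite !scale1r.
by rewrite D !D' !b0 add0r addr0 => ->.
Qed.

Lemma struct_constC b i j m : sc b i j m = - sc b j i m.
Proof. by rewrite /struct_const bracketC (metricNl gP). Qed.

Lemma struct_constxx b i m : sc b i i m = 0.
Proof. by case: brP => _ b0 _; rewrite /struct_const b0 (metric0l gP). Qed.

Definition gen_env b (vs ms : seq nat) (n : nat) : R :=
  let t := nth (0%N, 0%N, 0%N) (slots vs ms) n in sc b t.1.1 t.1.2 t.2.

Lemma gen_compE b vs ms i j m :
    (~~ [&& i \in vs, j \in vs & m \in ms] -> sc b i j m = 0) ->
  sc b i j m = eval (gen_env b vs ms) (gen_comp vs ms i j m).
Proof.
rewrite /gen_comp; case: ifP => [_ -> //|/negbFE/and3P[iv jv mv] _].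
  by rewrite /eval big_nil.
have X_ i' j' : i' \in vs -> j' \in vs ->
    gen_env b vs ms (index (i', j', m) (slots vs ms)) = sc b i' j' m.
  move=> iv' jv'; rewrite /gen_env nth_index // /slots.
  by apply/allpairsP; exists ((i', j'), m); split=> //; apply/allpairsP; exists (i', j').
case: ltngtP => [ij|ji|->].
- by rewrite evalX X_.
- by rewrite eval_scale evalX X_ // realZN1 mulN1r struct_constC.
- by rewrite struct_constxx /eval big_nil.
Qed.

Section Frame.
Variable b : nat -> V.
Hypothesis bA : adapted g phi b.

Lemma frame_all_zero env c :
    (forall i j m, index7 i -> index7 j -> index7 m -> sc b i j m = eval env (c i j m)) ->
  all_zero env (coclosed_eqs c) /\ all_zero env (instanton_eqs c).
Proof.
move=> cE; have H := frame_eqsP dimV brP gvolP phiF bA cE coclP nablaP instP.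
by split; apply/all_zeroP => q qc; apply: H; rewrite mem_cat qc ?orbT.
Qed.

(** ** One-dimensional derived algebra *)

Definition comp1 := gen_comp (iota 0 6) [:: 6%N].
Definition eqs1 (c : nat -> nat -> nat -> poly) : seq poly :=
  [:: poly_add (c 0 3 6) (c 1 2 6); poly_sub (c 0 2 6) (c 1 3 6);
      poly_add (c 0 5 6) (c 1 4 6); poly_sub (c 0 4 6) (c 1 5 6);
      poly_add (c 2 5 6) (c 3 4 6); poly_sub (c 2 4 6) (c 3 5 6);
      poly_sq (poly_add (c 0 1 6) (poly_add (c 2 3 6) (c 4 5 6)))]%N.

Lemma eqs1_span :
  in_span (products (vars 36) (coclosed_eqs comp1) ++ instanton_eqs comp1) (eqs1 comp1).
Proof. by vm_compute. Qed.

Lemma frame_eqs1 :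
    (forall j m, sc b 6 j m = 0) ->
    (forall i j m, index7 m -> m != 6%N -> sc b i j m = 0) ->
  let w i j := sc b i j 6 in
  [/\ w 0 3 = - w 1 2, w 0 2 = w 1 3, w 0 5 = - w 1 4 & w 0 4 = w 1 5] /\
  [/\ w 2 5 = - w 3 4, w 2 4 = w 3 5 & w 0 1 + w 2 3 + w 4 5 = 0].
Proof.
move=> c6 cm w; have cE i j m : index7 i -> index7 j -> index7 m ->
    sc b i j m = eval (gen_env b (iota 0 6) [:: 6%N]) (comp1 i j m).
  move=> i7 j7 m7; apply: gen_compE; rewrite !negb_and => /or3P[i6|j6|].
  - by rewrite (_ : i = 6%N) ?c6 //; move: i6 i7; rewrite /index7 mem_iota; lia.
  - by rewrite struct_constC (_ : j = 6%N) ?c6 ?oppr0 //; move: j6 j7; rewrite /index7 mem_iota; lia.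
  - by rewrite orbF; exact: cm.
have [cocl inst] := frame_all_zero cE.
have := all_zero_span eqs1_span (all_zero_cat (all_zero_products _ cocl) inst).
move: comp1 cE {cocl inst} => c cE.
case=> E1 [E2 [E3 [E4 [E5 [E6 [E7 _]]]]]].
rewrite !evalE -!cE // in E1 E2 E3 E4 E5 E6 E7; move/eqP: E7; rewrite sqrf_eq0 => /eqP E7.
by rewrite /w; do !split; lra.
Qed.

(** ** Two-dimensional derived algebra *)

Definition comp2 := gen_comp [:: 0; 1; 2; 3; 6]%N [:: 4; 5]%N.
Definition pairs7 : seq (nat * nat) := [seq (i, j) | i <- iota 0 7, j <- iota 0 7].
Definition eqs2 (c : nat -> nat -> nat -> poly) : seq poly :=
  [seq poly_sub (poly_mul (c p.1 p.2 4) (c q.1 q.2 5)) (poly_mul (c p.1 p.2 5) (c q.1 q.2 4))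
    | p <- pairs7, q <- pairs7]%N.

Lemma eqs2_span :
  in_span (products (vars 50) (coclosed_eqs comp2) ++ instanton_eqs comp2) (eqs2 comp2).
Proof. by vm_compute. Qed.

Lemma frame_eqs2 :
    (forall j m, sc b 4 j m = 0) -> (forall j m, sc b 5 j m = 0) ->
    (forall i j m, index7 m -> (m != 4%N) && (m != 5%N) -> sc b i j m = 0) ->
  forall i j k l, index7 i -> index7 j -> index7 k -> index7 l ->
    sc b i j 4 * sc b k l 5 = sc b i j 5 * sc b k l 4.
Proof.
move=> c4 c5 cm.
have c45 i j m : index7 i -> i \notin [:: 0; 1; 2; 3; 6]%N -> sc b i j m = 0.
  rewrite /index7 !inE => i7 iN; have /orP[/eqP->|/eqP->] // : (i == 4%N) || (i == 5%N) by lia.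
have cE i j m : index7 i -> index7 j -> index7 m ->
    sc b i j m = eval (gen_env b [:: 0; 1; 2; 3; 6]%N [:: 4; 5]%N) (comp2 i j m).
  move=> i7 j7 m7; apply: gen_compE; rewrite !negb_and => /or3P[iN|jN|].
  - exact: c45.
  - by rewrite struct_constC c45 ?oppr0.
  - by rewrite !inE negb_or; exact: cm.
have [cocl inst] := frame_all_zero cE.
have := all_zero_span eqs2_span (all_zero_cat (all_zero_products _ cocl) inst).
move: comp2 cE {cocl inst} => c cE /all_zeroP H i j k l i7 j7 k7 l7.
have := H (poly_sub (poly_mul (c i j 4%N) (c k l 5%N)) (poly_mul (c i j 5%N) (c k l 4%N))).
rewrite !evalE -!cE // => E; apply/eqP; rewrite -subr_eq0; apply/eqP/E.
apply/allpairsP; exists ((i, j), (k, l)); split=> //; apply: allpairs_f;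
  by rewrite mem_iota.
Qed.

(** ** Three-dimensional derived algebra that is not associative *)

(** The derived algebra is spanned by [e_5], [e_6] and [e_1 + t e_7]; the last
    variable is [t]. *)
Definition vs3 := [:: 1; 2; 3; 6]%N.
Definition ms3 := [:: 0; 4; 5]%N.
Definition comp3 (i j m : nat) : poly :=
  let t := X 48 in
  let co i := if i == 0%N then poly_scale (-1)%BZ t else poly_cst 1%BZ in
  let id i := if i == 0%N then 6%N else i in
  let gen m := poly_mul (poly_mul (co i) (co j)) (gen_comp vs3 ms3 (id i) (id j) m) in
  if m == 6%N then poly_mul t (gen 0%N) else gen m.

Definition t_powers (n : nat) : seq poly := [seq iter k (poly_mul (X 48)) (poly_cst 1%BZ) | k <- iota 0 n].

Definition lin3 (x : nat -> nat -> nat -> poly) : seq poly :=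
  [seq x 6 i m | i <- [:: 2; 3]%N, m <- ms3]
  ++ [seq x 2 3 m | m <- ms3]
  ++ [:: poly_sub (x 6 1 5) (x 1 2 0);
         poly_sub (x 6 1 4) (x 1 3 0);
         poly_sub (x 1 3 5) (x 1 2 4)].

Definition squares3 (x : nat -> nat -> nat -> poly) : seq poly :=
  [seq poly_add (poly_add (poly_sq (x 6 1 m)) (poly_sq (poly_mul (X 48) (x 6 1 m))))
                (poly_add (poly_sq (x 1 2 m)) (poly_sq (x 1 3 m)))
    | m <- ms3]%N.

Lemma lin3_span : in_span (products (t_powers 3) (coclosed_eqs comp3)) (lin3 (gen_comp vs3 ms3)).
Proof. by vm_compute. Qed.

Lemma squares3_span :
  in_span (products (products (vars 48) (t_powers 6)) (lin3 (gen_comp vs3 ms3)) ++ instanton_eqs comp3)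
    (squares3 (gen_comp vs3 ms3)).
Proof. by vm_compute. Qed.

Lemma frame_eqs3 t :
    (forall j m, sc b 4 j m = 0) -> (forall j m, sc b 5 j m = 0) ->
    (forall j m, sc b 0 j m = - t * sc b 6 j m) ->
    (forall i j, sc b i j 6 = t * sc b i j 0) ->
    (forall i j m, m \in [:: 1; 2; 3]%N -> sc b i j m = 0) ->
  forall i j m, index7 i -> index7 j -> index7 m -> sc b i j m = 0.
Proof.
move=> c4 c5 c0 c6 cm.
pose env n := if n == 48%N then t else gen_env b vs3 ms3 n.
have genE i j m : index7 i -> index7 j -> index7 m -> i != 0%N -> j != 0%N -> m != 6%N ->
    sc b i j m = eval env (gen_comp vs3 ms3 i j m).
  move=> i7 j7 m7 i0 j0 m6; rewrite (_ : eval env _ = eval (gen_env b vs3 ms3) (gen_comp vs3 ms3 i j m)).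
    apply: gen_compE; rewrite !negb_and => /or3P[iN|jN|mN].
    - move: i7 i0 iN; rewrite /index7 /vs3 !inE => i7 i0 iN.
      by have /orP[/eqP->|/eqP->] : (i == 4%N) || (i == 5%N) by lia.
    - move: j7 j0 jN; rewrite /index7 /vs3 !inE struct_constC => j7 j0 jN.
      by have /orP[/eqP->|/eqP->] : (j == 4%N) || (j == 5%N); [lia|rewrite c4 oppr0|rewrite c5 oppr0].
    - apply: cm; move: m7 m6 mN; rewrite /index7 /ms3 !inE; lia.
  rewrite /gen_comp; case: ifP => [_|/negbFE/and3P[iv jv mv]]; first by rewrite /eval !big_nil.
  have idx i' j' : i' \in vs3 -> j' \in vs3 -> (index (i', j', m) (slots vs3 ms3) < 48)%N.
    move=> iv' jv'; rewrite -[48%N]/(size (slots vs3 ms3)) index_mem.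
    by apply/allpairsP; exists ((i', j'), m); split=> //; apply/allpairsP; exists (i', j').
  by case: ltngtP => _; rewrite ?eval_scale ?evalX /env ?(ltn_eqF (idx _ _ _ _)) // /eval !big_nil.
have cE i j m : index7 i -> index7 j -> index7 m -> sc b i j m = eval env (comp3 i j m).
  move=> i7 j7 m7; rewrite /comp3.
  have coE k : eval env (if k == 0%N then poly_scale (-1)%BZ (X 48) else poly_cst 1%BZ)
      = if k == 0%N then - t else 1.
    by case: eqP => _; rewrite !evalE ?realZN1 ?realZ1 ?mulN1r // /env eqxx.
  have base m' : index7 m' -> m' != 6%N ->
     sc b i j m' = eval env (poly_mul (poly_mul
        (if i == 0%N then poly_scale (-1)%BZ (X 48) else poly_cst 1%BZ)
        (if j == 0%N then poly_scale (-1)%BZ (X 48) else poly_cst 1%BZ))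
        (gen_comp vs3 ms3 (if i == 0 then 6 else i) (if j == 0 then 6 else j) m'))%N.
    move=> m'7 m'6; rewrite !eval_mul !coE -genE //; try by case: ifP => // /negbT.
    have C0 i' n : sc b i' 0 n = - t * sc b i' 6 n by rewrite struct_constC c0 (struct_constC b i'); ring.
    by case: eqP => [->|_]; case: eqP => [->|_]; rewrite ?c0 ?C0; ring.
  case: eqP => [->|/eqP m6]; last exact: base.
  by rewrite eval_mul -base // c6 evalX /env eqxx.
have [cocl inst] := frame_all_zero cE.
have lin := all_zero_span lin3_span (all_zero_products _ cocl).
have := all_zero_span squares3_span (all_zero_cat (all_zero_products _ lin) inst).
have sq4 (x y z u : R) : x ^+ 2 + y ^+ 2 + (z ^+ 2 + u ^+ 2) = 0 -> [/\ x = 0, z = 0 & u = 0].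
  move=> E; have := (sqr_ge0 x, sqr_ge0 y, sqr_ge0 z, sqr_ge0 u) => -[[[h1 h2] h3] h4].
  by split; apply/eqP; rewrite -sqrf_eq0; apply/eqP; lra.
move: (gen_comp vs3 ms3) genE lin {cE cocl inst} => x genE lin.
case=> S0 [S4 [S5 _]].
case: lin => L1 [L2 [L3 [L4 [L5 [L6 [L7 [L8 [L9 _]]]]]]]].
rewrite !(eval_add, eval_sq, eval_mul) -!genE // in S0 S4 S5.
rewrite -!genE // in L1 L2 L3 L4 L5 L6 L7 L8 L9.
have [A0 B0 C0] := sq4 _ _ _ _ S0; have [A4 B4 C4] := sq4 _ _ _ _ S4; have [A5 B5 C5] := sq4 _ _ _ _ S5.
have half i j m : (i, j) \in [:: (6,1);(6,2);(6,3);(1,2);(1,3);(2,3)]%N -> m \in ms3 -> sc b i j m = 0.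
  rewrite !inE => /or4P[|||/or3P[||]] /eqP[-> ->] /or3P[] /eqP-> //.
have zero i j m : index7 i -> index7 j -> m \in ms3 -> i != 0%N -> j != 0%N -> sc b i j m = 0.
  move=> i7 j7 mv i0 j0.
  case: i i0 i7 => [//|[|[|[|[|[|[|//]]]]]]] _ _ //; case: j j0 j7 => [//|[|[|[|[|[|[|//]]]]]]] _ _ //;
  rewrite ?struct_constxx //;
  first [exact: half | exact: c4 | exact: c5
        | by rewrite struct_constC half ?oppr0 | by rewrite struct_constC c4 oppr0
        | by rewrite struct_constC c5 oppr0].
have zero6 j m : index7 j -> m \in ms3 -> sc b 6 j m = 0.
  move=> j7 mv; have [->|j0] := eqVneq j 0%N; last exact: zero.
  by rewrite struct_constC c0 struct_constxx mulr0 oppr0.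
have zero0 i j m : index7 i -> index7 j -> m \in ms3 -> sc b i j m = 0.
  move=> i7 j7 mv; have [->|i0] := eqVneq i 0%N; first by rewrite c0 zero6 // mulr0.
  have [->|j0] := eqVneq j 0%N; first by rewrite struct_constC c0 zero6 // mulr0 oppr0.
  exact: zero.
move=> i j m i7 j7 m7; have [mv|mN] := boolP (m \in [:: 1; 2; 3]%N); first exact: cm.
have [->|m6] := eqVneq m 6%N; first by rewrite c6 zero0 // mulr0.
apply: zero0 => //; move: m7 mN m6; rewrite /index7 /ms3 !inE; lia.
Qed.


(** ** Associative derived algebra *)

Definition pairs567 : seq (nat * nat) := [seq (k, l) | k <- [:: 4; 5; 6]%N, l <- [:: 4; 5; 6]%N].

(** With [e_1, ..., e_4] orthogonal to the derived algebra, the two-form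
    [de^k] is half of a combination of the self-dual forms
    [e^13 - e^24], [- e^14 - e^23], [e^12 + e^34], contracted with [e_5, e_6, e_7]
    in the form, and of the anti-self-dual forms [- e^13 - e^24], [e^14 - e^23],
    [e^34 - e^12]; these are its coefficients. *)
Section DualityParts.
Local Open Scope nat_scope.
Variables (T : Type) (A : arith T) (c : nat -> nat -> nat -> T).

Let sub x y := aadd A x (amul A (acst A (-1)%BZ) y).

Definition selfdual_part (k l : nat) : T :=
  if l == 4 then sub (c 1 3 k) (c 0 2 k)
  else if l == 5 then aadd A (c 0 3 k) (c 1 2 k)
  else amul A (acst A (-1)%BZ) (aadd A (c 0 1 k) (c 2 3 k)).

Definition antiselfdual_part (k l : nat) : T :=
  if l == 4 then aadd A (c 0 2 k) (c 1 3 k)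
  else if l == 5 then sub (c 1 2 k) (c 0 3 k)
  else sub (c 0 1 k) (c 2 3 k).

Definition next567 (k : nat) : nat := if k == 6%N then 4%N else k.+1.

Definition cofactor567 (m : nat -> nat -> T) (k l : nat) : T :=
  let k' := next567 k in let l' := next567 l in
  sub (amul A (m k' l') (m (next567 k') (next567 l')))
      (amul A (m k' (next567 l')) (m (next567 k') l')).

Definition trace567 (p : nat -> nat -> T) : T := aadd A (p 4 4) (aadd A (p 5 5) (p 6 6)).

Definition row_product (p : nat -> nat -> T) (k l : nat) : T :=
  aadd A (amul A (p k 4) (p l 4)) (aadd A (amul A (p k 5) (p l 5)) (amul A (p k 6) (p l 6))).

Definition eqs4 : seq T :=
  let p := selfdual_part in let m := antiselfdual_part in
  let t := trace567 p in let diag k l x := if k == l then x else acst A 0%BZ in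
  [seq sub (amul A (acst A 3%BZ) (amul A t (p q.1 q.2))) (diag q.1 q.2 (amul A t t)) | q <- pairs567]
  ++ [seq sub (amul A (acst A 9%BZ) (row_product p q.1 q.2)) (diag q.1 q.2 (amul A t t)) | q <- pairs567]
  ++ [seq sub (amul A (acst A 3%BZ) (cofactor567 m q.1 q.2)) (amul A t (m q.1 q.2)) | q <- pairs567].

End DualityParts.

Definition comp4 := gen_comp (iota 0 4) [:: 4; 5; 6]%N.

Lemma eqs4_span :
  in_span (products (vars 48) (coclosed_eqs comp4) ++ instanton_eqs comp4) (eqs4 Parith comp4).
Proof. by vm_compute. Qed.

Lemma hom_eqs4 (T T' : Type) (A : arith T) (A' : arith T') (h : T -> T') c :
  arith_hom A A' h -> [seq h x | x <- eqs4 A c] = eqs4 A' (fun i j m => h (c i j m)).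
Proof.
move=> hP; have E := (hom_add hP, hom_mul hP, hom_cst hP).
have pE k l : h (selfdual_part A c k l) = selfdual_part A' (fun i j m => h (c i j m)) k l.
  by rewrite /selfdual_part; case: (l == 4%N); [|case: (l == 5%N)]; rewrite !E.
have mE k l : h (antiselfdual_part A c k l) = antiselfdual_part A' (fun i j m => h (c i j m)) k l.
  by rewrite /antiselfdual_part; case: (l == 4%N); [|case: (l == 5%N)]; rewrite !E.
rewrite /eqs4; cbv zeta; move: pE mE.
move: (selfdual_part A c) (selfdual_part A' _) (antiselfdual_part A c) (antiselfdual_part A' _).
move=> p p' m m' pE mE; move: pairs567 => idx; rewrite !map_cat; congr (_ ++ (_ ++ _)); rewrite -map_comp;
  apply: eq_map => -[k l]; rewrite [LHS]/=.
- by case: ifP => _; rewrite /trace567 !E !pE.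
- by case: ifP => _; rewrite /trace567 /row_product !E !pE.
- by rewrite /trace567 /cofactor567 !E !pE !mE.
Qed.

Definition sd k l : R := selfdual_part (Rarith R) (sc b) k l.
Definition asd k l : R := antiselfdual_part (Rarith R) (sc b) k l.

Lemma frame_eqs4 :
    (forall i j m, (3 < i)%N -> index7 i -> sc b i j m = 0) ->
    (forall i j m, (m < 4)%N -> sc b i j m = 0) ->
  exists nu, forall k l, k \in [:: 4; 5; 6]%N -> l \in [:: 4; 5; 6]%N ->
    sd k l = (if k == l then nu else 0) /\
    cofactor567 (Rarith R) asd k l = nu * asd k l.
Proof.
move=> c4 cm.
have cE i j m : index7 i -> index7 j -> index7 m ->
    sc b i j m = eval (gen_env b (iota 0 4) [:: 4; 5; 6]%N) (comp4 i j m).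
  move=> i7 j7 m7; apply: gen_compE; rewrite !negb_and => /or3P[iN|jN|mN].
  - by rewrite c4 //; move: iN; rewrite mem_iota; lia.
  - by rewrite struct_constC c4 ?oppr0 //; move: jN; rewrite mem_iota; lia.
  - by rewrite cm //; move: mN m7; rewrite /index7 !inE; lia.
have [cocl inst] := frame_all_zero cE.
have := all_zero_span eqs4_span (all_zero_cat (all_zero_products _ cocl) inst).
set env := gen_env _ _ _ in cE *; move: comp4 cE {cocl inst} => c cE /all_zeroP H.
pose c' i j m := eval env (c i j m).
have {}H x : x \in eqs4 (Rarith R) c' -> x = 0.
  by rewrite -(hom_eqs4 c (eval_hom env)) => /mapP[q qe ->]; exact: H.
have idx k l : k \in [:: 4; 5; 6]%N -> l \in [:: 4; 5; 6]%N -> (k, l) \in pairs567.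
  by move=> kv lv; apply/allpairsP; exists (k, l).
have k7 k : k \in [:: 4; 5; 6]%N -> index7 k by rewrite /index7 !inE; lia.
have pE k l : k \in [:: 4; 5; 6]%N -> selfdual_part (Rarith R) c' k l = sd k l.
  by move=> /k7 kv; rewrite /sd /selfdual_part /c' -!cE.
have mE k l : k \in [:: 4; 5; 6]%N -> antiselfdual_part (Rarith R) c' k l = asd k l.
  by move=> /k7 kv; rewrite /asd /antiselfdual_part /c' -!cE.
have nx k : k \in [:: 4; 5; 6]%N -> next567 k \in [:: 4; 5; 6]%N.
  by rewrite !inE => /or3P[] /eqP->.
set t := trace567 (Rarith R) (selfdual_part (Rarith R) c').
have r3 : realZ R 3%BZ = 3 by [].
have r9 : realZ R 9%BZ = 9 by [].
have H1 k l : k \in [:: 4; 5; 6]%N -> l \in [:: 4; 5; 6]%N ->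
    3 * (t * sd k l) = if k == l then t * t else 0.
  move=> kv lv; have := H (3 * (t * sd k l) - (if k == l then t * t else 0)).
  move=> E; apply/eqP; rewrite -subr_eq0; apply/eqP/E; rewrite !mem_cat; apply/orP; left.
  apply/mapP; exists (k, l); first exact: idx.
  rewrite -[RHS]/(realZ R 3%BZ * (t * selfdual_part (Rarith R) c' k l)
    + realZ R (-1)%BZ * (if k == l then t * t else realZ R 0%BZ)).
  by rewrite pE // realZN1 mulN1r r3 realZ0.
have H2 k l : k \in [:: 4; 5; 6]%N -> l \in [:: 4; 5; 6]%N ->
    9 * (sd k 4%N * sd l 4%N + (sd k 5%N * sd l 5%N + sd k 6%N * sd l 6%N)) = if k == l then t * t else 0.
  move=> kv lv; have := H (9 * (sd k 4%N * sd l 4%N + (sd k 5%N * sd l 5%N + sd k 6%N * sd l 6%N)) - (if k == l then t * t else 0)).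
  move=> E; apply/eqP; rewrite -subr_eq0; apply/eqP/E; rewrite !mem_cat; apply/orP; right; apply/orP; left.
  apply/mapP; exists (k, l); first exact: idx.
  rewrite -[RHS]/(realZ R 9%BZ * row_product (Rarith R) (selfdual_part (Rarith R) c') k l
    + realZ R (-1)%BZ * (if k == l then t * t else realZ R 0%BZ)).
  by rewrite /row_product !pE // realZN1 mulN1r r9 realZ0.
have H3 k l : k \in [:: 4; 5; 6]%N -> l \in [:: 4; 5; 6]%N ->
    3 * cofactor567 (Rarith R) asd k l = t * asd k l.
  move=> kv lv; have := H (3 * cofactor567 (Rarith R) asd k l - t * asd k l).
  move=> E; apply/eqP; rewrite -subr_eq0; apply/eqP/E; rewrite !mem_cat; apply/orP; right; apply/orP; right.
  apply/mapP; exists (k, l); first exact: idx.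
  rewrite -[RHS]/(realZ R 3%BZ * cofactor567 (Rarith R) (antiselfdual_part (Rarith R) c') k l
    + realZ R (-1)%BZ * (t * antiselfdual_part (Rarith R) c' k l)).
  by rewrite /cofactor567 !mE ?nx // realZN1 mulN1r r3.
exists (t / 3) => k l kv lv; split; last first.
  by have := H3 k l kv lv; lra.
have [t0|t0] := eqVneq t 0; last first.
  have := H1 k l kv lv; case: eqP => _ E.
    by apply: (mulfI t0); lra.
  by apply: (mulfI t0); lra.
have -> : (if k == l then t / 3 else 0) = 0 by rewrite t0 mul0r if_same.
have := H2 k k kv kv; rewrite eqxx t0 mul0r => E.
have sq x : 0 <= x * x :> R by rewrite -expr2 sqr_ge0.
have := (sq (sd k 4%N), sq (sd k 5%N), sq (sd k 6%N)) => -[[h4 h5] h6].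
apply/eqP; rewrite -sqrf_eq0 expr2; apply/eqP.
by move: lv; rewrite !inE => /or3P[] /eqP->; lra.
Qed.

(** Vectors that are each other's cross products up to the factor [n] are zero or
    orthogonal of length [n]. *)
Lemma cross_triple (n a1 a2 a3 b1 b2 b3 c1 c2 c3 : R) : n != 0 ->
    n * a1 = b2 * c3 - b3 * c2 -> n * a2 = b3 * c1 - b1 * c3 -> n * a3 = b1 * c2 - b2 * c1 ->
    n * b1 = c2 * a3 - c3 * a2 -> n * b2 = c3 * a1 - c1 * a3 -> n * b3 = c1 * a2 - c2 * a1 ->
    n * c1 = a2 * b3 - a3 * b2 -> n * c2 = a3 * b1 - a1 * b3 -> n * c3 = a1 * b2 - a2 * b1 ->
  [/\ a1 * b1 + a2 * b2 + a3 * b3 = 0, b1 * c1 + b2 * c2 + b3 * c3 = 0 &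
      c1 * a1 + c2 * a2 + c3 * a3 = 0] /\
  ([/\ [/\ a1 = 0, a2 = 0 & a3 = 0], [/\ b1 = 0, b2 = 0 & b3 = 0] &
       [/\ c1 = 0, c2 = 0 & c3 = 0]] \/
   [/\ a1 ^+ 2 + a2 ^+ 2 + a3 ^+ 2 = n ^+ 2, b1 ^+ 2 + b2 ^+ 2 + b3 ^+ 2 = n ^+ 2 &
       c1 ^+ 2 + c2 ^+ 2 + c3 ^+ 2 = n ^+ 2]).
Proof.
move=> n0 A1 A2 A3 B1 B2 B3 C1 C2 C3.
have ab : a1 * b1 + a2 * b2 + a3 * b3 = 0.
  by apply: (mulfI n0); rewrite mulr0 !mulrDr !mulrA A1 A2 A3; ring.
have bc : b1 * c1 + b2 * c2 + b3 * c3 = 0.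
  by apply: (mulfI n0); rewrite mulr0 !mulrDr !mulrA B1 B2 B3; ring.
have ca : c1 * a1 + c2 * a2 + c3 * a3 = 0.
  by apply: (mulfI n0); rewrite mulr0 !mulrDr !mulrA C1 C2 C3; ring.
split=> //.
(* n^2 b = n (c x a) = c x (b x c) = |c|^2 b - (b . c) c *)
have key (x1 x2 x3 y1 y2 y3 z1 z2 z3 : R) :
    n * x1 = y2 * z3 - y3 * z2 -> n * x2 = y3 * z1 - y1 * z3 -> n * x3 = y1 * z2 - y2 * z1 ->
    n * y1 = z2 * x3 - z3 * x2 -> n * y2 = z3 * x1 - z1 * x3 -> n * y3 = z1 * x2 - z2 * x1 ->
    y1 * z1 + y2 * z2 + y3 * z3 = 0 -> z1 ^+ 2 + z2 ^+ 2 + z3 ^+ 2 != n ^+ 2 ->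
    [/\ y1 = 0, y2 = 0 & y3 = 0].
  move=> X1 X2 X3 Y1 Y2 Y3 yz zn; rewrite -subr_eq0 in zn.
  split; apply: (mulIf zn); rewrite mul0r mulrBr.
  - have E : n * (n * y1) = z2 * (n * x3) - z3 * (n * x2) by rewrite Y1; ring.
    rewrite X2 X3 in E; have -> : y1 * n ^+ 2 = n * (n * y1) by ring.
    by rewrite E -[RHS](mulr0 z1) -yz; ring.
  - have E : n * (n * y2) = z3 * (n * x1) - z1 * (n * x3) by rewrite Y2; ring.
    rewrite X1 X3 in E; have -> : y2 * n ^+ 2 = n * (n * y2) by ring.
    by rewrite E -[RHS](mulr0 z2) -yz; ring.
  - have E : n * (n * y3) = z1 * (n * x2) - z2 * (n * x1) by rewrite Y3; ring.
    rewrite X1 X2 in E; have -> : y3 * n ^+ 2 = n * (n * y3) by ring.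
    by rewrite E -[RHS](mulr0 z3) -yz; ring.
have z0 x : n * x = 0 -> x = 0.
  by move=> /eqP; rewrite mulf_eq0 (negPf n0) => /eqP.
have [cn|cn] := eqVneq (c1 ^+ 2 + c2 ^+ 2 + c3 ^+ 2) (n ^+ 2); last first.
  have [h1 h2 h3] := key _ _ _ _ _ _ _ _ _ A1 A2 A3 B1 B2 B3 bc cn.
  left; split; split=> //; apply: z0; rewrite ?A1 ?A2 ?A3 ?C1 ?C2 ?C3 ?h1 ?h2 ?h3; ring.
have [an|an] := eqVneq (a1 ^+ 2 + a2 ^+ 2 + a3 ^+ 2) (n ^+ 2); last first.
  have [h1 h2 h3] := key _ _ _ _ _ _ _ _ _ B1 B2 B3 C1 C2 C3 ca an.
  left; split; split=> //; apply: z0; rewrite ?A1 ?A2 ?A3 ?B1 ?B2 ?B3 ?h1 ?h2 ?h3; ring.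
have [bn|bn] := eqVneq (b1 ^+ 2 + b2 ^+ 2 + b3 ^+ 2) (n ^+ 2); last first.
  have [h1 h2 h3] := key _ _ _ _ _ _ _ _ _ C1 C2 C3 A1 A2 A3 ab bn.
  left; split; split=> //; apply: z0; rewrite ?B1 ?B2 ?B3 ?C1 ?C2 ?C3 ?h1 ?h2 ?h3; ring.
by right.
Qed.

(** If the anti-self-dual part does not vanish, it is an isometry up to scale onto
    the anti-self-dual forms.  Then the projection [1 + sum_k J_k J'_k] of the
    orthogonal complement of the derived algebra, for the quaternionic structures
    [J] and [J'] given by the two parts, has rank one and maps to central vectors;
    its rows, up to scale, are used here. *)
Lemma frame_kernel nu : nu != 0 ->
    (forall i j m, (3 < i)%N -> index7 i -> sc b i j m = 0) ->
    (forall i j m, (m < 4)%N -> sc b i j m = 0) ->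
    (forall k l, k \in [:: 4; 5; 6]%N -> l \in [:: 4; 5; 6]%N ->
      sd k l = (if k == l then nu else 0) /\
      cofactor567 (Rarith R) asd k l = nu * asd k l) ->
  (forall k l, k \in [:: 4; 5; 6]%N -> l \in [:: 4; 5; 6]%N -> asd k l = 0) \/
  exists a : nat -> R, (exists2 i, (i < 4)%N & a i != 0) /\
    forall j m, index7 j -> index7 m -> \sum_(i < 4) a i * sc b i j m = 0.
Proof.
move=> nu0 c4 cm H.
have cof k l : k \in [:: 4; 5; 6]%N -> l \in [:: 4; 5; 6]%N ->
    nu * asd k l = asd (next567 k) (next567 l) * asd (next567 (next567 k)) (next567 (next567 l))
      - asd (next567 k) (next567 (next567 l)) * asd (next567 (next567 k)) (next567 l).
  by move=> kv lv; have [_ <-] := H k l kv lv; rewrite /cofactor567 /= realZN1 mulN1r.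
have scE k : k \in [:: 4; 5; 6]%N ->
   let d l := if k == l then nu else 0 in
   [/\ sc b 0 2 k = (asd k 4 - d 4%N) / 2, sc b 1 3 k = (asd k 4 + d 4%N) / 2 &
       sc b 0 3 k = (d 5%N - asd k 5) / 2] /\
   [/\ sc b 1 2 k = (d 5%N + asd k 5) / 2, sc b 0 1 k = (asd k 6 - d 6%N) / 2 &
       sc b 2 3 k = - (asd k 6 + d 6%N) / 2].
  move=> kv d; have [P4 _] := H k 4%N kv isT; have [P5 _] := H k 5%N kv isT.
  have [P6 _] := H k 6%N kv isT; rewrite /d -P4 -P5 -P6 /sd /asd /selfdual_part /antiselfdual_part /=.
  by rewrite realZN1 !mulN1r; do !split; lra.
have [E4 E4'] := scE 4%N isT; have [E5 E5'] := scE 5%N isT; have [E6 E6'] := scE 6%N isT.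
rewrite /= in E4 E4' E5 E5' E6 E6'.
move: (cof 4%N 4%N isT isT) (cof 4%N 5%N isT isT) (cof 4%N 6%N isT isT).
move: (cof 5%N 4%N isT isT) (cof 5%N 5%N isT isT) (cof 5%N 6%N isT isT).
move: (cof 6%N 4%N isT isT) (cof 6%N 5%N isT isT) (cof 6%N 6%N isT isT).
rewrite /next567 /= => C1 C2 C3 B1 B2 B3 A1 A2 A3.
have [] := @cross_triple nu (asd 4 4) (asd 4 5) (asd 4 6) (asd 5 4) (asd 5 5) (asd 5 6)
  (asd 6 4) (asd 6 5) (asd 6 6) nu0; rewrite ?A1 ?A2 ?A3 ?B1 ?B2 ?B3 ?C1 ?C2 ?C3; try ring.
move=> [ab bc ca] [[[a1 a2 a3] [b1 b2 b3] [c1 c2 c3]]|[aa bb cc]].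
  left=> k l; rewrite !inE => /or3P[] /eqP-> /or3P[] /eqP->; assumption.
right.
move: E4 E4' E5 E5' E6 E6' aa bb cc ab bc ca A1 A2 A3 B1 B2 B3 C1 C2 C3.
set a1 := asd 4 4; set a2 := asd 4 5; set a3 := asd 4 6.
set b1 := asd 5 4; set b2 := asd 5 5; set b3 := asd 5 6.
set c1 := asd 6 4; set c2 := asd 6 5; set c3 := asd 6 6.
move=> [e402 e413 e403] [e412 e401 e423] [e502 e513 e503] [e512 e501 e523]
  [e602 e613 e603] [e612 e601 e623] aa bb cc ab bc ca A1 A2 A3 B1 B2 B3 C1 C2 C3.
pose K r i : R := nth 0 (nth [::] [::
  [:: nu + a1 + b2 + c3; a2 - b1; b3 - c2; a3 - c1];
  [:: a2 - b1; nu - a1 - b2 + c3; a3 + c1; - b3 - c2];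
  [:: b3 - c2; a3 + c1; nu + a1 - b2 - c3; - a2 - b1];
  [:: a3 - c1; - b3 - c2; - a2 - b1; nu - a1 + b2 - c3]] r) i.
have Kker r j m : (r < 4)%N -> index7 j -> index7 m -> \sum_(i < 4) K r i * sc b i j m = 0.
  move=> r4 j7 m7; have [m4|m4] := ltnP m 4.
    by rewrite big1 // => i _; rewrite cm // mulr0.
  have [j4|j4] := ltnP j 4; last first.
    by rewrite big1 // => i _; rewrite struct_constC c4 // oppr0 mulr0.
  have mv : m \in [:: 4; 5; 6]%N by move: m7; rewrite /index7 !inE; lia.
  rewrite !big_ord_recl big_ord0 /= /bump /= {m4 m7 j7}.
  case: r r4 => [|[|[|[|//]]]] _; case: j j4 => [|[|[|[|//]]]] _;
  move: mv; rewrite !inE => /or3P[] /eqP->;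
  rewrite ?struct_constxx ?[sc b 1 0 _]struct_constC ?[sc b 2 0 _]struct_constC
    ?[sc b 3 0 _]struct_constC ?[sc b 2 1 _]struct_constC ?[sc b 3 1 _]struct_constC
    ?[sc b 3 2 _]struct_constC ?e402 ?e413 ?e403 ?e412 ?e401 ?e423 ?e502 ?e513 ?e503 ?e512
    ?e501 ?e523 ?e602 ?e613 ?e603 ?e612 ?e601 ?e623 /K /=; lra.
have [r [r4 Kr]] : exists r, (r < 4)%N /\ K r r != 0.
  have [k0|k0] := eqVneq (K 0%N 0%N) 0; last by exists 0%N.
  have [k1|k1] := eqVneq (K 1%N 1%N) 0; last by exists 1%N.
  have [k2|k2] := eqVneq (K 2%N 2%N) 0; last by exists 2%N.
  exists 3%N; split=> //; apply: contra nu0 => /eqP k3; apply/eqP.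
  by rewrite /K /= in k0 k1 k2 k3; lra.
exists (K r); split; first by exists r.
by move=> j m j7 m7; exact: Kker.
Qed.

End Frame.
End Classification.

(** * The structure equations in terms of the bracket *)

Section StructureConstants.
Variables (R : realType) (V : vectType R) (br : V -> V -> V) (g : V -> V -> R^o).
Variable phi : kform V 3.
Hypothesis dimV : \dim {:V} = 7%N.
Hypothesis brP : lie_bracket br.
Hypothesis gP : inner_product g.
Variables (e : seq 'Hom(V, R^o)) (b : nat -> V).
Hypothesis bA : adapted g phi b.
Hypothesis eb : dual_frame e b.

Lemma dual_metric k v : (k < 7)%N -> nth 0 e k v = g v (b k).
Proof.
move=> k7; have bO : orthonormal g 7 b by case: bA.
rewrite (orthonormal_expand gP dimV bO v) linear_sum (metric_suml gP).
apply: eq_bigr => i _; rewrite linearZ /= eb // (metricZl gP) bO // eq_sym.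
by [].
Qed.

Lemma ce_diff_covector (f : 'Hom(V, R^o)) :
  ce_diff br (form_of_covector f) = fun v => - f (br (v ord0) (v ord_max)).
Proof.
apply/funext => v; rewrite /ce_diff !big_ord_recl !big_ord0 /= addr0.
rewrite !(big_mkcond (fun j : 'I_1 => _)) /= !big_ord_recl !big_ord0 /= !addr0.
rewrite expr1 mulN1r /form_of_covector /fcons unlift_none.
by congr (- f (br _ (v _))); apply: val_inj.
Qed.

Lemma d_basis_is_form k : is_form (d_basis br e k).
Proof.
rewrite /d_basis ce_diff_covector; set f := nth 0 e k.-1.
case: brP => -[bl b_r] b0 _.
apply: (@pairing_is_form _ _ (fun x y => - f (br x y))) => [a x x' y|a x y y'|x].
- by rewrite bl linearP opprD mulrN.
- by rewrite b_r linearP opprD mulrN.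
- by rewrite b0 linear0 oppr0.
Qed.

Lemma two_form_eq (w w' : kform V 2) : is_form w -> is_form w' ->
    (forall i j, (i < j)%N -> index7 j -> ev b w [:: i; j] = ev b w' [:: i; j]) ->
  w = w'.
Proof.
move=> wF wF' ww'; apply: (frame_ext dimV gP bA) => [||]; [by case: wF|by case: wF'|].
case=> [|i [|j [|]]] // _ /and3P[i7 j7 _].
have anti (u : kform V 2) k l : is_form u -> ev b u [:: l; k] = - ev b u [:: k; l].
  by move=> uF; have := @ev_alt_comp _ _ b _ u (is_form_alternating uF) k [:: l] 1%N erefl isT; rewrite /ins /= expr1 mulN1r.
have rep (u : kform V 2) k : is_form u -> ev b u [:: k; k] = 0.
  by move=> uF; have := anti u k k uF => E; lra.
case: (ltngtP i j) => [ij|ji|->]; first exact: ww'.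
  by rewrite anti // ww' // -anti.
by rewrite !rep.
Qed.

Lemma ev_d_basis k i j : (0 < k <= 7)%N ->
  ev b (d_basis br e k) [:: i; j] = - struct_const br g b i j k.-1.
Proof. by move=> k7; rewrite /d_basis ce_diff_covector /ev /= dual_metric //; move: k7; lia. Qed.

(** A structure equation only has to be compared on pairs of frame vectors. *)
Lemma d_basisE k (w : kform V 2) : (0 < k <= 7)%N -> is_form w ->
  d_basis br e k = w <-> forall i j, (i < j)%N -> index7 j ->
    struct_const br g b i j k.-1 = - ev b w [:: i; j].
Proof.
move=> k7 wF; split=> [<- i j _ _|H]; first by rewrite ev_d_basis // opprK.
apply: two_form_eq => // [|i j ij j7]; first exact: d_basis_is_form.
by rewrite ev_d_basis // H // opprK.
Qed.

Lemma ev_monomial2 p q i j : (p.-1 < 7)%N -> (q.-1 < 7)%N -> index7 i -> index7 j ->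
  ev b (monomial e [:: p; q] : kform V 2) [:: i; j] =
    ((i == p.-1) && (j == q.-1))%:R - ((j == p.-1) && (i == q.-1))%:R.
Proof.
move=> p7 q7 i7 j7; have -> : ev b (monomial e [:: p; q] : kform V 2) [:: i; j]
    = monomial_comp (Rarith R) [:: p; q] [:: i; j].
  by apply: (@ev_monomial _ _ e b [:: p; q] [:: i; j] eb); rewrite /= ?p7 ?q7 ?i7 ?j7.
rewrite /=.
rewrite !eqseq_cons !andbT /asign /= realZ0 realZ1 realZN1.
by case: eqP; case: eqP; case: eqP; case: eqP => *; rewrite /= ?realZ0 ?realZ1; ring.
Qed.

Lemma monomial2_is_form p q : is_form (monomial e [:: p; q] : kform V 2).
Proof. exact: (monomial_is_form e [:: p; q]). Qed.

Lemma is_formZ k (a : R) (w : kform V k) : is_form w -> is_form (a *: w).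
Proof.
move=> [wL w0]; split=> [v i c x y|v i j ij vij].
  by rewrite -![(a *: w) _]/(a * w _) wL mulrDr mulrCA.
by rewrite -[(a *: w) _]/(a * w _) (w0 _ _ _ ij vij) mulr0.
Qed.

Lemma is_form0 k : is_form (0 : kform V k).
Proof. by split=> [v i a x y|//]; rewrite -![(0 : kform V k) _]/(0 : R) mulr0 addr0. Qed.

End StructureConstants.

(** * Adapted frames for the derived algebra *)

Section Relabel.
Variables (R : realType) (V : vectType R) (g : V -> V -> R^o) (phi : kform V 3).
Hypothesis dimV : \dim {:V} = 7%N.
Hypothesis gP : inner_product g.
Hypothesis phiF : is_form phi.
Variable b0 : nat -> V.
Hypothesis b0A : adapted g phi b0.

Local Notation "x \x y" := (cross phi b0 x y) (at level 40, left associativity).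

(** A signed permutation of the indices that preserves the model form. *)
Definition relabel (t : seq (Z * nat)) (b : nat -> V) (i : nat) : V :=
  realZ R (nth (0%BZ, 0%N) t i).1 *: b (nth (0%BZ, 0%N) t i).2.

Definition relabel_ok (t : seq (Z * nat)) : bool :=
  let s i := (nth (0%BZ, 0%N) t i).1 in let p i := (nth (0%BZ, 0%N) t i).2 in
  all (fun i => (p i < 7)%N && all (fun j =>
    Z.eqb (if p i == p j then Z.mul (s i) (s j) else 0%BZ) (if i == j then 1%BZ else 0%BZ)
    && all (fun k => Z.eqb (Z.mul (s i) (Z.mul (s j) (Z.mul (s k) (phiZ [:: p i; p j; p k]))))
                          (phiZ [:: i; j; k])) (iota 0 7)) (iota 0 7)) (iota 0 7).

Lemma relabel_adapted t b : relabel_ok t -> adapted g phi b -> adapted g phi (relabel t b).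
Proof.
move=> tP [bO bphi].
have {}tP i (i7 : (i < 7)%N) := allP tP i (etrans (mem_iota 0 7 i) i7).
have p7 i : (i < 7)%N -> ((nth (0%BZ, 0%N) t i).2 < 7)%N by move=> /tP /andP[].
have {}tP i j i7 (j7 : (j < 7)%N) := allP (proj2 (andP (tP i i7))) j (etrans (mem_iota 0 7 j) j7).
split=> [i j i7 j7|]; rewrite /relabel.
  have /andP[/Z.eqb_eq/(congr1 (realZ R)) E _] := tP i j i7 j7.
  rewrite (metricZl gP) (metricZr gP) bO ?p7 // mulrA -realZM.
  have -> : (i == j)%:R = realZ R (if i == j then 1%BZ else 0%BZ) by case: (i == j).
  by rewrite -E; case: ifP; rewrite ?mulr1 ?mulr0.
case=> [|i [|j [|k [|]]]] // _ /and4P[i7 j7 k7 _].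
have /andP[_ /allP/(_ k)] := tP i j i7 j7; rewrite mem_iota => /(_ k7)/Z.eqb_eq <-.
rewrite !realZM -bphi //=; last by rewrite /index7 !p7.
have -> : ev (fun n => relabel t b n) phi [:: i; j; k] = phi (vec3 (relabel t b i) (relabel t b j) (relabel t b k)).
  by congr phi; apply/funext => -[[|[|[|]]]].
have -> : ev b phi [:: (nth (0%BZ, 0%N) t i).2; (nth (0%BZ, 0%N) t j).2; (nth (0%BZ, 0%N) t k).2]
    = phi (vec3 (b (nth (0%BZ, 0%N) t i).2) (b (nth (0%BZ, 0%N) t j).2) (b (nth (0%BZ, 0%N) t k).2)).
  by congr phi; apply/funext => -[[|[|[|]]]].
have Z0 (u x y : V) c : phi (vec3 (c *: u) x y) = c * phi (vec3 u x y).
  have := phi3_lin0 phiF c u 0 x y; rewrite addr0 => ->.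
  by have := phi3_lin0 phiF (-1) 0 0 x y; rewrite scaler0 addr0 mulN1r addNr => ->; rewrite addr0.
rewrite /relabel Z0 phi3_swap01 // Z0 phi3_swap12 // phi3_swap01 // Z0.
rewrite (phi3_swap01 phiF) (phi3_swap12 phiF) (phi3_swap01 phiF _ (b _) (b _)); ring.
Qed.

Lemma cross_adapted b i j : adapted g phi b -> (i < 7)%N -> (j < 7)%N ->
  b i \x b j = realZ R (cross_index i j).1 *: b (cross_index i j).2.
Proof.
move=> [bO bphi] i7 j7; rewrite (orthonormal_expand gP dimV bO (b i \x b j)).
have /andP[/andP[_ /allP cP] m7] := allP (allP cross_indexP i (etrans (mem_iota 0 7 i) i7)) j (etrans (mem_iota 0 7 j) j7).
have E m : (m < 7)%N -> g (b i \x b j) (b m)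
    = realZ R (if m == (cross_index i j).2 then (cross_index i j).1 else 0%BZ).
  move=> m_7; rewrite -(eqP (cP m (etrans (mem_iota 0 7 m) m_7))) metric_cross //.
  rewrite -bphi //=; last by rewrite /index7 i7 j7 m_7.
  by congr phi; apply/funext => -[[|[|[|]]]].
rewrite (bigD1 (Ordinal m7)) //= big1 => [|m mN]; first by rewrite addr0 E // eqxx.
rewrite E // (_ : (m == _ :> nat) = false) ?realZ0 ?scale0r //.
by apply: contraNF mN => /eqP mE; apply/eqP/val_inj.
Qed.

(** The frame with [e_7], [e_1], [e_3] equal to the given vectors. *)
Definition complex_frame (x y z : V) : nat -> V :=
  relabel [:: (1%BZ, 5); (1%BZ, 6); (1%BZ, 0); (1%BZ, 2); ((-1)%BZ, 3); ((-1)%BZ, 1); (1%BZ, 4)]%N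
    (triple_frame phi b0 x y z).

Lemma complex_frame_adapted x y z :
    g x x = 1 -> g y y = 1 -> g z z = 1 -> g x y = 0 -> g x z = 0 -> g y z = 0 ->
    phi (vec3 x y z) = 0 ->
  [/\ adapted g phi (complex_frame x y z), complex_frame x y z 6 = x,
      complex_frame x y z 0 = y, complex_frame x y z 1 = x \x y &
      complex_frame x y z 2 = z].
Proof.
move=> xx yy zz xy xz yz xyz; split; rewrite ?/complex_frame /relabel /= ?realZ1 ?scale1r //.
by apply: relabel_adapted; [vm_compute|exact: (triple_frame_adapted dimV gP phiF b0A)].
Qed.

End Relabel.

(** * Necessity of the structure equations *)

Section Necessity.
Variables (R : realType) (V : vectType R) (br : V -> V -> V) (g : V -> V -> R^o).
Variables (vol : kform V 7) (phi : kform V 3) (nabla : V -> V -> V).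
Hypothesis dimV : \dim {:V} = 7%N.
Hypothesis brP : lie_bracket br.
Hypothesis nilP : two_step_nilpotent br.
Hypothesis gvolP : g2_metric phi g vol.
Hypothesis phiF : is_form phi.
Hypothesis coclP : coclosed br g vol phi.
Hypothesis nablaP : characteristic_connection br g vol phi nabla.
Hypothesis instP : g2_instanton br g vol phi nabla.
Variable b0 : nat -> V.
Hypothesis b0A : adapted g phi b0.

Let gP : inner_product g. Proof. by case: gvolP. Qed.
Let b0O : orthonormal g 7 b0. Proof. by case: b0A. Qed.
Let brL : bilinear_map br. Proof. by case: brP. Qed.

Local Notation sc := (struct_const br g).
Local Notation "x \x y" := (cross phi b0 x y) (at level 40, left associativity).

(** The derived algebra, as the orthogonal complement of the vectors orthogonal to
    all brackets. *)
Definition derived (u : V) : Prop :=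
  forall w, (forall x y, g (br x y) w = 0) -> g u w = 0.

Lemma derived_bracket x y : derived (br x y).
Proof. by move=> w; apply. Qed.

Lemma derived_linear a u v : derived u -> derived v -> derived (a *: u + v).
Proof.
by move=> Du Dv w wP; rewrite (metricDl gP) (metricZl gP) Du ?Dv // mulr0 addr0.
Qed.

Lemma derivedZ a u : derived u -> derived (a *: u).
Proof. by move=> Du w wP; rewrite (metricZl gP) Du // mulr0. Qed.

Lemma derived_eq0 u : derived u -> (forall x y, g (br x y) u = 0) -> u = 0.
Proof. by move=> Du uP; apply: (metric_eq0 gP); exact: Du. Qed.

Lemma bracket_linear_l y : linear (br^~ y). Proof. by case: brL. Qed.
Lemma bracket_linear_r x : linear (br x). Proof. by case: brL. Qed.

Lemma linear_sum_frame (f : V -> V) u : linear f ->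
  f u = \sum_(i < 7) g u (b0 i) *: f (b0 i).
Proof.
move=> fL; rewrite {1}(orthonormal_expand gP dimV b0O u).
elim/big_rec2: _ => [|i v v' _ <-]; last by rewrite fL.
by have := fL (-1) 0 0; rewrite scaler0 addr0 scaleN1r addNr.
Qed.

(** The functional [u |-> g [u, y] z] is represented by a vector, which is
    orthogonal to all brackets by nilpotency. *)
Lemma derived_central u y : derived u -> br u y = 0.
Proof.
move=> Du; apply: (metric_inj gP) => z; rewrite (metric0l gP).
pose w := \sum_(i < 7) g (br (b0 i) y) z *: b0 i.
have wE v : g v w = g (br v y) z.
  rewrite (linear_sum_frame v (bracket_linear_l y)) (metric_suml gP) (metric_sumr gP).
  by apply: eq_bigr => i _; rewrite (metricZr gP) (metricZl gP) mulrC.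
rewrite -wE; apply: Du => x' y'; rewrite wE.
have [_ nil] := nilP.
by rewrite (bracketC brP) nil oppr0 (metric0l gP).
Qed.

Lemma derived_central_r u y : derived u -> br y u = 0.
Proof. by move=> Du; rewrite (bracketC brP) derived_central // oppr0. Qed.

Lemma derived_unit (s : seq V) :
  (exists u, [/\ derived u, g u u = 1 & forall x, x \in s -> g u x = 0]) \/
  (forall u, derived u -> (forall x, x \in s -> g u x = 0) -> u = 0).
Proof.
have [H|H] := pselect (exists u, [/\ derived u, u != 0 & forall x, x \in s -> g u x = 0]).
  left; have [u [Du u0 us]] := H; have [r _ ru] := normalize gP u0.
  exists (r *: u); split=> //; first exact: derivedZ.
  by move=> x xs; rewrite (metricZl gP) us // mulr0.
right=> u Du us; apply: contrapT => /eqP u0; apply: H; by exists u.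
Qed.

Lemma bracket_frame_eq0 b u : orthonormal g 7 b ->
    (forall i j, (i < j)%N -> (j < 7)%N -> g (br (b i) (b j)) u = 0) ->
  forall x y, g (br x y) u = 0.
Proof.
move=> bO buP x y.
have {}buP (i j : 'I_7) : g (br (b i) (b j)) u = 0.
  have [ij|ji|->] := ltngtP i j; first exact: buP.
    by rewrite (bracketC brP) (metricNl gP) buP ?oppr0.
  by case: brP => _ -> _; rewrite (metric0l gP).
have lin f v : linear f -> g (f v) u = \sum_(i < 7) g v (b i) * g (f (b i)) u.
  move=> fL; rewrite {1}(orthonormal_expand gP dimV bO v).
  rewrite -[RHS](eq_bigr _ (fun i _ => metricZl gP _ _ _)) -(metric_suml gP); congr (g _ u).
  elim/big_rec2: _ => [|i v' v'' _ <-]; last by rewrite fL.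
  by have := fL (-1) 0 0; rewrite scaler0 addr0 scaleN1r addNr.
rewrite (lin _ _ (bracket_linear_l y)) big1 // => i _ /=.
by rewrite (lin _ _ (bracket_linear_r (b i))) [X in _ * X]big1 ?mulr0 // => j _; rewrite buP mulr0.
Qed.

(** A nonzero element of the derived algebra is not orthogonal to all brackets. *)
Lemma derived_detect b u : orthonormal g 7 b -> derived u ->
  (forall i j, (i < j)%N -> (j < 7)%N -> g (br (b i) (b j)) u = 0) -> u = 0.
Proof. by move=> bO Du buP; apply: derived_eq0 Du (bracket_frame_eq0 bO buP). Qed.

Lemma sc_central_l b i j m : derived (b i) -> sc b i j m = 0.
Proof. by move=> Di; rewrite /struct_const derived_central // (metric0l gP). Qed.

Lemma sc_central_r b i j m : derived (b j) -> sc b i j m = 0.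
Proof. by move=> Dj; rewrite /struct_const derived_central_r // (metric0l gP). Qed.

Definition conclusion : Prop :=
  exists e : 7.-tuple 'Hom(V, R^o),
     [/\ basis_of fullv e, phi = g2_model e &
         [\/ structure_eqs1 br e, structure_eqs2 br e | structure_eqs3 br e]].

Lemma conclude b : adapted g phi b ->
    (forall e : 7.-tuple 'Hom(V, R^o), dual_frame e b ->
       [\/ structure_eqs1 br e, structure_eqs2 br e | structure_eqs3 br e]) ->
  conclusion.
Proof.
move=> bA H; have [e [ebase eb]] := coframe_exists dimV gvolP bA.1.
by exists e; split=> //; [exact: (adapted_model dimV gvolP phiF bA)|exact: H].
Qed.

(** ** Two-dimensional derived algebra *)

Lemma not_two_dim z1 z2 : derived z1 -> derived z2 -> g z1 z1 = 1 -> g z2 z2 = 1 ->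
    g z1 z2 = 0 -> (forall u, derived u -> g u z1 = 0 -> g u z2 = 0 -> u = 0) -> False.
Proof.
move=> D1 D2 z11 z22 z12 H.
have [z zz zo] := unit_orthogonal gP (s := [:: z1; z2; z1 \x z2]) b0O isT.
have zz1 : g z1 z = 0 by rewrite (metricC gP) zo // !inE eqxx.
have zz2 : g z2 z = 0 by rewrite (metricC gP) zo // !inE eqxx orbT.
have z12z : phi (vec3 z1 z2 z) = 0.
  by rewrite -(metric_cross dimV gP phiF b0A) (metricC gP) zo // !inE eqxx !orbT.
have bA := triple_frame_adapted dimV gP phiF b0A z11 z22 zz z12 zz1 zz2 z12z.
set b := triple_frame phi b0 z1 z2 z in bA.
have b4 : b 4%N = z1 by []. have b5 : b 5%N = z2 by [].
have bO := bA.1.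
have E i j : br (b i) (b j) = sc b i j 4 *: z1 + sc b i j 5 *: z2.
  apply/eqP; rewrite -subr_eq0; apply/eqP; apply: H.
  - rewrite -scaleN1r addrC; apply: derived_linear; last exact: derived_bracket.
    by apply: derived_linear => //; exact: derivedZ.
  - rewrite (metricDl gP) (metricNl gP) (metricDl gP) !(metricZl gP) /struct_const b4 b5 z11 (metricC gP z2) z12; ring.
  - rewrite (metricDl gP) (metricNl gP) (metricDl gP) !(metricZl gP) /struct_const b4 b5 z22 z12; ring.
have c4 j m : sc b 4 j m = 0 by exact: sc_central_l.
have c5 j m : sc b 5 j m = 0 by exact: sc_central_l.
have cm i j m : index7 m -> (m != 4%N) && (m != 5%N) -> sc b i j m = 0.
  move=> m7 /andP[m4 m5]; rewrite {1}/struct_const E (metricDl gP) !(metricZl gP) -b4 -b5 !bO //.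
  by rewrite eq_sym (negPf m4) eq_sym (negPf m5) !mulr0 addr0.
have minors := frame_eqs2 dimV brP gvolP phiF coclP nablaP instP bA c4 c5 cm.
have zero k l : index7 k -> index7 l -> sc b k l 4 = 0 /\ sc b k l 5 = 0.
  move=> k7 l7; have u0 : sc b k l 5 *: z1 + - sc b k l 4 *: z2 = 0.
    apply: (derived_detect bO); first by apply: derived_linear => //; exact: derivedZ.
    move=> i j ij j7; have i7 : index7 i by exact: ltn_trans ij j7.
    rewrite (metricDr gP) !(metricZr gP) -[g (br _ _) z1]/(sc b i j 4) -[g (br _ _) z2]/(sc b i j 5).
    have := minors i j k l i7 j7 k7 l7; lra.
  have := congr1 (g^~ z1) u0; have := congr1 (g^~ z2) u0.
  rewrite !(metricDl gP) !(metricZl gP) !(metric0l gP) z11 z22 z12 (metricC gP z2) z12; lra.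
have z10 : z1 = 0.
  apply: (derived_detect bO) => // i j ij j7; have i7 : index7 i by exact: ltn_trans ij j7.
  by rewrite -[g _ _]/(sc b i j 4); case: (zero i j i7 j7).
by move: z11; rewrite z10 (metric0l gP) => /eqP; rewrite eq_sym oner_eq0.
Qed.

End Necessity.

Lemma pairing_multilinear (R : realType) (V : vectType R) (f : V -> V -> R) :
    (forall a x x' y, f (a *: x + x') y = a * f x y + f x' y) ->
    (forall a x y y', f x (a *: y + y') = a * f x y + f x y') ->
  multilinear (fun v : 'I_2 -> V => f (v ord0) (v ord_max)).
Proof.
move=> fl fr v i a x y; have : i = ord0 \/ i = ord_max.
  by case: i => -[|[|//]] i2; [left|right]; apply: val_inj.
by case=> ->; rewrite !fupd_same !fupd_other.
Qed.

Section OneDimensional.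
Variables (R : realType) (V : vectType R) (br : V -> V -> V) (g : V -> V -> R^o).
Variables (vol : kform V 7) (phi : kform V 3) (nabla : V -> V -> V).
Hypothesis dimV : \dim {:V} = 7%N.
Hypothesis brP : lie_bracket br.
Hypothesis nilP : two_step_nilpotent br.
Hypothesis gvolP : g2_metric phi g vol.
Hypothesis phiF : is_form phi.
Hypothesis coclP : coclosed br g vol phi.
Hypothesis nablaP : characteristic_connection br g vol phi nabla.
Hypothesis instP : g2_instanton br g vol phi nabla.
Variable b0 : nat -> V.
Hypothesis b0A : adapted g phi b0.

Let gP : inner_product g. Proof. by case: gvolP. Qed.
Let b0O : orthonormal g 7 b0. Proof. by case: b0A. Qed.

Local Notation sc := (struct_const br g).
Local Notation derived := (derived br g).
Local Notation "x \x y" := (cross phi b0 x y) (at level 40, left associativity).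

(** ** One-dimensional derived algebra *)

Variable z : V.
Hypothesis Dz : derived z.
Hypothesis z1 : g z z = 1.
Hypothesis D1 : forall u, derived u -> g u z = 0 -> u = 0.

Definition omega (x y : V) : R := g (br x y) z.
Definition levi (x y : V) : R := omega x (z \x y).

Lemma omegaC x y : omega x y = - omega y x.
Proof. by rewrite /omega (bracketC brP) (metricNl gP). Qed.

Lemma bracket_omega x y : br x y = omega x y *: z.
Proof.
apply/eqP; rewrite -subr_eq0; apply/eqP; apply: D1.
  rewrite -scaleN1r addrC; apply: (derived_linear gvolP); last exact: derived_bracket.
  exact: (derivedZ gvolP).
by rewrite (metricDl gP) (metricNl gP) (metricZl gP) z1 mulr1 subrr.
Qed.

Lemma omegaDl a x x' y : omega (a *: x + x') y = a * omega x y + omega x' y.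
Proof.
by rewrite /omega; case: brP => -[bl _] _ _; rewrite bl (metricDl gP) (metricZl gP).
Qed.

Lemma omegaDr a x y y' : omega x (a *: y + y') = a * omega x y + omega x y'.
Proof. by rewrite omegaC omegaDl opprD -mulrN -!omegaC. Qed.

Lemma omegaZr a x y : omega x (a *: y) = a * omega x y.
Proof.
have o0 : omega x 0 = 0.
  by have := omegaDr (-1) x 0 0; rewrite scaler0 addr0 mulN1r addNr.
by rewrite -[a *: y]addr0 omegaDr o0 addr0.
Qed.

Lemma omegaz x : omega x z = 0.
Proof. by rewrite /omega (derived_central_r dimV brP nilP gvolP b0A _ Dz) (metric0l gP). Qed.

Lemma frame_eqs1z b : adapted g phi b -> b 6%N = z ->
  let w i j := sc b i j 6 in
  [/\ w 0 3 = - w 1 2, w 0 2 = w 1 3, w 0 5 = - w 1 4 & w 0 4 = w 1 5] /\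
  [/\ w 2 5 = - w 3 4, w 2 4 = w 3 5 & w 0 1 + w 2 3 + w 4 5 = 0].
Proof.
move=> bA b6; apply: (frame_eqs1 dimV brP gvolP phiF coclP nablaP instP bA) => [j m|i j m m7 m6].
  by apply: (sc_central_l dimV brP nilP gvolP b0A); rewrite b6.
rewrite /struct_const bracket_omega (metricZl gP) -b6; case: bA => bO _.
by rewrite bO // eq_sym (negPf m6) mulr0.
Qed.

(** Coclosedness says that the two-form [omega] is of type (1,1) for the complex
    structure [z \x _]. *)
Lemma leviC x y : levi x y = levi y x.
Proof.
have [y1 y11 zy] := unit_orthogonal gP (s := [:: z]) b0O isT.
have [z' z11 zz'] := unit_orthogonal gP (s := [:: z; y1; z \x y1]) b0O isT.
have h1 : g z y1 = 0 by rewrite (metricC gP) zy ?inE.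
have h2 : g z z' = 0 by rewrite (metricC gP) zz' ?inE ?eqxx.
have h3 : g y1 z' = 0 by rewrite (metricC gP) zz' ?inE ?eqxx ?orbT.
have h4 : phi (vec3 z y1 z') = 0.
  by rewrite -(metric_cross dimV gP phiF b0A) (metricC gP) zz' ?inE ?eqxx ?orbT.
have [bA b6 _ _ _] := complex_frame_adapted dimV gP phiF b0A z1 y11 z11 h1 h2 h3 h4.
move: (complex_frame _ _ _ _ _) bA b6 => b bA b6 {h1 h2 h3 h4 y11 zy z11 zz' y1 z'}.
have [[e03 e02 e05 e04] [e25 e24 _]] := frame_eqs1z bA b6.
have E : (fun v : 'I_2 -> V => levi (v ord0) (v ord_max)) = (fun v : 'I_2 -> V => levi (v ord_max) (v ord0)).
  apply: (frame_ext dimV gP bA).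
  - by apply: pairing_multilinear => *; rewrite /levi ?(cross_linr dimV gP phiF b0A) ?omegaDl ?omegaDr.
  - by apply: (@pairing_multilinear _ _ (fun x y => levi y x)) => *; rewrite /levi ?(cross_linr dimV gP phiF b0A) ?omegaDl ?omegaDr.
  case=> [|i [|j [|]]] // _ /and3P[i7 j7 _]; rewrite /ev /= /levi -b6.
  rewrite !(cross_adapted dimV gP phiF b0A bA) //.
  have JE k : (k < 7)%N -> cross_index 6 k = nth (0%BZ, 0%N)
      [:: (1%BZ, 1); ((-1)%BZ, 0); (1%BZ, 3); ((-1)%BZ, 2); (1%BZ, 5); ((-1)%BZ, 4); (0%BZ, 0)]%N k.
    by do 7 (case: k => [//|k]).
  rewrite !JE // !omegaZr {JE}.
  have wE k l : omega (b k) (b l) = sc b k l 6 by rewrite /struct_const b6.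
  have C k l : sc b k l 6 = - sc b l k 6 by exact: (struct_constC brP gvolP).
  have X k : sc b k k 6 = 0 by exact: (struct_constxx brP gvolP).
  have Z k : sc b 6 k 6 = 0 by apply: (sc_central_l dimV brP nilP gvolP b0A); rewrite b6.
  have Z' k : sc b k 6 6 = 0 by rewrite C Z oppr0.
  by do 7 (case: i i7 => [_|i i7]; [do 7 (case: j j7 => [_|j j7]; [rewrite /= !wE ?realZ0
    ?realZ1 ?realZN1 ?X ?Z ?Z' ?[sc b 1 0 _]C ?[sc b 2 0 _]C ?[sc b 2 1 _]C ?[sc b 3 2 _]C ?[sc b 4 2 _]C ?[sc b 4 3 _]C ?[sc b 5 2 _]C ?[sc b 5 3 _]C ?[sc b 5 4 _]C ?[sc b 3 0 _]C ?[sc b 3 1 _]C ?[sc b 4 0 _]C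
    ?[sc b 4 1 _]C ?[sc b 5 0 _]C ?[sc b 5 1 _]C; move: e03 e02 e05 e04 e25 e24; lra|]); by []|]).
by have := congr1 (fun F => F (fun i : 'I_2 => nth 0 [:: x; y] i)) E.
Qed.

Lemma levi_omega X mu : (forall y, levi X y = mu * g X y) ->
  forall y, omega X y = mu * g (z \x X) y.
Proof.
move=> H y; have := H (z \x y).
rewrite /levi (cross_cross dimV gP phiF b0A) z1 omegaDr omegaZr omegaz mulr0 addr0 mulN1r.
rewrite (metricC gP X) !(metric_cross dimV gP phiF b0A) (phi3_swap12 phiF).
rewrite mulrN => E; apply: oppr_inj; exact: E.
Qed.

Lemma leviDl a x x' y : levi (a *: x + x') y = a * levi x y + levi x' y.
Proof. exact: omegaDl. Qed.

Lemma levi0l y : levi 0 y = 0.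
Proof. have := leviDl (-1) 0 0 y; rewrite scaler0 addr0; lra. Qed.

Lemma levi_suml n (a : 'I_n -> R) (x : 'I_n -> V) y :
  levi (\sum_i a i *: x i) y = \sum_i a i * levi (x i) y.
Proof.
elim/big_rec2: _ => [|i v v' _ <-]; last by rewrite leviDl.
exact: levi0l.
Qed.

(** An eigenvector of [levi] orthogonal to [z] and to given eigenvectors. *)
Lemma levi_direction b k : adapted g phi b -> b 6%N = z -> (k < 6)%N ->
    (forall i, (i < k)%N -> exists mu, forall y, levi (b i) y = mu * g (b i) y) ->
  exists X mu, [/\ g X X = 1, g X z = 0, forall i, (i < k)%N -> g X (b i) = 0 &
    forall y, levi X y = mu * g X y].
Proof.
move=> bA b6 k6 bk; have bO : orthonormal g 7 b by case: bA.
pose f (i : 'I_(6 - k)) := b (k + i)%N.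
have f6 (i : 'I_(6 - k)) : (k + i < 6)%N by have := ltn_ord i; lia.
have f7 (i : 'I_(6 - k)) : (k + i < 7)%N := ltnW (f6 i).
have fO i j : g (f i) (f j) = (i == j)%:R by rewrite bO // eqn_add2l.
pose S := \matrix_(i, j) levi (f i) (f j).
have ST : S^T = S by apply/matrixP => i j; rewrite !mxE leviC.
have [] := symmetric_eigenvector _ ST; first by rewrite subn_gt0.
move=> mu [v [v0 vS]]; pose X := \sum_i v 0 i *: f i.
have Xf j : g X (f j) = v 0 j.
  rewrite (metric_suml gP) (bigD1 j) //= (metricZl gP) fO eqxx mulr1 big1 ?addr0 // => i ij.
  by rewrite (metricZl gP) fO (negPf ij) mulr0.
have Xb i : (i < 7)%N -> (i < k)%N || (i == 6)%N -> g X (b i) = 0.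
  move=> i7 ik; rewrite (metric_suml gP) big1 // => j _.
  rewrite (metricZl gP) bO // (_ : (_ == _) = false) ?mulr0 //.
  by have := f6 j; move: ik; lia.
have X0 : X != 0.
  apply: contraNneq v0 => X0; apply/eqP/rowP => j.
  by rewrite -Xf X0 (metric0l gP) mxE.
have levib i : (i < 7)%N -> levi X (b i) = mu * g X (b i).
  move=> i7; have [ik|ki] := ltnP i k.
    have [nu bi] := bk i ik.
    by rewrite leviC bi (metricC gP) Xb ?ik // !mulr0.
  have [i6|i6] := eqVneq i 6%N.
    by rewrite Xb ?i6 ?orbT // mulr0 b6 leviC /levi omegaC omegaz oppr0.
  have ik : (i - k < 6 - k)%N by rewrite ltn_sub2r //; move: i6 i7; lia.
  have -> : b i = f (Ordinal ik) by rewrite /f /= subnKC.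
  rewrite Xf levi_suml; have /rowP/(_ (Ordinal ik)) := vS; rewrite !mxE => <-.
  by apply: eq_bigr => j _; rewrite mxE.
have leviX y : levi X y = mu * g X y.
  rewrite leviC (orthonormal_expand gP dimV bO y) levi_suml (metric_sumr gP) mulr_sumr.
  by apply: eq_bigr => i _; rewrite leviC levib // (metricZr gP) mulrCA.
have [r r0 rX] := normalize gP X0; exists (r *: X), mu; split=> // [|i ik|y].
- by rewrite (metricZl gP) -b6 Xb ?mulr0 ?orbT.
- by rewrite (metricZl gP) Xb ?ik ?mulr0 //; apply: ltn_trans ik _; exact: ltnW.
- have := leviDl r X 0 y; rewrite addr0 => ->; rewrite leviX (metricZl gP).
  rewrite levi0l.
  by rewrite addr0 mulrCA.
Qed.

Lemma one_dim : conclusion br phi.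
Proof.
have frame y w : g y y = 1 -> g w w = 1 -> g z y = 0 -> g z w = 0 -> g y w = 0 ->
    g (z \x y) w = 0 ->
  exists b, [/\ adapted g phi b, b 6%N = z, b 0%N = y, b 1%N = z \x y & b 2%N = w].
  rewrite (metric_cross dimV gP phiF b0A) => yy ww zy zw yw zyw.
  exists (complex_frame phi b0 z y w).
  by have [] := complex_frame_adapted dimV gP phiF b0A z1 yy ww zy zw yw zyw.
have frame1 y : g y y = 1 -> g z y = 0 -> exists b,
    [/\ adapted g phi b, b 6%N = z, b 0%N = y & b 1%N = z \x y].
  move=> yy zy; have [w ww wo] := unit_orthogonal gP (s := [:: z; y; z \x y]) b0O isT.
  have [|||b [bA b6 b0y b1 _]] := frame y w yy ww zy; rewrite ?(metricC gP _ w) ?wo ?inE ?eqxx ?orbT //.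
  by exists b.
have [y yy zy] := unit_orthogonal gP (s := [:: z]) b0O isT.
have [|b [bA b6 _ _]] := frame1 y yy; first by rewrite (metricC gP) zy ?inE.
have [//|X [mu [XX Xz _ XE]]] := @levi_direction b 0%N bA b6 isT.
have [|b' [b'A b'6 b'0 b'1]] := frame1 X XX; first by rewrite (metricC gP).
have [|Y [nu [YY Yz Yb YE]]] := @levi_direction b' 2%N b'A b'6 isT.
  case=> [|[|//]] _; exists mu => v; rewrite ?b'0 ?b'1 //.
  rewrite leviC /levi (cross_cross dimV gP phiF b0A) z1 omegaDr omegaZr omegaz mulr0 addr0.
  by rewrite mulN1r -omegaC (levi_omega XE).
have [||||b2 [bA2 b26 b20 b21 b22]] := frame X Y XX YY; rewrite ?(metricC gP z) //.
- by rewrite (metricC gP) -b'0 Yb.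
- by rewrite (metricC gP) -b'1 Yb.
have b2O : orthonormal g 7 b2 by case: bA2.
have b23 : z \x Y = b2 3%N.
  rewrite -b22 -b26 (cross_adapted dimV gP phiF b0A bA2) //.
  by rewrite (_ : cross_index 6 2 = (1%BZ, 3%N)) // realZ1 scale1r.
have w0 j : (j < 7)%N -> sc b2 0 j 6 = if j == 1%N then mu else 0.
  move=> j7; rewrite /struct_const b26 -/(omega _ _) b20 (levi_omega XE) -b21 b2O // eq_sym.
  by case: eqP; rewrite ?mulr1 ?mulr0.
have w2 j : (j < 7)%N -> sc b2 2 j 6 = if j == 3%N then nu else 0.
  move=> j7; rewrite /struct_const b26 -/(omega _ _) b22 (levi_omega YE) b23 b2O // eq_sym.
  by case: eqP; rewrite ?mulr1 ?mulr0.
have C i j : sc b2 i j 6 = - sc b2 j i 6 by exact: (struct_constC brP gvolP).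
have [[e03 e02 e05 e04] [e25 e24 tr]] := frame_eqs1z bA2 b26.
rewrite !w0 //= in e03 e02 e05 e04 tr; rewrite !w2 //= in e25 e24 tr.
have cm i j m : index7 m -> m != 6%N -> sc b2 i j m = 0.
  move=> m7 m6; rewrite /struct_const bracket_omega (metricZl gP) -b26 b2O // eq_sym (negPf m6).
  by rewrite mulr0.
have Z j : sc b2 6 j 6 = 0 by apply: (sc_central_l dimV brP nilP gvolP b0A); rewrite b26.
have wE i j : (i < j)%N -> (j < 7)%N -> sc b2 i j 6 =
    mu * ((i == 0%N) && (j == 1%N))%:R + nu * ((i == 2%N) && (j == 3%N))%:R
    - (mu + nu) * ((i == 4%N) && (j == 5%N))%:R.
  move=> ij j7; have [j6|j6] := eqVneq j 6%N.
    rewrite j6 C Z !andbF /= !mulr0; lra.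
  have {j6} j6 : (j < 6)%N by rewrite ltn_neqAle j6.
  case: i ij => [|[|[|[|[|i]]]]] ij; last by move: ij; lia.
  - rewrite w0 //=; case: eqP => _ /=; rewrite ?mulr0n ?mulr1n; lra.
  - case: j ij j7 j6 => [|[|[|[|[|[|//]]]]]] // _ _ _ /=; rewrite ?mulr0n ?mulr1n; lra.
  - rewrite w2 //=; case: eqP => _ /=; rewrite ?mulr0n ?mulr1n; lra.
  - case: j ij j7 j6 => [|[|[|[|[|[|//]]]]]] // _ _ _ /=; rewrite ?mulr0n ?mulr1n; lra.
  - case: j ij j7 j6 => [|[|[|[|[|[|//]]]]]] // _ _ _ /=; rewrite ?mulr0n ?mulr1n; lra.
apply: (conclude dimV gvolP phiF bA2) => e eb; constructor 1.
have dE := d_basisE dimV brP gP bA2 eb; split=> [k /andP[k0 k6]|].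
  apply/dE; [by rewrite k0 ltnW|exact: is_form0|] => i j ij j7.
  rewrite /ev oppr0 cm // /index7; move: k0 k6; lia.
exists (- mu), (- nu); split.
  apply: contraTN isT => /eqP[/eqP + /eqP]; rewrite !oppr_eq0 => /eqP mu0 /eqP nu0.
  suff z0 : z = 0 by move/eqP: z1; rewrite z0 (metric0l gP) eq_sym oner_eq0.
  have w00 i j : (i < j)%N -> (j < 7)%N -> sc b2 i j 6 = 0.
    by move=> ij j7; rewrite wE // mu0 nu0; lra.
  apply: (derived_detect dimV brP gvolP b2O Dz) => i j ij j7.
  by rewrite -b26 -/(struct_const br g b2 i j 6) w00.
apply/dE => //.
  apply: is_formD; apply: is_formZ; (apply: is_formD; last apply: is_formN); exact: monomial2_is_form.
move=> i j ij j7; have i7 : index7 i by exact: ltn_trans ij j7.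
rewrite wE //.
have evm := @ev_monomial2 _ _ _ _ eb.
pose mon p q := ev b2 (monomial e [:: p; q] : kform V 2) [:: i; j].
rewrite -[ev _ _ _]/(- mu * (mon 1 2 - mon 5 6) + - nu * (mon 3 4 - mon 5 6)) /mon.
rewrite !evm //=.
have sw k l : (k < l)%N -> (j == k) && (i == l) = false.
  by move=> kl; apply/negbTE; move: ij kl; lia.
by rewrite !sw //; lra.
Qed.

End OneDimensional.

Section ThreeDimensional.
Variables (R : realType) (V : vectType R) (br : V -> V -> V) (g : V -> V -> R^o).
Variables (vol : kform V 7) (phi : kform V 3) (nabla : V -> V -> V).
Hypothesis dimV : \dim {:V} = 7%N.
Hypothesis brP : lie_bracket br.
Hypothesis nilP : two_step_nilpotent br.
Hypothesis gvolP : g2_metric phi g vol.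
Hypothesis phiF : is_form phi.
Hypothesis coclP : coclosed br g vol phi.
Hypothesis nablaP : characteristic_connection br g vol phi nabla.
Hypothesis instP : g2_instanton br g vol phi nabla.
Variable b0 : nat -> V.
Hypothesis b0A : adapted g phi b0.

Let gP : inner_product g. Proof. by case: gvolP. Qed.
Let b0O : orthonormal g 7 b0. Proof. by case: b0A. Qed.

Local Notation sc := (struct_const br g).
Local Notation derived := (derived br g).
Local Notation "x \x y" := (cross phi b0 x y) (at level 40, left associativity).

Lemma unit_neq0 x : g x x = 1 -> x <> 0.
Proof. by move=> xx x0; move/eqP: xx; rewrite x0 (metric0l gP) eq_sym oner_eq0. Qed.

(** Only the three brackets of an orthonormal basis of the complement of four
    central vectors can be nonzero, and four vectors have a combination that is
    orthogonal to three. *)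
Lemma not_four_dim (z : nat -> V) : orthonormal g 4 z ->
  (forall i, (i < 4)%N -> derived (z i)) -> False.
Proof.
move=> zO zD.
have [p pp po] := unit_orthogonal gP (s := [:: z 0; z 1; z 2; z 3]%N) b0O isT.
have [q qq qo] := unit_orthogonal gP (s := [:: z 0; z 1; z 2; z 3; p]%N) b0O isT.
have [r rr ro] := unit_orthogonal gP (s := [:: z 0; z 1; z 2; z 3; p; q]%N) b0O isT.
pose b i := nth 0 [:: z 0; z 1; z 2; z 3; p; q; r]%N i.
have bO : orthonormal g 7 b.
  have lt i j : (i < j)%N -> (j < 7)%N -> g (b j) (b i) = 0.
    have bz k : (k < 4)%N -> b k = z k by case: k => [|[|[|[|]]]].
    have [j4 ij _|j4 ij j7] := ltnP j 4.
      by rewrite !bz ?(ltn_trans ij) // zO ?(ltn_trans ij) // gtn_eqF.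
    have [|[]] : j = 4%N \/ j = 5%N \/ j = 6%N by move: j4 j7; lia.
    - by move=> jE; move: ij; rewrite jE; case: i => [|[|[|[|]]]] // _; apply: po; rewrite !inE eqxx ?orbT.
    - by move=> jE; move: ij; rewrite jE; case: i => [|[|[|[|[|]]]]] // _; apply: qo; rewrite !inE eqxx ?orbT.
    - by move=> jE; move: ij; rewrite jE; case: i => [|[|[|[|[|[|]]]]]] // _; apply: ro; rewrite !inE eqxx ?orbT.
  move=> i j i7 j7; have [ij|ji|ij] := ltngtP i j.
  - by rewrite (metricC gP) lt.
  - exact: lt.
  - by rewrite ij; case: j j7 {i7 ij} => [|[|[|[|[|[|[|]]]]]]] //= _; rewrite zO.
have [a [[i ai] aw]] := @orthogonal_combination R V g 4 3 (fun i => z i)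
  (fun j => nth 0 [:: br p q; br p r; br q r] j) gP isT.
set u := \sum_i _ in aw.
have Du : derived u.
  move=> w wP; rewrite (metric_suml gP) big1 // => k _.
  by rewrite (metricZl gP) (zD k) ?mulr0.
have u0 : u = 0.
  apply: (derived_detect dimV brP gvolP bO Du) => k l kl l7.
  have [k4|k4] := ltnP k 4.
    have -> : b k = z k by case: k k4 {kl} => [|[|[|[|]]]].
    by rewrite (derived_central dimV brP nilP gvolP b0A) ?(metric0l gP) //; exact: zD.
  rewrite (metricC gP); have := aw ord0; have := aw (lift ord0 ord0); have := aw ord_max; rewrite /= => h3 h2 h1.
  by have [[-> ->]|[[-> ->]|[-> ->]]] : (k = 4 /\ l = 5 \/ k = 4 /\ l = 6 \/ k = 5 /\ l = 6)%N by move: kl k4 l7; lia.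
move/eqP: ai; apply; have := metric0l gP (z i); rewrite -u0 (metric_suml gP) (bigD1 i) //=.
rewrite (metricZl gP) zO // eqxx mulr1 big1 ?addr0 // => j ji.
by rewrite (metricZl gP) zO // (inj_eq val_inj) (negPf ji) mulr0.
Qed.

(** ** Three-dimensional derived algebra *)

Variables z1 z2 z3 : V.
Hypothesis D1 : derived z1.
Hypothesis D2 : derived z2.
Hypothesis D3 : derived z3.
Hypothesis z11 : g z1 z1 = 1.
Hypothesis z22 : g z2 z2 = 1.
Hypothesis z33 : g z3 z3 = 1.
Hypothesis z12 : g z1 z2 = 0.
Hypothesis z13 : g z1 z3 = 0.
Hypothesis z23 : g z2 z3 = 0.
Hypothesis Dmax : forall u, derived u -> g u z1 = 0 -> g u z2 = 0 -> g u z3 = 0 -> u = 0.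

Lemma bracket_three x y :
  br x y = g (br x y) z1 *: z1 + g (br x y) z2 *: z2 + g (br x y) z3 *: z3.
Proof.
have z21 : g z2 z1 = 0 by rewrite (metricC gP).
have z31 : g z3 z1 = 0 by rewrite (metricC gP).
have z32 : g z3 z2 = 0 by rewrite (metricC gP).
set w := br x y; set a1 := g w z1; set a2 := g w z2; set a3 := g w z3.
have /eqP : - a1 *: z1 + (- a2 *: z2 + (- a3 *: z3 + w)) = 0.
  apply: Dmax; first by do 3!(apply: (derived_linear gvolP) => //); exact: derived_bracket.
  - rewrite !(metricDl gP) !(metricZl gP) z11 z21 z31 -/a1; ring.
  - rewrite !(metricDl gP) !(metricZl gP) z12 z22 z32 -/a2; ring.
  - rewrite !(metricDl gP) !(metricZl gP) z13 z23 z33 -/a3; ring.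
by rewrite !scaleNr !addrA addrC -!opprD subr_eq0 => /eqP.
Qed.

Let e7 : V := z1 \x z2.

Let e7z1 : g e7 z1 = 0. Proof. exact: (metric_crossl dimV gP phiF b0A). Qed.
Let e7z2 : g e7 z2 = 0. Proof. exact: (metric_crossr dimV gP phiF b0A). Qed.
Let e77 : g e7 e7 = 1.
Proof. by rewrite /e7 (metric_cross2 dimV gP phiF b0A) z11 z22 z12; ring. Qed.

(** If the third direction [z3] is not the product of the others, the frame with
    [e_5], [e_6] equal to [z1], [z2] and [e_1] in the plane of [e_7] and [z3] has no
    nonzero structure constants at all. *)
Lemma third_is_product : z3 = g z3 e7 *: e7.
Proof.
set C := g z3 e7; apply: contrapT => z3e; pose u := z3 - C *: e7.
have u0 : u != 0 by rewrite subr_eq0; apply/eqP.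
have [r r0 ru] := normalize gP u0.
have gu w : g (r *: u) w = r * (g z3 w - C * g e7 w).
  by rewrite (metricZl gP) /u (metricDl gP) (metricNl gP) (metricZl gP).
have uz1 : g z1 (r *: u) = 0 by rewrite (metricC gP) gu e7z1 (metricC gP) z13; ring.
have uz2 : g z2 (r *: u) = 0 by rewrite (metricC gP) gu e7z2 (metricC gP) z23; ring.
have ue7 : phi (vec3 z1 z2 (r *: u)) = 0.
  by rewrite -(metric_cross dimV gP phiF b0A) -/e7 (metricC gP) gu e77 -/C; ring.
have bA := triple_frame_adapted dimV gP phiF b0A z11 z22 ru z12 uz1 uz2 ue7.
set b := triple_frame phi b0 z1 z2 (r *: u) in bA.
have b4 : b 4%N = z1 by []. have b5 : b 5%N = z2 by [].
have b6 : b 6%N = e7 by []. have bu : b 0%N = r *: u by [].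
move: b bA b4 b5 b6 bu => b bA b4 b5 b6 bu; have bO := bA.1.
have z3E : z3 = C *: b 6%N + r^-1 *: b 0%N.
  by rewrite bu b6 scalerA mulVf // scale1r addrC subrK.
have brE i j m : index7 m -> sc b i j m = sc b i j 4 * (4 == m)%N%:R + sc b i j 5 * (5 == m)%N%:R
     + g (br (b i) (b j)) z3 * (C * (6 == m)%N%:R + r^-1 * (0 == m)%N%:R).
  move=> m7; rewrite {1}/struct_const [in LHS]bracket_three !(metricDl gP) !(metricZl gP) -b4 -b5.
  have z3m : g z3 (b m) = C * (6 == m)%N%:R + r^-1 * (0 == m)%N%:R.
    by rewrite z3E (metricDl gP) !(metricZl gP) !bO.
  by rewrite z3m !bO.
have brz3 y : r^-1 *: br (b 0%N) y = - C *: br (b 6%N) y.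
  have [[bl _] _ _] := brP.
  have : br z3 y = 0 by exact: (derived_central dimV brP nilP gvolP b0A).
  rewrite z3E bl; have := bl y r^-1 (b 0%N) 0; rewrite addr0 => ->.
  have := bl y (-1) 0 0; rewrite scaler0 addr0 scaleN1r addNr => ->.
  by rewrite addr0 addrC => /eqP; rewrite addr_eq0 scaleNr => /eqP.
have all0 := frame_eqs3 dimV brP gvolP phiF coclP nablaP instP bA (t := C * r).
have {}all0 i j m : index7 i -> index7 j -> index7 m -> sc b i j m = 0.
  apply: all0 => {i j m}.
  - by move=> j m; apply: (sc_central_l dimV brP nilP gvolP b0A); rewrite b4.
  - by move=> j m; apply: (sc_central_l dimV brP nilP gvolP b0A); rewrite b5.
  - move=> j m; apply: (mulfI (invr_neq0 r0)).
    rewrite /struct_const -(metricZl gP) brz3 (metricZl gP); by field.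
  - move=> i j; rewrite (brE i j 6%N) // (brE i j 0%N) //=; by field.
  - by move=> i j m; rewrite !inE => /or3P[] /eqP->; rewrite brE //=; ring.
apply: (unit_neq0 z11); apply: (derived_detect dimV brP gvolP bO D1) => i j ij j7.
by rewrite -b4 -/(sc b i j 4) all0 //; exact: ltn_trans ij j7.
Qed.

Lemma derived_product : derived e7.
Proof.
have C0 : g z3 e7 != 0.
  by apply/eqP => C0; apply: (unit_neq0 z33); rewrite third_is_product C0 scale0r.
rewrite -[e7](scalerK C0) -third_is_product; exact: (derivedZ gvolP).
Qed.

Section CentralFrame.
Variable b : nat -> V.
Hypothesis bA : adapted g phi b.
Hypothesis b4 : b 4%N = z1.
Hypothesis b5 : b 5%N = z2.
Hypothesis b6 : b 6%N = e7.

Lemma frame_central i j m : (3 < i)%N -> index7 i -> sc b i j m = 0.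
Proof.
move=> i3 i7; apply: (sc_central_l dimV brP nilP gvolP b0A).
have [->|[->|->]] : i = 4%N \/ i = 5%N \/ i = 6%N by move: i3 i7; rewrite /index7; lia.
- by rewrite b4.
- by rewrite b5.
- by rewrite b6; exact: derived_product.
Qed.

Lemma frame_central_r i j m : (3 < j)%N -> index7 j -> sc b i j m = 0.
Proof. by move=> j3 j7; rewrite (struct_constC brP gvolP) frame_central ?oppr0. Qed.

Lemma frame_horizontal i j m : (m < 4)%N -> sc b i j m = 0.
Proof.
move=> m4; have bO := bA.1; have m7 : (m < 7)%N by exact: leq_trans m4 _.
rewrite /struct_const bracket_three third_is_product -b4 -b5 -b6.
rewrite !(metricDl gP) !(metricZl gP) !bO // !gtn_eqF // ?(leq_trans m4) //.
by rewrite !mulr0 !addr0.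
Qed.

Local Notation sd := (sd br g b).
Local Notation asd := (asd br g b).

Lemma frame_duality : exists nu, forall k l, k \in [:: 4; 5; 6]%N -> l \in [:: 4; 5; 6]%N ->
  sd k l = (if k == l then nu else 0) /\ cofactor567 (Rarith R) asd k l = nu * asd k l.
Proof.
apply: (frame_eqs4 dimV brP gvolP phiF coclP nablaP instP bA).
  exact: frame_central. exact: frame_horizontal.
Qed.

Lemma sc_duality k :
  [/\ sc b 0 2 k = (asd k 4 - sd k 4) / 2, sc b 1 3 k = (asd k 4 + sd k 4) / 2 &
      sc b 0 3 k = (sd k 5 - asd k 5) / 2] /\
  [/\ sc b 1 2 k = (sd k 5 + asd k 5) / 2, sc b 0 1 k = (asd k 6 - sd k 6) / 2 &
      sc b 2 3 k = - (asd k 6 + sd k 6) / 2].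
Proof.
rewrite /sd /asd /selfdual_part /antiselfdual_part /=.
by rewrite realZN1 !mulN1r; do !split; lra.
Qed.

Lemma lt4_cases (P : nat -> nat -> Prop) :
  P 0 1 -> P 0 2 -> P 0 3 -> P 1 2 -> P 1 3 -> P 2 3 ->
  forall i j, (i < j)%N -> (j < 4)%N -> P i j.
Proof. by move=> ? ? ? ? ? ? [|[|[|i]]] [|[|[|[|j]]]]. Qed.

(** Otherwise the anti-self-dual parts span at most a line, and the derived
    algebra would not be three-dimensional. *)
Lemma frame_nu_neq0 nu :
  (forall k l, k \in [:: 4; 5; 6]%N -> l \in [:: 4; 5; 6]%N ->
     sd k l = (if k == l then nu else 0) /\ cofactor567 (Rarith R) asd k l = nu * asd k l) ->
  nu != 0.
Proof.
move=> H; apply/eqP => nu0; have bO := bA.1.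
have sd0 k l : k \in [:: 4; 5; 6]%N -> l \in [:: 4; 5; 6]%N -> sd k l = 0.
  by move=> kv lv; have [-> _] := H k l kv lv; rewrite nu0 if_same.
have minor l l' : l \in [:: 4; 5; 6]%N -> l' \in [:: 4; 5; 6]%N ->
    asd 5 l * asd 4 l' = asd 4 l * asd 5 l'.
  have m6 k : k \in [:: 4; 5; 6]%N -> asd 4 (next567 k) * asd 5 (next567 (next567 k))
      - asd 4 (next567 (next567 k)) * asd 5 (next567 k) = 0.
    move=> kv; have [_] := H 6%N k isT kv; rewrite nu0 mul0r => <-.
    by rewrite /cofactor567 /= realZN1 mulN1r.
  move: (m6 4%N isT) (m6 5%N isT) (m6 6%N isT); rewrite /next567 /= => h4 h5 h6.
  by rewrite !inE => /or3P[] /eqP-> /or3P[] /eqP->; lra.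
have row l : l \in [:: 4; 5; 6]%N -> asd 4 l = 0.
  move=> lv; have u0 : asd 5 l *: z1 + - asd 4 l *: z2 = 0.
    apply: (derived_detect dimV brP gvolP bO).
      by apply: (derived_linear gvolP) => //; exact: (derivedZ gvolP).
    move=> i j ij j7; rewrite (metricDr gP) !(metricZr gP) -b4 -b5 -!/(struct_const br g b i j _).
    have [j4|j4] := ltnP j 4; last by rewrite !frame_central_r //; ring.
    have [[a1 a2 a3] [a4 a5 a6]] := sc_duality 4.
    have [[c1 c2 c3] [c4 c5 c6]] := sc_duality 5.
    move: (minor l 4%N lv isT) (minor l 5%N lv isT) (minor l 6%N lv isT) => h4 h5 h6.
    move: a1 a2 a3 a4 a5 a6 c1 c2 c3 c4 c5 c6; rewrite !sd0 // => a1 a2 a3 a4 a5 a6 c1 c2 c3 c4 c5 c6.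
    move: ij j4; apply: (@lt4_cases (fun i j => asd 5 l * sc b i j 4 + - asd 4 l * sc b i j 5 = 0)); rewrite ?a1 ?a2 ?a3 ?a4 ?a5 ?a6 ?c1 ?c2 ?c3 ?c4 ?c5 ?c6; lra.
  have := congr1 (g^~ z2) u0; rewrite (metricDl gP) !(metricZl gP) (metric0l gP) z22 z12; lra.
apply: (unit_neq0 z11); apply: (derived_detect dimV brP gvolP bO D1) => i j ij j7.
rewrite -b4 -/(struct_const br g b i j 4).
have [j4|j4] := ltnP j 4; last by rewrite !frame_central_r.
have [[a1 a2 a3] [a4 a5 a6]] := sc_duality 4.
move: a1 a2 a3 a4 a5 a6; rewrite !sd0 // !row // => a1 a2 a3 a4 a5 a6.
move: ij j4; apply: (@lt4_cases (fun i j => sc b i j 4 = 0)); lra.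
Qed.

Lemma frame_two_form k (e : seq 'Hom(V, R^o)) (w : kform V 2) :
    dual_frame e b -> (0 < k <= 7)%N -> is_form w ->
    (forall i j, (i < j)%N -> (j < 4)%N -> sc b i j k.-1 = - ev b w [:: i; j]) ->
    (forall i j, (i < j)%N -> (3 < j)%N -> index7 j -> ev b w [:: i; j] = 0) ->
  d_basis br e k = w.
Proof.
move=> eb k7 wF w4 w0; apply/(d_basisE dimV brP gP bA eb k7 wF) => i j ij j7.
have [j4|j4] := ltnP j 4; first exact: w4.
by rewrite w0 // frame_central_r // oppr0.
Qed.

Lemma frame_closed k (e : seq 'Hom(V, R^o)) :
  dual_frame e b -> (1 <= k <= 4)%N -> d_basis br e k = 0.
Proof.
move=> eb k4; apply: (frame_two_form eb) => [||i j ij j4|//]; [by lia|exact: is_form0|].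
by rewrite frame_horizontal ?oppr0 //; lia.
Qed.

Lemma ev_monomial2_lt (e : seq 'Hom(V, R^o)) p q i j :
    dual_frame e b -> (p < q)%N -> (q <= 4)%N -> (i < j)%N -> index7 j ->
  ev b (monomial e [:: p; q] : kform V 2) [:: i; j] = ((i == p.-1) && (j == q.-1))%:R.
Proof.
move=> eb pq q4 ij j7; have i7 : index7 i by exact: ltn_trans ij j7.
rewrite (ev_monomial2 eb) //; [|by lia|by lia].
have -> : (j == p.-1) && (i == q.-1) = false by apply/negbTE; lia.
by rewrite subr0.
Qed.

Lemma ev_monomial2_gt (e : seq 'Hom(V, R^o)) p q i j :
    dual_frame e b -> (p < q)%N -> (q <= 4)%N -> (i < j)%N -> (3 < j)%N -> index7 j ->
  ev b (monomial e [:: p; q] : kform V 2) [:: i; j] = 0.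
Proof.
move=> eb pq q4 ij j4 j7; rewrite ev_monomial2_lt //.
by rewrite (_ : (j == _) = false) ?andbF //; lia.
Qed.

Section Equations.
Variable nu : R.
Hypothesis nu0 : nu != 0.
Hypothesis sdE : forall k l, k \in [:: 4; 5; 6]%N -> l \in [:: 4; 5; 6]%N ->
  sd k l = if k == l then nu else 0.

Let nu20 : nu / 2 != 0. Proof. by rewrite mulf_neq0 ?invr_eq0 ?pnatr_eq0. Qed.

Lemma frame_equations2 : (forall k l, k \in [:: 4; 5; 6]%N -> l \in [:: 4; 5; 6]%N -> asd k l = 0) ->
  conclusion br phi.
Proof.
move=> asd0; apply: (conclude dimV gvolP phiF bA) => e eb; constructor 2.
split=> [k k4|]; first exact: frame_closed.
pose m i j p q := ev b (monomial e [:: p; q] : kform V 2) [:: i; j].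
have mE p q i j := @ev_monomial2_lt e p q i j eb.
have m0 p q i j := @ev_monomial2_gt e p q i j eb.
have mF p q := @monomial2_is_form _ _ e p q.
have scE k (kv : k \in [:: 4; 5; 6]%N) := sc_duality k.
have {}scE k : k \in [:: 4; 5; 6]%N -> let d l : R := if k == l then nu else 0 in
    [/\ sc b 0 2 k = - d 4%N / 2, sc b 1 3 k = d 4%N / 2 & sc b 0 3 k = d 5%N / 2] /\
    [/\ sc b 1 2 k = d 5%N / 2, sc b 0 1 k = - d 6%N / 2 & sc b 2 3 k = - d 6%N / 2].
  move=> kv; have := scE k kv; rewrite !sdE // !asd0 // /=.
  by rewrite !add0r ?addr0 ?subr0 ?sub0r.
have m5 i j : ev b (nu / 2 *: ((monomial e [:: 1; 3]%N : kform V 2) - (monomial e [:: 2; 4]%N : kform V 2))) [:: i; j]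
  = nu / 2 * (m i j 1 3 - m i j 2 4) by [].
have m6 i j : ev b (nu / 2 *: (- (monomial e [:: 1; 4]%N : kform V 2) - (monomial e [:: 2; 3]%N : kform V 2))) [:: i; j]
  = nu / 2 * (- m i j 1 4 - m i j 2 3) by [].
have m7 i j : ev b (nu / 2 *: ((monomial e [:: 1; 2]%N : kform V 2) + (monomial e [:: 3; 4]%N : kform V 2))) [:: i; j]
  = nu / 2 * (m i j 1 2 + m i j 3 4) by [].
exists (nu / 2); split=> //.
- apply: (frame_two_form eb) => // [|i j ij j4|i j ij j4 j7].
  + by apply: is_formZ; apply: is_formD => //; apply: is_formN.
  + have /= [[a1 a2 a3] [a4 a5 a6]] := scE 4%N isT.
    move: ij j4; apply: (@lt4_cases (fun i j => sc b i j 4 = - ev b _ [:: i; j]));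
    rewrite m5 /m !mE //= ?mulr0n ?mulr1n; lra.
  + by rewrite m5 /m !m0 // ?addr0 ?oppr0 ?addr0 ?mulr0.
- apply: (frame_two_form eb) => // [|i j ij j4|i j ij j4 j7].
  + by apply: is_formZ; apply: is_formD => //; apply: is_formN.
  + have /= [[a1 a2 a3] [a4 a5 a6]] := scE 5%N isT.
    move: ij j4; apply: (@lt4_cases (fun i j => sc b i j 5 = - ev b _ [:: i; j]));
    rewrite m6 /m !mE //= ?mulr0n ?mulr1n; lra.
  + by rewrite m6 /m !m0 // ?addr0 ?oppr0 ?addr0 ?mulr0.
- apply: (frame_two_form eb) => // [|i j ij j4|i j ij j4 j7].
  + by apply: is_formZ; apply: is_formD.
  + have /= [[a1 a2 a3] [a4 a5 a6]] := scE 6%N isT.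
    move: ij j4; apply: (@lt4_cases (fun i j => sc b i j 6 = - ev b _ [:: i; j]));
    rewrite m7 /m !mE //= ?mulr0n ?mulr1n; lra.
  + by rewrite m7 /m !m0 // ?addr0 ?oppr0 ?addr0 ?mulr0.
Qed.

Lemma frame_equations3 : (forall j m, sc b 0 j m = 0) -> conclusion br phi.
Proof.
move=> c0; apply: (conclude dimV gvolP phiF bA) => e eb; constructor 3.
split=> [k k4|]; first exact: frame_closed.
pose m i j p q := ev b (monomial e [:: p; q] : kform V 2) [:: i; j].
have mE p q i j := @ev_monomial2_lt e p q i j eb.
have m0 p q i j := @ev_monomial2_gt e p q i j eb.
have mF p q := @monomial2_is_form _ _ e p q.
have scE k : k \in [:: 4; 5; 6]%N -> let d l : R := if k == l then nu else 0 in
    [/\ sc b 0 2 k = 0, sc b 1 3 k = d 4%N & sc b 0 3 k = 0] /\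
    [/\ sc b 1 2 k = d 5%N, sc b 0 1 k = 0 & sc b 2 3 k = - d 6%N].
  move=> kv d; have := sdE kv (isT : 4%N \in [:: 4; 5; 6]%N); have := sdE kv (isT : 5%N \in [:: 4; 5; 6]%N).
  have := sdE kv (isT : 6%N \in [:: 4; 5; 6]%N).
  by rewrite /sd /selfdual_part /= realZN1 !c0 /d !mulN1r; do !split; lra.
have m5 i j : ev b ((- 2 * (nu / 2)) *: (monomial e [:: 2; 4]%N : kform V 2)) [:: i; j]
  = (- 2 * (nu / 2)) * m i j 2 4 by [].
have m6 i j : ev b ((- 2 * (nu / 2)) *: (monomial e [:: 2; 3]%N : kform V 2)) [:: i; j]
  = (- 2 * (nu / 2)) * m i j 2 3 by [].
have m7 i j : ev b ((2 * (nu / 2)) *: (monomial e [:: 3; 4]%N : kform V 2)) [:: i; j]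
  = (2 * (nu / 2)) * m i j 3 4 by [].
exists (nu / 2); split=> //.
- apply: (frame_two_form eb) => // [|i j ij j4|i j ij j4 j7].
  + exact: is_formZ.
  + have /= [[a1 a2 a3] [a4 a5 a6]] := scE 4%N isT.
    move: ij j4; apply: (@lt4_cases (fun i j => sc b i j 4 = - ev b _ [:: i; j]));
    rewrite m5 /m !mE //= ?mulr0n ?mulr1n; lra.
  + by rewrite m5 /m !m0 // ?addr0 ?oppr0 ?addr0 ?mulr0.
- apply: (frame_two_form eb) => // [|i j ij j4|i j ij j4 j7].
  + exact: is_formZ.
  + have /= [[a1 a2 a3] [a4 a5 a6]] := scE 5%N isT.
    move: ij j4; apply: (@lt4_cases (fun i j => sc b i j 5 = - ev b _ [:: i; j]));
    rewrite m6 /m !mE //= ?mulr0n ?mulr1n; lra.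
  + by rewrite m6 /m !m0 // ?addr0 ?oppr0 ?addr0 ?mulr0.
- apply: (frame_two_form eb) => // [|i j ij j4|i j ij j4 j7].
  + exact: is_formZ.
  + have /= [[a1 a2 a3] [a4 a5 a6]] := scE 6%N isT.
    move: ij j4; apply: (@lt4_cases (fun i j => sc b i j 6 = - ev b _ [:: i; j]));
    rewrite m7 /m !mE //= ?mulr0n ?mulr1n; lra.
  + by rewrite m7 /m !m0 // ?addr0 ?oppr0 ?addr0 ?mulr0.
Qed.

End Equations.

End CentralFrame.

Lemma three_dim : conclusion br phi.
Proof.
have [x xx xo] := unit_orthogonal gP (s := [:: z1; z2; e7]) b0O isT.
have frame y : g y y = 1 -> g y z1 = 0 -> g y z2 = 0 -> g y e7 = 0 -> exists b,
    [/\ adapted g phi b, b 4%N = z1, b 5%N = z2, b 6%N = e7 & b 0%N = y].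
  move=> yy yz1 yz2 ye7; exists (triple_frame phi b0 z1 z2 y); split=> //.
  apply: (triple_frame_adapted dimV gP phiF b0A) => //; try by rewrite (metricC gP).
  by rewrite -(metric_cross dimV gP phiF b0A) -/e7 (metricC gP).
have [|||b [bA b4 b5 b6 _]] := frame x xx; rewrite ?xo ?inE ?eqxx ?orbT //.
have [nu H] := frame_duality bA b4 b5 b6.
have nu0 := frame_nu_neq0 bA b4 b5 b6 H.
have H1 k l kv lv := proj1 (H k l kv lv).
have [asd0|] := frame_kernel dimV brP gvolP nu0 (frame_central b4 b5 b6) (frame_horizontal bA b4 b5 b6) H.
  exact: (frame_equations2 bA b4 b5 b6 nu0 H1 asd0).
(* [X] is a unit vector orthogonal to the derived algebra that is central. *)
move=> [a [[i0 i04 ai0] aker]]; have bO := bA.1.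
pose X := \sum_(i < 4) a i *: b i.
have Xb j : (j < 7)%N -> g X (b j) = if (j < 4)%N then a j else 0.
  move=> j7; rewrite (metric_suml gP); case: ltnP => j4.
    rewrite (bigD1 (Ordinal j4)) //= (metricZl gP) bO // eqxx mulr1 big1 ?addr0 // => i ij.
    rewrite (metricZl gP) bO ?(leq_trans (ltn_ord i)) // (_ : (_ == _) = false) ?mulr0 //.
    by apply: contraNF ij => /eqP ij; apply/eqP/val_inj.
  rewrite big1 // => i _; rewrite (metricZl gP) bO ?(leq_trans (ltn_ord i)) //.
  by rewrite ltn_eqF ?mulr0 // (leq_trans (ltn_ord i)).
have X0 : X != 0.
  by apply: contraNneq ai0 => X0; have := Xb i0 (leq_trans i04 (isT : (4 <= 7)%N)); rewrite i04 X0 (metric0l gP) => <-.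
have XC w : br X w = 0.
  rewrite (linear_sum_frame dimV gvolP bA w (bracket_linear_r brP X)) big1 // => j _.
  rewrite (orthonormal_expand gP dimV bO (br X (b j))) big1 ?scaler0 // => m _.
  rewrite (_ : g _ _ = 0) ?scale0r // -(aker j m (ltn_ord j) (ltn_ord m)).
  have lin (f : V -> V) : linear f -> f X = \sum_(i < 4) a i *: f (b i).
    move=> fL; rewrite /X; elim/big_rec2: _ => [|i u u' _ <-]; last by rewrite fL.
    by have := fL (-1) 0 0; rewrite scaler0 addr0 scaleN1r addNr.
  rewrite (lin _ (bracket_linear_l brP (b j))) (metric_suml gP).
  by apply: eq_bigr => i _; rewrite (metricZl gP).
have [r r0 rX] := normalize gP X0.
have [|||c [cA c4 c5 c6 c0]] := frame (r *: X) rX; rewrite ?(metricZl gP) -?b4 -?b5 -?b6 ?Xb ?mulr0 //.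
have [mu K] := frame_duality cA c4 c5 c6.
have mu0 := frame_nu_neq0 cA c4 c5 c6 K.
have K1 k l kv lv := proj1 (K k l kv lv).
apply: (frame_equations3 cA c4 c5 c6 mu0 K1) => j m.
rewrite /struct_const c0; have := bracket_linear_l brP (c j) r X 0; rewrite /= XC scaler0 add0r addr0 => ->.
have := bracket_linear_l brP (c j) (-1) 0 0; rewrite /= scaler0 addr0 scaleN1r addNr => ->.
exact: (metric0l gP).
Qed.

End ThreeDimensional.

Section NecessityProof.
Variables (R : realType) (V : vectType R) (br : V -> V -> V) (g : V -> V -> R^o).
Variables (vol : kform V 7) (phi : kform V 3) (nabla : V -> V -> V).
Hypothesis dimV : \dim {:V} = 7%N.
Hypothesis brP : lie_bracket br.
Hypothesis nilP : two_step_nilpotent br.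
Hypothesis gvolP : g2_metric phi g vol.
Hypothesis phiF : is_form phi.
Hypothesis coclP : coclosed br g vol phi.
Hypothesis nablaP : characteristic_connection br g vol phi nabla.
Hypothesis instP : g2_instanton br g vol phi nabla.
Variable b0 : nat -> V.
Hypothesis b0A : adapted g phi b0.

Let gP : inner_product g. Proof. by case: gvolP. Qed.

(** The cases are the dimensions of the derived algebra. *)
Theorem necessity : conclusion br phi.
Proof.
have unit s := derived_unit br gvolP s.
have gC := metricC gP.
have [[z1 [D1 z11 _]]|H0] := unit [::]; last first.
  have [[x [y]]] := nilP; rewrite (H0 (br x y)) ?eqxx //; exact: derived_bracket.
have [[z2 [D2 z22 o2]]|H1] := unit [:: z1]; last first.
  apply: (one_dim dimV brP nilP gvolP phiF coclP nablaP instP b0A D1 z11) => u Du uz.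
  by apply: H1 => // x; rewrite inE => /eqP->.
have z12 : g z1 z2 = 0 by rewrite gC o2 ?inE.
have [[z3 [D3 z33 o3]]|H2] := unit [:: z1; z2]; last first.
  case: (not_two_dim dimV brP nilP gvolP phiF coclP nablaP instP b0A D1 D2 z11 z22 z12) => u Du uz1 uz2.
  by apply: H2 => // x; rewrite !inE => /orP[] /eqP->.
have z13 : g z1 z3 = 0 by rewrite gC o3 ?inE ?eqxx.
have z23 : g z2 z3 = 0 by rewrite gC o3 ?inE ?eqxx ?orbT.
have [[z4 [D4 z44 o4]]|H3] := unit [:: z1; z2; z3]; last first.
  apply: (three_dim dimV brP nilP gvolP phiF coclP nablaP instP b0A D1 D2 D3 z11 z22 z33 z12 z13 z23).
  by move=> u Du uz1 uz2 uz3; apply: H3 => // x; rewrite !inE => /or3P[] /eqP->.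
have z14 : g z1 z4 = 0 by rewrite gC o4 ?inE ?eqxx.
have z24 : g z2 z4 = 0 by rewrite gC o4 ?inE ?eqxx ?orbT.
have z34 : g z3 z4 = 0 by rewrite gC o4 ?inE ?eqxx ?orbT.
case: (@not_four_dim _ _ br g vol phi dimV brP nilP gvolP b0 b0A (nth 0 [:: z1; z2; z3; z4])).
  by move=> [|[|[|[|]]]] [|[|[|[|]]]] //= _ _; rewrite // gC.
by move=> [|[|[|[|]]]].
Qed.

End NecessityProof.

(** * Sufficiency of the structure equations *)

Fixpoint sublists (k : nat) (l : seq nat) : seq (seq nat) :=
  match k, l with
  | 0, _ => [:: [::]]
  | _, [::] => [::]
  | k'.+1, x :: l' => [seq x :: s | s <- sublists k' l'] ++ sublists k l'
  end.

Definition coclosed_check (c : nat -> nat -> nat -> poly) : bool :=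
  all (fun s => nilp (ce_comp Parith 3 c (psi_cst Parith) s)) (sublists 5 (iota 0 7)).

Definition parallel_comp (T : Type) (A : arith T) (gam : nat -> nat -> nat -> T) (x y z w : nat) : T :=
  asum A (iota 0 7) (fun l =>
    aadd A (amul A (gam x y l) (phi_cst A [:: l; z; w]))
      (aadd A (amul A (gam x z l) (phi_cst A [:: y; l; w])) (amul A (gam x w l) (phi_cst A [:: y; z; l])))).

Definition parallel_check (c : nat -> nat -> nat -> poly) : bool :=
  let gam := gamma c in
  all (fun x => all (fun y => all (fun z => all (fun w =>
    nilp (parallel_comp Parith gam x y z w)) (iota 0 7)) (iota 0 7)) (iota 0 7)) (iota 0 7).

Definition instanton_check (c : nat -> nat -> nat -> poly) : bool :=
  let gam := gamma c in
  all (fun a => all (fun z => all (fun s =>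
    nilp (instanton_comp Parith c gam a z s)) (sublists 6 (iota 0 7))) (iota 0 7)) (iota 0 7).

Definition comp_of (d : nat -> seq (poly * nat * nat)) (i j m : nat) : poly :=
  let at_ t k l := if (k == t.1.2.-1) && (l == t.2.-1) then 1%BZ else 0%BZ in
  foldr (fun t p => poly_add (poly_mul (poly_cst (Z.sub (at_ t j i) (at_ t i j))) t.1.1) p) [::] (d m).

Definition equations1 (k : nat) : seq (poly * nat * nat) :=
  if k == 6%N then
    [:: (X 0, 1, 2); (poly_scale (-1)%BZ (X 0), 5, 6); (X 1, 3, 4); (poly_scale (-1)%BZ (X 1), 5, 6)]%N
  else [::].

Definition equations2 (k : nat) : seq (poly * nat * nat) :=
  if k == 4%N then [:: (X 0, 1, 3); (poly_scale (-1)%BZ (X 0), 2, 4)]%N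
  else if k == 5%N then [:: (poly_scale (-1)%BZ (X 0), 1, 4); (poly_scale (-1)%BZ (X 0), 2, 3)]%N
  else if k == 6%N then [:: (X 0, 1, 2); (X 0, 3, 4)]%N
  else [::].

Definition equations3 (k : nat) : seq (poly * nat * nat) :=
  if k == 4%N then [:: (poly_scale (-2)%BZ (X 0), 2, 4)]%N
  else if k == 5%N then [:: (poly_scale (-2)%BZ (X 0), 2, 3)]%N
  else if k == 6%N then [:: (poly_scale 2%BZ (X 0), 3, 4)]%N
  else [::].

Definition check (d : nat -> seq (poly * nat * nat)) : bool :=
  let c := comp_of d in [&& coclosed_check c, parallel_check c & instanton_check c].

Lemma check1 : check equations1. Proof. by vm_compute. Qed.
Lemma check2 : check equations2. Proof. by vm_compute. Qed.
Lemma check3 : check equations3. Proof. by vm_compute. Qed.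

Lemma filter_sublists (p : pred nat) l : filter p l \in sublists (size (filter p l)) l.
Proof.
elim: l => [//|x l IH] /=; case: (p x) => /=.
  by rewrite mem_cat map_f.
by case: (size _) IH => [|k] IH; rewrite ?mem_cat ?IH ?orbT //; case: (l) IH.
Qed.

Lemma wedge_linl (R : realType) (V : vectType R) p q a (w w1 : kform V p) (w' : kform V q) v :
  wedge (fun u => a * w u + w1 u) w' v = a * wedge w w' v + wedge w1 w' v.
Proof.
rewrite /wedge mulrCA -mulrDr; congr (_ * _); rewrite mulr_sumr -big_split.
by apply: eq_bigr => s _ /=; rewrite mulrDr mulrDl !mulrA (mulrC a).
Qed.

Section Sufficiency.
Variables (R : realType) (V : vectType R) (br : V -> V -> V) (g : V -> V -> R^o).
Variables (vol : kform V 7) (phi : kform V 3).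
Hypothesis dimV : \dim {:V} = 7%N.
Hypothesis brP : lie_bracket br.
Hypothesis gvolP : g2_metric phi g vol.
Hypothesis phiF : is_form phi.
Variables (b : nat -> V) (env : nat -> R) (c : nat -> nat -> nat -> poly).
Hypothesis bA : adapted g phi b.
Hypothesis cE : forall i j m, index7 i -> index7 j -> index7 m ->
  struct_const br g b i j m = eval env (c i j m).

Let gP : inner_product g. Proof. by case: gvolP. Qed.
Let volF : is_form vol. Proof. by case: gvolP => _ []. Qed.
Let vol1 : ev b vol (iota 0 7) = 1. Proof. exact: (adapted_vol gvolP phiF bA). Qed.
Let bO : orthonormal g 7 b. Proof. by case: bA. Qed.
Let psiF : is_form (g2_psi g vol phi). Proof. exact: (@hodge_is_form _ _ g 3 4). Qed.

(** A form vanishes as soon as it does on the increasing lists of frame vectors. *)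
Lemma form_eq0 k (w : kform V k) : is_form w ->
  (forall s, s \in sublists k (iota 0 7) -> ev b w s = 0) -> w = 0.
Proof.
move=> wF w0; apply: (frame_ext dimV gP bA) => [||s sk s7]; [by case: wF|by case: (is_form0 V k)|].
rewrite [RHS]/(0 : R); have [us|] := boolP (uniq s); last first.
  case/(uniqPn 0%N) => i [j [ij js nij]]; rewrite sk in js.
  case: wF => _ wr; apply: (wr _ (Ordinal (ltn_trans ij js)) (Ordinal js)); last by rewrite /= nij.
  by rewrite -val_eqE /= neq_ltn ij.
have sr : perm_eq s (filter (mem s) (iota 0 7)).
  apply: uniq_perm => // [|i]; first exact/filter_uniq/iota_uniq.
  rewrite mem_filter mem_iota /=; case si: (i \in s) => //.
  by symmetry; exact: (allP s7 _ si).
rewrite (alt_comp_exchanges (ev_alt_comp b (is_form_alternating wF)) sk sr) w0 ?mulr0 //.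
by rewrite -sk (perm_size sr) filter_sublists.
Qed.

Lemma sublists_index7 k s : s \in sublists k (iota 0 7) -> size s = k /\ all index7 s.
Proof.
have : all index7 (iota 0 7) by [].
elim: (iota 0 7) k s => [|x l IH] [|k] s //=; first by rewrite inE => _ /eqP->.
  by rewrite inE => _ /eqP->.
move=> /andP[x7 l7]; rewrite mem_cat => /orP[/mapP[s' /(IH _ _ l7)[sk s7] ->]|/(IH _ _ l7)//].
by rewrite /= sk x7.
Qed.

Lemma check_coclosed : coclosed_check c -> coclosed br g vol phi.
Proof.
move=> /allP H; apply: form_eq0 => [|s sI]; first exact: (ce_diff_is_form dimV brP gP bA).
have [s5 s7] := sublists_index7 sI.
rewrite (ev_ce_diff br dimV gP bA); last by case: psiF.
transitivity (eval env (ce_comp Parith 3 c (psi_cst Parith) s)).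
  rewrite (hom_ce_comp (eval_hom env) 3 (c' := fun i j m => eval env (c i j m)) (w' := psi_cst (Rarith R))) //.
    by apply: eq_ce_comp => // l l4 l7; exact: (ev_psi dimV gP volF phiF bA vol1).
  by move=> l; exact: eval_cst.
by have /nilP -> := H s sI; rewrite /eval big_nil.
Qed.

(** ** The characteristic connection *)

Lemma represent (f : V -> R) z : (forall a x y, f (a *: x + y) = a * f x + f y) ->
  g (\sum_(k < 7) f (b k) *: b k) z = f z.
Proof.
move=> fL; rewrite [in RHS](orthonormal_expand gP dimV bO z) (metric_suml gP).
rewrite (eq_bigr (fun k : 'I_7 => g z (b k) * f (b k))) => [|k _]; last first.
  by rewrite (metricZl gP) (metricC gP z) mulrC.
elim/big_rec2: _ => [|k x y _ ->]; last by rewrite fL.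
by have := fL (-1) 0 0; rewrite scaler0 addr0; lra.
Qed.

Definition koszul (x y z : V) : R := 2^-1 * (g (br x y) z + g (br z x) y - g (br y z) x).

Definition koszul_connection (x y : V) : V := \sum_(k < 7) koszul x y (b k) *: b k.

Local Notation tor := (g2_torsion br g vol phi).

Let brl a x x' y : br (a *: x + x') y = a *: br x y + br x' y.
Proof. exact: bracket_linl. Qed.
Let brr a x x' y : br y (a *: x + x') = a *: br y x + br y x'.
Proof. exact: bracket_linr. Qed.

Lemma koszul_connectionE x y z : g (koszul_connection x y) z = koszul x y z.
Proof.
apply: represent => a u v.
rewrite /koszul brl brr !(metricDl gP, metricDr gP, metricZl gP, metricZr gP); ring.
Qed.

Lemma koszul_levi_civita : levi_civita br g koszul_connection.
Proof.
have gC := metricC gP; split; [split|] => [|x y z|x y].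
- split=> [y a x x'|x a y y']; apply: (metric_inj gP) => z;
  rewrite (metricDl gP) (metricZl gP) !koszul_connectionE /koszul ?brl ?brr
    !(metricDl gP, metricDr gP, metricZl gP, metricZr gP); ring.
- rewrite (gC y) !koszul_connectionE /koszul (bracketC brP z x) (bracketC brP y x) (bracketC brP z y).
  rewrite !(metricNl gP); ring.
- apply: (metric_inj gP) => z; rewrite /torsion !(metricDl gP) !(metricNl gP) (metric0l gP).
  rewrite !koszul_connectionE /koszul (bracketC brP y x) (bracketC brP z x) (bracketC brP z y).
  rewrite !(metricNl gP); lra.
Qed.

Let torF : is_form tor.
Proof.
apply: is_formD; first exact: is_formZ.
by apply: is_formN; exact: (@hodge_is_form _ _ g 4 3).
Qed.

Section Connection.
Variables (LC nabla : V -> V -> V).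
Hypothesis LCP : levi_civita br g LC.
Hypothesis nablaE : forall x y z, g (nabla x y) z = g (LC x y) z + 2^-1 * tor (vec3 x y z).

Lemma nabla_bilinear : bilinear_map nabla.
Proof.
have [[[nl nr] _] _] := LCP.
by split=> [y a x x'|x a y y']; apply: (metric_inj gP) => z;
  rewrite (metricDl gP) (metricZl gP) !nablaE ?nl ?nr
   ?(phi3_lin0 torF, phi3_lin1 torF) (metricDl gP) (metricZl gP); ring.
Qed.

Lemma nabla_metric : metric_connection g nabla.
Proof.
split=> [|x y z]; first exact: nabla_bilinear.
have [[_ m] _] := LCP; have := m x y z.
rewrite !(metricC gP y) !nablaE (phi3_swap12 torF x z); lra.
Qed.

Lemma nabla_torsion x y : g (torsion br nabla x y) y = 0.
Proof.
have [_ m] := LCP; have := congr1 (g^~ y) (m x y).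
rewrite /torsion !(metricDl gP) !(metricNl gP) (metric0l gP) !nablaE.
have := phi3_swap12 torF x y y; have := phi3_swap12 torF y x y; have := phi3_swap01 torF y y x.
rewrite (phi3_swap01 torF y x y); lra.
Qed.

Local Notation gam := (connection_comp (Rarith R) (struct_const br g b)
  (torsion_comp (Rarith R) (ce_comp (Rarith R) 2 (struct_const br g b) (phi_cst (Rarith R))))).

Lemma nabla_comp x y z : (x < 7)%N -> (y < 7)%N -> (z < 7)%N ->
  12 * g (nabla (b x) (b y)) (b z) = gam x y z.
Proof.
exact: (connection_compE dimV brP gP volF phiF bA vol1 LCP nablaE).
Qed.

Lemma check_parallel : parallel_check c -> parallel nabla phi.
Proof.
move=> H; have [nl nr] := nabla_bilinear; pose N := nabla; rewrite -/N in nl nr.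
pose j1 : 'I_4 := Ordinal (isT : (1 < 4)%N); pose j2 : 'I_4 := Ordinal (isT : (2 < 4)%N).
pose F : kform V 4 := fun v => phi (vec3 (N (v ord0) (v j1)) (v j2) (v ord_max))
  + phi (vec3 (v j1) (N (v ord0) (v j2)) (v ord_max)) + phi (vec3 (v j1) (v j2) (N (v ord0) (v ord_max))).
have F0 : F = 0.
  apply: (frame_ext dimV gP bA); [move=> v i a u u'|by case: (is_form0 V 4)|].
    rewrite /F; have : [\/ i = ord0, i = j1, i = j2 | i = ord_max].
      by case: i => -[|[|[|[|]]]] // i4; [constructor 1|constructor 2|constructor 3|constructor 4]; apply: val_inj.
    by case=> ->; rewrite !fupd_same ?[fupd v _ _ ord0]fupd_other ?[fupd v _ _ j1]fupd_other
      ?[fupd v _ _ j2]fupd_other ?[fupd v _ _ ord_max]fupd_other // ?nl ?nr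
      ?(phi3_lin0 phiF, phi3_lin1 phiF, phi3_lin2 phiF); ring.
  case=> [|x [|y [|z [|w [|]]]]] // _ /and5P[x7 y7 z7 w7 _].
  rewrite [RHS]/(0 : R); apply: (mulfI (_ : 12 != 0 :> R)); first by rewrite pnatr_eq0.
  rewrite mulr0; transitivity (eval env (parallel_comp Parith (gamma c) x y z w)); last first.
    have /nilP -> : nilp (parallel_comp Parith (gamma c) x y z w); last by rewrite /eval big_nil.
    by move: H => /allP/(_ x); rewrite mem_iota => /(_ x7)/allP/(_ y); rewrite mem_iota =>
      /(_ y7)/allP/(_ z); rewrite mem_iota => /(_ z7)/allP/(_ w); rewrite mem_iota => /(_ w7).
  pose n i j l := eval env (gamma c i j l).
  have nE i j (l : 'I_7) : index7 i -> index7 j -> 12 * g (N (b i) (b j)) (b l) = n i j l.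
    by move=> i7 j7; rewrite nabla_comp // -(eval_gamma cE) //; exact: ltn_ord.
  have phiL : multilinear phi by case: phiF.
  have phib i j k : index7 i -> index7 j -> index7 k ->
      phi (vec3 (b i) (b j) (b k)) = phi_cst (Rarith R) [:: i; j; k].
    move=> i7 j7 k7; have [_ phiE] := bA.
    rewrite -[RHS]/(realZ R (phiZ [:: i; j; k])) -phiE //=; last by rewrite i7 j7 k7.
    by congr phi; apply/funext => -[[|[|[|]]]].
  rewrite /ev /F /= !mulrDr.
  have phi0 u p q : phi (vec3 u p q) = \sum_(l < 7) g u (b l) * phi (vec3 (b l) p q).
    rewrite {1}(orthonormal_expand gP dimV bO u) -(vec3_fupd0 0) multilinear_sum //.
    by apply: eq_bigr => l _; rewrite vec3_fupd0.
  have phi1 u p q : phi (vec3 p u q) = \sum_(l < 7) g u (b l) * phi (vec3 p (b l) q).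
    rewrite {1}(orthonormal_expand gP dimV bO u) -(vec3_fupd1 p 0) multilinear_sum //.
    by apply: eq_bigr => l _; rewrite vec3_fupd1.
  have phi2 u p q : phi (vec3 p q u) = \sum_(l < 7) g u (b l) * phi (vec3 p q (b l)).
    rewrite {1}(orthonormal_expand gP dimV bO u) -(vec3_fupd2 p q 0) multilinear_sum //.
    by apply: eq_bigr => l _; rewrite vec3_fupd2.
  rewrite (phi0 (N _ _)) (phi1 (N _ _)) (phi2 (N _ _)) !mulr_sumr.
  rewrite /parallel_comp (hom_asum (eval_hom env) _ (F' := fun l =>
    n x y l * phi_cst (Rarith R) [:: l; z; w] + (n x z l * phi_cst (Rarith R) [:: y; l; w]
    + n x w l * phi_cst (Rarith R) [:: y; z; l]))); last first.
    by move=> l; rewrite !((hom_add (eval_hom env)), (hom_mul (eval_hom env)), (hom_cst (eval_hom env))).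
  rewrite -sum_frame -!big_split; apply: eq_bigr => l _ /=.
  have l7 : index7 l by exact: ltn_ord.
  by rewrite !phib // !mulrA !nE // addrA.
move=> x v; pose y : 'I_4 -> V := fun i => nth 0 [:: x; v ord0; v (lift ord0 ord0); v ord_max] i.
have vE : v = vec3 (v ord0) (v (lift ord0 ord0)) (v ord_max).
  by apply/funext => -[[|[|[|//]]] i3]; rewrite /vec3 /=; congr v; apply: val_inj.
have := congr1 (fun w => w y) F0; rewrite /F /y /= => E.
rewrite !big_ord_recl big_ord0 addr0 (_ : lift ord0 (lift ord0 ord0) = ord_max); last exact: val_inj.
have fu0 t : fupd v ord0 t = vec3 t (v (lift ord0 ord0)) (v ord_max) by rewrite {1}vE vec3_fupd0.
have fu1 t : fupd v (lift ord0 ord0) t = vec3 (v ord0) t (v ord_max) by rewrite {1}vE vec3_fupd1.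
have fu2 t : fupd v ord_max t = vec3 (v ord0) (v (lift ord0 ord0)) t by rewrite {1}vE vec3_fupd2.
by rewrite fu0 fu1 fu2 addrA.
Qed.

Lemma curvature_linear a A A' x y :
  curvature br nabla x y (a *: A + A')
    = a *: curvature br nabla x y A + curvature br nabla x y A'.
Proof.
have [_ nr] := nabla_bilinear; rewrite /curvature !nr.
by apply: (metric_inj gP) => u; rewrite !(metricDl gP, metricNl gP, metricZl gP); ring.
Qed.

Lemma curvature_is_form A B :
  is_form ((fun v => g (curvature br nabla (v ord0) (v ord_max) A) B) : kform V 2).
Proof.
have [nl nr] := nabla_bilinear.
apply: (@pairing_is_form _ _ (fun x y => g (curvature br nabla x y A) B)) => [r x x' y|r x y y'|x].
- by rewrite /curvature brl !nl !nr !(metricDl gP, metricNl gP, metricZl gP); ring.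
- by rewrite /curvature brr !nl !nr !(metricDl gP, metricNl gP, metricZl gP); ring.
- have bxx : br x x = 0 by case: brP.
  rewrite /curvature bxx subrr; have := nl A (-1) 0 0; rewrite scaler0 addr0 scaleN1r addNr => ->.
  by rewrite subrr (metric0l gP).
Qed.

Lemma check_instanton : instanton_check c -> g2_instanton br g vol phi nabla.
Proof.
move=> H A B; set psi := g2_psi g vol phi.
pose W (A B : V) : kform V 6 := @wedge R V 2 4 (fun v => g (curvature br nabla (v ord0) (v ord_max) A) B) psi.
have WL0 a A1 A2 B1 v : W (a *: A1 + A2) B1 v = a * W A1 B1 v + W A2 B1 v.
  rewrite -(wedge_linl (p := 2) (q := 4)); congr (@wedge R V 2 4 _ _ v); apply/funext => u.
  by rewrite curvature_linear (metricDl gP) (metricZl gP).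
have WL1 a A1 B1 B2 v : W A1 (a *: B1 + B2) v = a * W A1 B1 v + W A1 B2 v.
  rewrite -(wedge_linl (p := 2) (q := 4)); congr (@wedge R V 2 4 _ _ v); apply/funext => u.
  by rewrite (metricDr gP) (metricZr gP).
have Wb i j : index7 i -> index7 j -> W (b i) (b j) = 0.
  move=> i7 j7; apply: form_eq0 => [|s sI].
    by apply: (@wedge_is_form R V 2 4); [case: (curvature_is_form (b i) (b j))|case: psiF].
  have [s6 s7] := sublists_index7 sI.
  apply: (mulfI (_ : 144 != 0 :> R)); first by rewrite pnatr_eq0.
  rewrite mulr0 (instanton_compE dimV brP gP volF phiF bA vol1 nabla_bilinear nabla_comp) //.
  rewrite -(eval_instanton cE) //.
  have /nilP -> : nilp (instanton_comp Parith c (gamma c) i j s); last by rewrite /eval big_nil.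
  by move: H => /allP/(_ i); rewrite mem_iota => /(_ i7)/allP/(_ j); rewrite mem_iota => /(_ j7)/allP/(_ s sI).
have sumW (f : V -> R) : (forall a x y, f (a *: x + y) = a * f x + f y) ->
    (forall i : 'I_7, f (b i) = 0) -> forall z, f z = 0.
  move=> fL fb z; rewrite -(represent z fL) big1 ?(metric0l gP) // => k _.
  by rewrite fb scale0r.
apply/funext => v; rewrite -[LHS]/(W A B v).
apply: (sumW (fun A => W A B v)) => [a x y|i]; first exact: WL0.
apply: (sumW (fun B => W (b i) B v)) => [a x y|j]; first exact: WL1.
by rewrite Wb //; exact: ltn_ord.
Qed.

End Connection.

Theorem check_sufficient : coclosed_check c -> parallel_check c -> instanton_check c ->
  coclosed br g vol phi /\
  exists2 nabla, characteristic_connection br g vol phi nabla & g2_instanton br g vol phi nabla.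
Proof.
move=> coclC parC instC; split; first exact: check_coclosed.
pose nabla x y := koszul_connection x y + \sum_(k < 7) (2^-1 * tor (vec3 x y (b k))) *: b k.
have nablaE x y z : g (nabla x y) z = g (koszul_connection x y) z + 2^-1 * tor (vec3 x y z).
  rewrite (metricDl gP); congr (_ + _).
  apply: (represent (f := fun u => 2^-1 * tor (vec3 x y u))) => a u v.
  by rewrite (phi3_lin2 torF); ring.
have LCP := koszul_levi_civita.
exists nabla; last exact: check_instanton LCP nablaE instC.
split; [exact: nabla_metric LCP nablaE|exact: nabla_torsion LCP nablaE| |by exists koszul_connection].
exact: check_parallel LCP nablaE parC.
Qed.

End Sufficiency.

Section FromEquations.
Variables (R : realType) (V : vectType R) (br : V -> V -> V) (g : V -> V -> R^o).
Variables (vol : kform V 7) (phi : kform V 3).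
Hypothesis dimV : \dim {:V} = 7%N.
Hypothesis brP : lie_bracket br.
Hypothesis gvolP : g2_metric phi g vol.
Hypothesis phiF : is_form phi.
Variable e : seq 'Hom(V, R^o).
Hypothesis phiE : phi = g2_model e.
Variable b : nat -> V.
Hypothesis eb : dual_frame e b.

Let gP : inner_product g. Proof. by case: gvolP. Qed.
Let bA : adapted g phi b. Proof. exact: (dual_frame_adapted gvolP phiF phiE eb). Qed.

Local Notation e2 i j := (monomial e [:: i; j]%N : kform V 2).

Lemma comp_ofE (d : nat -> seq (poly * nat * nat)) (env : nat -> R) :
    (forall k t, t \in d k -> (t.1.2.-1 < 7)%N && (t.2.-1 < 7)%N) ->
    (forall k, (k < 7)%N -> d_basis br e k.+1
       = \sum_(t <- d k) eval env t.1.1 *: e2 t.1.2 t.2) ->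
  forall i j m, index7 i -> index7 j -> index7 m ->
    struct_const br g b i j m = eval env (comp_of d i j m).
Proof.
move=> dlt dE i j m i7 j7 m7.
have := ev_d_basis br dimV gP bA eb (k := m.+1) i j m7.
rewrite dE //= => /(congr1 -%R); rewrite opprK => <-; rewrite /comp_of.
have sumE (r : seq (poly * nat * nat)) : ev b (\sum_(t <- r) eval env t.1.1 *: e2 t.1.2 t.2) [:: i; j]
    = \sum_(t <- r) eval env t.1.1 * ev b (e2 t.1.2 t.2) [:: i; j].
  by elim/big_rec2: _ => [//|t x y _ <-].
rewrite sumE; elim: (d m) (dlt m) => [|t r IH] lt; first by rewrite big_nil oppr0 /eval big_nil.
rewrite big_cons opprD IH => [|u ur]; last by apply: lt; rewrite inE ur orbT.
have /andP[p7 q7] := lt t (mem_head t r).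
rewrite /= eval_add eval_mul eval_cst (ev_monomial2 eb) //; congr (_ + _).
case: (_ && _); case: (_ && _); rewrite /= ?realZ0 ?realZ1 ?realZN1; ring.
Qed.

Theorem sufficiency : [\/ structure_eqs1 br e, structure_eqs2 br e | structure_eqs3 br e] ->
  coclosed br g vol phi /\
  exists2 nabla, characteristic_connection br g vol phi nabla & g2_instanton br g vol phi nabla.
Proof.
have main d env : check d ->
    (forall k t, t \in d k -> (t.1.2.-1 < 7)%N && (t.2.-1 < 7)%N) ->
    (forall k, (k < 7)%N -> d_basis br e k.+1 = \sum_(t <- d k) eval env t.1.1 *: e2 t.1.2 t.2) ->
  coclosed br g vol phi /\
  exists2 nabla, characteristic_connection br g vol phi nabla & g2_instanton br g vol phi nabla.
  move=> /and3P[h1 h2 h3] dlt dE.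
  exact: (check_sufficient dimV brP gvolP phiF bA (comp_ofE dlt dE)).
case=> [[d0 [a [a' [_ d7]]]]|[d0 [nu [_ d5 d6 d7]]]|[d0 [nu [_ d5 d6 d7]]]].
- apply: (main equations1 (fun n => if n == 0%N then a else a')) => [|k t|k k7]; first exact: check1.
    by rewrite /equations1; case: (k == 6%N) => //; rewrite !inE => /or4P[] /eqP->.
  rewrite /equations1; have [->|k6] := eqVneq k 6%N; last first.
    by rewrite big_nil d0 //; move: k6 k7; lia.
  rewrite d7 !big_cons big_nil !eval_scale !evalX /= realZN1 !mulN1r !scaleNr !scalerBr.
  by rewrite addr0 !addrA.
- apply: (main equations2 (fun=> nu)) => [|k t|k k7]; first exact: check2.
    by rewrite /equations2; do 3![case: ifP => _; first by rewrite !inE => /orP[] /eqP->].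
  rewrite /equations2; have [->|k4] := eqVneq k 4%N.
    by rewrite d5 !big_cons big_nil !eval_scale !evalX /= realZN1 mulN1r scaleNr scalerBr addr0.
  have [->|k5] := eqVneq k 5%N.
    by rewrite d6 !big_cons big_nil !eval_scale !evalX /= realZN1 mulN1r !scaleNr scalerBr scalerN addr0.
  have [->|k6] := eqVneq k 6%N.
    by rewrite d7 !big_cons big_nil !evalX /= scalerDr addr0.
  by rewrite big_nil d0 //; move: k4 k5 k6 k7; lia.
- apply: (main equations3 (fun=> nu)) => [|k t|k k7]; first exact: check3.
    by rewrite /equations3; do 3![case: ifP => _; first by rewrite !inE => /eqP->].
  have Z2 : realZ R 2%BZ = 2 by []. have ZN2 : realZ R (-2)%BZ = - 2 by [].
  rewrite /equations3; have [->|k4] := eqVneq k 4%N.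
    by rewrite d5 !big_cons big_nil !eval_scale !evalX /= ZN2 addr0.
  have [->|k5] := eqVneq k 5%N.
    by rewrite d6 !big_cons big_nil !eval_scale !evalX /= ZN2 addr0.
  have [->|k6] := eqVneq k 6%N.
    by rewrite d7 !big_cons big_nil !eval_scale !evalX /= Z2 addr0.
  by rewrite big_nil d0 //; move: k4 k5 k6 k7; lia.
Qed.

End FromEquations.

Theorem theorem1p1 (R : realType) (V : vectType R) (br : V -> V -> V)
    (phi : kform V 3) (g : V -> V -> R^o) (vol : kform V 7)
    (dimV : \dim {:V} = 7%N)
    (lieV : lie_bracket br)
    (nilV : two_step_nilpotent br)
    (G2phi : g2_structure phi)
    (gvolE : g2_metric phi g vol) :
  (coclosed br g vol phi /\
     exists2 nabla : V -> V -> V,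
       characteristic_connection br g vol phi nabla &
       g2_instanton br g vol phi nabla)
  <->
  (exists e : 7.-tuple 'Hom(V, R^o),
     [/\ basis_of fullv e,
         phi = g2_model e &
         [\/ structure_eqs1 br e, structure_eqs2 br e | structure_eqs3 br e]]).
Proof.
have phiF : is_form phi by have [e _ ->] := G2phi; exact: g2_model_is_form.
split=> [[cocl [nabla nablaP inst]]|[e [ebase phiE eqs]]].
  have [e ebase phiE] := G2phi; have [b eb] := dual_frame_exists ebase.
  have bA := dual_frame_adapted gvolE phiF phiE eb.
  exact: (necessity dimV lieV nilV gvolE phiF cocl nablaP inst bA).
have [b eb] := dual_frame_exists ebase.
exact: (sufficiency dimV lieV gvolE phiF phiE eb eqs).
Qed.
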